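(* Let $N\ge3$ and $1<p<N$, let $V:(0,+\infty)\to[0,+\infty]$ be a measurable function such that $V\in L^1((r_1,r_2))$ for some $r_2>r_1>0$, and let $K:(0,+\infty)\to(0,+\infty)$ be a measurable function such that $K\in L^s_{\mathrm{loc}}((0,+\infty))$ for some $s>1$. Assume that there exists $R_1>0$ such that $V(r)<+\infty$ for almost every $r\in(0,R_1)$, $$\operatorname*{ess\,sup}_{r\in(0,R_1)}\frac{K(r)}{r^{\alpha_0}V(r)^{\beta_0}}<+\infty\quad\text{for some } 0\le\beta_0\le1 \text{ and } \alpha_0\in\mathbb{R},$$ and $$\operatorname*{ess\,inf}_{r\in(0,R_1)} r^{\gamma_0}V(r)>0\quad\text{for some }\gamma_0\ge p.$$ Then $$\lim_{R\to0^+}\mathcal{R}_0(q_1,R)=0$$ for every $q_1\in\mathbb{R}$ such that $(\alpha_0,q_1)\in\mathcal{A}_{\beta_0,\gamma_0}$, where the region $\mathcal{A}_{\beta,\gamma}$ of the $\alpha q$-plane is defined in the context.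
   Context: $B_R=\{x\in\mathbb{R}^N:|x|<R\}$. For $1<p<N$, $p^*=pN/(N-p)$ and $D^{1,p}(\mathbb{R}^N)=\{u\in L^{p^*}(\mathbb{R}^N):\nabla u\in L^p(\mathbb{R}^N)\}$ is the usual homogeneous Sobolev space; $D^{1,p}_{\mathrm{rad}}(\mathbb{R}^N)$ is its subspace of radial functions. $W:=D^{1,p}(\mathbb{R}^N)\cap L^p(\mathbb{R}^N,V(|x|)dx)$ and $W_r:=D^{1,p}_{\mathrm{rad}}(\mathbb{R}^N)\cap L^p(\mathbb{R}^N,V(|x|)dx)$, both with norm $\|u\|^p:=\int_{\mathbb{R}^N}\left(|\nabla u|^p+V(|x|)|u|^p\right)dx$. For $R>0$ and $q>1$ (values in $[0,+\infty]$): $$\mathcal{R}_0(q,R):=\sup_{u\in W_r,\ h\in W,\ \|u\|=\|h\|=1}\int_{B_R}K(|x|)|u|^{q-1}|h|\,dx.$$ For $\alpha\in\mathbb{R}$, $\beta\le1$, $\gamma\in\mathbb{R}$ set $$q_*=q_*(\alpha,\beta,\gamma):=p\,\frac{\alpha-\gamma\beta+N}{N-\gamma}\ (\gamma\ne N),\qquad q_{**}=q_{**}(\alpha,\beta,\gamma):=p\,\frac{p\alpha+(1-p\beta)\gamma+p(N-1)}{p(N-1)-\gamma(p-1)}\ \left(\gamma\neq\tfrac{p}{p-1}(N-1)\right).$$ For $\beta\in[0,1]$ and $\gamma\ge p$ the set $\mathcal{A}_{\beta,\gamma}\subset\mathbb{R}^2$ is (note $\frac{p}{p-1}(N-1)>N$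 since $p<N$): - if $p\le\gamma<N$: $\mathcal{A}_{\beta,\gamma}:=\{(\alpha,q):\max\{1,p\beta\}<q<\min\{q_*,q_{**}\}\}$; - if $\gamma=N$: $\mathcal{A}_{\beta,\gamma}:=\{(\alpha,q):\max\{1,p\beta\}<q<q_{**},\ \alpha>-(1-\beta)N\}$; - if $N<\gamma<\frac{p}{p-1}(N-1)$: $\mathcal{A}_{\beta,\gamma}:=\{(\alpha,q):\max\{1,p\beta,q_*\}<q<q_{**}\}$; - if $\gamma=\frac{p}{p-1}(N-1)$: $\mathcal{A}_{\beta,\gamma}:=\{(\alpha,q):\max\{1,p\beta,q_*\}<q,\ \alpha>-(1-\beta)\gamma\}$; - if $\gamma>\frac{p}{p-1}(N-1)$: $\mathcal{A}_{\beta,\gamma}:=\{(\alpha,q):\max\{1,p\beta,q_*,q_{**}\}<q\}$. Conventions: $V(r)^0=1$ for every $r$ (even if $V(r)=0$); the quotient $K(r)/(r^{\alpha}V(r)^{\beta})$ is $+\infty$ where its denominator vanishes. *)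

(* Defs.v *)
From HB Require Import structures.
From mathcomp Require Import all_boot all_order all_algebra.
From mathcomp Require Import all_classical all_reals all_analysis.
From mathcomp Require Import measurable_realfun ess_sup_inf.
Import Order.TTheory GRing.Theory Num.Theory.
Import numFieldNormedType.Exports.

Set Implicit Arguments.
Unset Strict Implicit.
Unset Printing Implicit Defensive.

Local Open Scope classical_set_scope.
Local Open Scope ring_scope.

(* R^n is 'rV[R]_n with the sigma-algebra generated by the coordinates, that
   is, the Borel one. *)

Definition rV_display : measure_display -> measure_display.
Proof. exact. Qed.

Definition rV_coord (R : realType) (n : nat) (i : 'I_n) (x : 'rV[R]_n) : R :=
  x ord0 i.

Section measurable_rV.
Context (R : realType) (n : nat).

Let coords : 'I_n -> 'rV[R]_n -> R := @rV_coord R n.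

Let rV_set0 : g_sigma_preimage coords set0.
Proof. exact: sigma_algebra0. Qed.

Let rV_setC A : g_sigma_preimage coords A -> g_sigma_preimage coords (~` A).
Proof. exact: sigma_algebraC. Qed.

Let rV_bigcup (F : _^nat) : (forall i, g_sigma_preimage coords (F i)) ->
  g_sigma_preimage coords (\bigcup_i (F i)).
Proof. exact: sigma_algebra_bigcup. Qed.

HB.instance Definition _ := @isMeasurable.Build
  (rV_display default_measure_display) 'rV[R]_n
  (g_sigma_preimage coords) rV_set0 rV_setC rV_bigcup.

End measurable_rV.

Lemma measurable_rV_coord (R : realType) (n : nat) (i : 'I_n) :
  measurable_fun [set: 'rV[R]_n] (@rV_coord R n i).
Proof.
move=> _ Y mY; rewrite setTI; apply: sub_sigma_algebra => /=.
rewrite -bigcup_seq/=; exists i => /=; first by rewrite mem_index_enum.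
by exists Y => //; rewrite setTI.
Qed.

Lemma measurable_fun_rV d (T : measurableType d) (R : realType) (n : nat)
    (f : T -> 'rV[R]_n) :
  (forall i, measurable_fun setT (rV_coord i \o f)) -> measurable_fun setT f.
Proof.
move=> mf _ A mA; rewrite setTI.
pose G := [set B : set 'rV[R]_n | measurable (f @^-1` B)].
suff: G A by [].
have : g_sigma_preimage (@rV_coord R n) A by exact: mA.
apply; split.
  split => /=.
  - by rewrite /G /= preimage_set0.
  - by move=> B GB; rewrite /G /= setTD preimage_setC; exact: measurableC.
  - move=> F GF; rewrite /G /= preimage_bigcup.
    by apply: bigcupT_measurable => k; exact: GF.
move=> B /=; rewrite -bigcup_seq => -[/= i _ [Y mY <-]].
rewrite /G /= setTI -comp_preimage -[X in measurable X]setTI.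
exact: mf.
Qed.

(* Lebesgue measure on R^n: the n-fold product of the one on R. *)

Definition rV_cons (R : realType) (n : nat) (xv : R * 'rV[R]_n) : 'rV[R]_n.+1 :=
  \row_i (if unlift ord0 i is Some j then xv.2 ord0 j else xv.1).

Definition rV_uncons (R : realType) (n : nat) (w : 'rV[R]_n.+1) : R * 'rV[R]_n :=
  (w ord0 ord0, \row_j w ord0 (lift ord0 j)).

Lemma rV_consK (R : realType) (n : nat) : cancel (@rV_cons R n) (@rV_uncons R n).
Proof.
move=> [x v]; rewrite /rV_uncons /rV_cons /= mxE unlift_none; congr pair.
by apply/rowP => j; rewrite !mxE liftK.
Qed.

Lemma measurable_rV_cons (R : realType) (n : nat) :
  measurable_fun setT (@rV_cons R n).
Proof.
apply: measurable_fun_rV => i; have [j ->|->] := unliftP ord0 i; last first.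
  apply: (eq_measurable_fun fst) => // xv _.
  by rewrite /= /rV_coord mxE unlift_none.
apply: (eq_measurable_fun (rV_coord j \o snd)) => [xv _|].
  by rewrite /= /rV_coord mxE liftK.
by apply: measurableT_comp => //; exact: measurable_rV_coord.
Qed.

Lemma measurable_rV_uncons (R : realType) (n : nat) :
  measurable_fun setT (@rV_uncons R n).
Proof.
apply/measurable_fun_pairP; split; first exact: (measurable_rV_coord ord0).
apply: measurable_fun_rV => j.
apply: (eq_measurable_fun (rV_coord (lift ord0 j))) => [w _|].
  by rewrite /rV_coord /= mxE.
exact: measurable_rV_coord.
Qed.

Section lebesgue_rV_succ.
Context (R : realType) (n : nat).
Context (m : {sigma_finite_measure set 'rV[R]_n -> \bar R}).

Definition lebesgue_rV_succ : set 'rV[R]_n.+1 -> \bar R :=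
  pushforward (@lebesgue_measure R \x m)%E (@rV_cons R n).

Let mu0 : lebesgue_rV_succ set0 = 0%E.
Proof. by rewrite /lebesgue_rV_succ /pushforward preimage_set0 measure0. Qed.

Let mu_ge0 A : (0 <= lebesgue_rV_succ A)%E.
Proof. exact: (@measure_ge0 _ _ _ (@lebesgue_measure R \x m)%E). Qed.

Let measurable_preimage_cons (A : set 'rV[R]_n.+1) :
  measurable A -> measurable (@rV_cons R n @^-1` A).
Proof.
by move=> mA; rewrite -[X in measurable X]setTI; exact: measurable_rV_cons.
Qed.

Let mu_sigma_additive : semi_sigma_additive lebesgue_rV_succ.
Proof.
move=> F mF tF mUF; rewrite /lebesgue_rV_succ /pushforward preimage_bigcup.
apply: measure_semi_sigma_additive.
- by move=> k; exact: measurable_preimage_cons.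
- apply/trivIsetP => /= i j _ _ ij; rewrite -preimage_setI.
  by move/trivIsetP : tF => /(_ _ _ _ _ ij) ->//; rewrite preimage_set0.
- by rewrite -preimage_bigcup; exact: measurable_preimage_cons.
Qed.

HB.instance Definition _ := isMeasure.Build _ _ _ lebesgue_rV_succ
  mu0 mu_ge0 mu_sigma_additive.

Let mu_sigma_finite : sigma_finite setT lebesgue_rV_succ.
Proof.
have /sigma_finiteP[F [TF ndF Foo]] := sigma_finiteT (@lebesgue_measure R).
have /sigma_finiteP[G [TG ndG Goo]] := sigma_finiteT m.
exists (fun k => @rV_uncons R n @^-1` (F k `*` G k)).
  rewrite -preimage_bigcup; apply/esym; rewrite -subTset => w _.
  have [k _ Fk] : (\bigcup_k F k) (w ord0 ord0) by rewrite -TF.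
  have [l _ Gl] : (\bigcup_k G k) (rV_uncons w).2 by rewrite -TG.
  exists (maxn k l) => //; split.
    by move: Fk; exact/subsetPset/ndF/leq_maxl.
  by move: Gl; exact/subsetPset/ndG/leq_maxr.
move=> k; have [mF Fk] := Foo k; have [mG Gk] := Goo k; split.
  rewrite -[X in measurable X]setTI; apply: measurable_rV_uncons => //.
  exact: measurableX.
rewrite /lebesgue_rV_succ /pushforward (_ : _ @^-1` _ = F k `*` G k).
  by rewrite product_measure1E// lte_mul_pinfty// ge0_fin_numE.
rewrite -comp_preimage (_ : _ \o _ = id) ?preimage_id//.
by apply/funext => xv; exact: rV_consK.
Qed.

HB.instance Definition _ := Measure_isSigmaFinite.Build _ _ _ lebesgue_rV_succ
  mu_sigma_finite.

End lebesgue_rV_succ.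

Fixpoint lebesgue_rV (R : realType) (n : nat) :
    {sigma_finite_measure set 'rV[R]_n -> \bar R} :=
  match n with
  | 0 => \d_(0 : 'rV[R]_0)
  | n'.+1 => lebesgue_rV_succ (lebesgue_rV R n')
  end.

(* Measurability on the line for the Lebesgue sigma-algebra, i.e. the completion
   of the Borel one.  The measures used below live on the Borel sigma-algebras;
   as \int is defined by simple functions from below, \int of a nonnegative
   function that is only Lebesgue measurable is its Lebesgue integral. *)
Definition lebesgue_measurable_fun d (T : measurableType d) (R : realType)
    (D : set R) (f : R -> T) : Prop :=
  measurable_fun
    (D : set (g_sigma_algebraType (completed_algebra_gen (@lebesgue_measure R)))) f.

Section Sobolev.
Context (R : realType) (N : nat).
Local Notation RN := 'rV[R]_N.
Local Notation mu := (lebesgue_rV R N).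

(* The Euclidean norm; the library norm on matrices is the sup norm. *)
Definition enorm (x : RN) : R := Num.sqrt (\sum_i x ord0 i ^+ 2).

Definition eball (r : R) : set RN := [set x | enorm x < r].

Definition partial (i : 'I_N) (f : RN -> R) (x : RN) : R :=
  'D_(delta_mx ord0 i) f x.

Fixpoint Ck (k : nat) (f : RN -> R) : Prop :=
  match k with
  | 0 => continuous f
  | k'.+1 => continuous f /\
      forall i, (forall x, derivable f x (delta_mx ord0 i)) /\ Ck k' (partial i f)
  end.

Definition test_function (phi : RN -> R) : Prop :=
  (forall k, Ck k phi) /\ compact (closure [set x | phi x != 0]).

Definition locally_L1 (f : RN -> R) : Prop :=
  forall A : set RN, compact A -> mu.-integrable A (EFin \o f).

Definition is_weak_gradient (u : RN -> R) (g : RN -> RN) : Prop :=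
  locally_L1 u /\
  forall i, locally_L1 (fun x => g x ord0 i) /\
    forall phi, test_function phi ->
      (\int[mu]_x (u x * partial i phi x) = - \int[mu]_x (g x ord0 i * phi x))%R.

(* The weak gradient is unique up to a null set; this is one representative when
   u is weakly differentiable, and 0 otherwise. *)
Definition weak_gradient (u : RN -> R) : RN -> RN :=
  xget (cst 0) [set g | is_weak_gradient u g].

Definition sobolev_exponent (p : R) : R := p * N%:R / (N%:R - p).

(* Function spaces are predicates on Borel representatives. *)
Definition D1p (p : R) (u : RN -> R) : Prop :=
  [/\ u \in Lfun mu (sobolev_exponent p)%:E,
      exists g, is_weak_gradient u g &
      (fun x => enorm (weak_gradient u x)) \in Lfun mu p%:E].

Definition radial (u : RN -> R) : Prop :=
  exists f : R -> R, {ae mu, forall x, u x = f (enorm x)}.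

Section weighted.
Context (p : R) (V : R -> \bar R) (K : R -> R).

Definition W (u : RN -> R) : Prop :=
  D1p p u /\ (\int[mu]_x (V (enorm x) * (`|u x| `^ p)%:E) < +oo)%E.

Definition Wr (u : RN -> R) : Prop := W u /\ radial u.

Definition Wnorm (u : RN -> R) : \bar R :=
  ((\int[mu]_x ((enorm (weak_gradient u x) `^ p)%:E +
                V (enorm x) * (`|u x| `^ p)%:E)) `^ p^-1)%E.

Definition R0 (q r : R) : \bar R :=
  ereal_sup [set t : \bar R | exists u h : RN -> R,
    [/\ Wr u, W h, Wnorm u = 1%E, Wnorm h = 1%E &
        t = (\int[mu]_(x in eball r)
               (K (enorm x) * `|u x| `^ (q - 1) * `|h x|)%:E)%E]].

End weighted.
End Sobolev.

Arguments R0 {R} N p V K q r.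

Definition q_star (R : realType) (N : nat) (p alpha beta gamma : R) : R :=
  p * ((alpha - gamma * beta + N%:R) / (N%:R - gamma)).

Definition q_sstar (R : realType) (N : nat) (p alpha beta gamma : R) : R :=
  p * ((p * alpha + (1 - p * beta) * gamma + p * (N%:R - 1)) /
       (p * (N%:R - 1) - gamma * (p - 1))).

(* The set A_(beta,gamma), meant for 0 <= beta <= 1 and p <= gamma. *)
Definition region (R : realType) (N : nat) (p beta gamma : R) : set (R * R) :=
  let n : R := N%:R in
  let gamma_c := p / (p - 1) * (n - 1) in
  [set aq | let alpha := aq.1 in let q := aq.2 in
    let qs := q_star N p alpha beta gamma in
    let qss := q_sstar N p alpha beta gamma in
    let m := Num.max 1 (p * beta) in
    if gamma < n then m < q < Num.min qs qss
    else if gamma == n then [&& m < q, q < qss & - (1 - beta) * n < alpha]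
    else if gamma < gamma_c then Num.max m qs < q < qss
    else if gamma == gamma_c then (Num.max m qs < q) && (- (1 - beta) * gamma < alpha)
    else Num.max (Num.max m qs) qss < q].

(* Main.v *)
(* Near the origin K <= L r^alpha V^beta and V >= c r^-gamma.  Let M be
   V max(|u|, |h|)^p, whose integral is at most 2.

   If q < p, then K |u|^(q-1) |h| <= C r^e M^(q/p) with
   e = alpha + gamma (q/p - beta), and Young's inequality bounds this by the
   maximum of eps M and C_eps r^(e p / (p - q)); the power is integrable at the
   origin because q (N - gamma) < p (alpha - gamma beta + N).

   If q >= p, then K |u|^(q-1) |h| <= C r^(alpha + gamma (1 - beta)) |u|^(q-p) M.
   The radial function u is at most C |x|^-nu with nu = (N - 1 - gamma + gamma/p) / p,
   which leaves a positive power of r in front of M because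
   q (p (N - 1) - gamma (p - 1)) < p (p alpha + (1 - p beta) gamma + p (N - 1)).

   For the decay of u, test the weak gradient against x_i chi(|x|^2), where chi
   rises from 0 to 1 across a layer of thickness e at |x| = a and falls back to 0
   across a < |x| < a (1 + d).  As e tends to 0, at a Lebesgue point a of the profile
   of u, |u(a)| a^N <= C (d^-1 int |u| + a int |grad u|) over this shell; choose
   d = a^(gamma/p - 1) and apply Young's inequality to both integrals.

   As V and K are only Lebesgue measurable, the integrals are lower integrals:
   they are monotone almost everywhere and can be split along Borel sets, but
   they are not additive.

   The supremum defining R0 is over a nonempty set, hence nonnegative: a smooth
   function of |x|^2 supported in r1 < |x| < r2, where V is integrable, is in W_r.  By
   integration by parts its classical gradient is a weak gradient, and weak
   gradients are unique almost everywhere. *)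

Require Import Defs.
From mathcomp Require Import all_boot all_order all_algebra.
From mathcomp Require Import all_classical all_reals all_analysis.
From mathcomp Require Import measurable_realfun ess_sup_inf.
From mathcomp Require Import ring lra zify.
Import Order.TTheory GRing.Theory Num.Theory.
Import numFieldNormedType.Exports.

Set Implicit Arguments.
Unset Strict Implicit.
Unset Printing Implicit Defensive.

Local Open Scope classical_set_scope.
Local Open Scope ring_scope.

(** * Lower integrals *)

(** The maximum of |u| and |h| takes the place of Hölder's inequality, whose usual form presupposes
    measurable factors: the single function M is split along the Borel set where |h| <= |u|, at the
    price of a factor 2. Young's inequality is likewise stated with a maximum, which a split along a
    set takes apart.

    V is bounded from below, so V^beta can be raised to V^(q/p) or to V at the cost of a power of r;
    this is where p beta < q and beta <= 1 enter.

    On the shell at radius a the L^p norm of u is at most of order a^(gamma/p), that of its gradient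
    at most 1. The thickness a d is the quotient of the two, which makes both terms of the bound
    comparable; d <= 1 is gamma >= p. As the shell has volume of order a^N d, both terms are of
    order a (a^N d)^(1 - 1/p), and this gives nu.

    The five cases of the region are one pair of inequalities, with the denominators of the two
    thresholds cleared; where a denominator vanishes, the condition on alpha takes the place of its
    threshold. *)

Section lower_integral.
Local Open Scope ereal_scope.
Context d (T : measurableType d) (R : realType).
Variable mu : {measure set T -> \bar R}.
Implicit Types f g X Y Z : T -> \bar R.
Import HBNNSimple.

(** A simple function below [f], cut off to 0 on the null set, lies below [g] and keeps its
    integral. *)
Let le_integral_ae0 f g : (forall x, 0 <= f x) -> (forall x, 0 <= g x) ->
  {ae mu, forall x, f x <= g x} -> \int[mu]_x f x <= \int[mu]_x g x.
Proof.
move=> f0 g0 [A [mA muA fgA]].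
rewrite !ge0_integralTE//; apply: ge_ereal_sup => _ [s sf <-].
rewrite -integralT_nnsfun.
have mCA := measurableC mA.
have -> : \int[mu]_x (s x)%:E = sintegral mu (proj_nnsfun s mCA).
  rewrite -integralT_nnsfun; apply: ge0_ae_eq_integral => //.
  - exact/measurable_EFinP/measurable_funP.
  - exact/measurable_EFinP/measurable_funP.
  - by move=> x _; rewrite lee_fin.
  - by move=> x _; rewrite lee_fin.
  - exists A; split => // x /= /not_implyP[_ sx]; apply: contrapT => Ax.
    by apply: sx => /=; rewrite mindicE in_setC memNset// mulr1.
apply: ereal_sup_ubound; exists (proj_nnsfun s mCA) => //= x.
rewrite mindicE in_setC; have [xA|xA] := boolP (x \in A).
  by rewrite mulr0.
rewrite mulr1 (le_trans (sf x))//; apply: contrapT => fgx.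
by move: xA; rewrite notin_setE; apply; exact: fgA.
Qed.

Lemma le_integral_ae f g : {ae mu, forall x, f x <= g x} ->
  \int[mu]_x f x <= \int[mu]_x g x.
Proof.
move=> fg; rewrite integralE [leRHS]integralE; apply: leeB.
  apply: le_integral_ae0 => //; apply: filterS fg => x fgx.
  by rewrite !funeposE ge_max le_max fgx/= le_max lexx orbT.
apply: le_integral_ae0 => //; apply: filterS fg => x fgx.
by rewrite !funenegE ge_max le_max leeN2 fgx/= le_max lexx orbT.
Qed.

Lemma eq_integral_ae f g : {ae mu, forall x, f x = g x} ->
  \int[mu]_x f x = \int[mu]_x g x.
Proof.
move=> fg; apply/eqP; rewrite eq_le; apply/andP; split; apply: le_integral_ae;
  by apply: filterS fg => x ->.
Qed.

Lemma integral_ae_ge0 f : {ae mu, forall x, 0 <= f x} -> 0 <= \int[mu]_x f x.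
Proof. by move=> f0; rewrite -(integral0 mu setT); exact: le_integral_ae. Qed.

(** It suffices to bound the simple functions below the positive part, since the negative part only
    lowers the integral of [f]. *)
Let integral_pos_le f (g : \bar R) : (forall s : {nnsfun T >-> R},
    (forall x, (s x)%:E <= f ^\+ x) -> \int[mu]_x (s x)%:E <= g) ->
  \int[mu]_x f x <= g.
Proof.
move=> sg; apply: (@le_trans _ _ (\int[mu]_x f ^\+ x)).
  by apply: le_integral_ae; apply: nearW => x; rewrite !funeposE le_max lexx.
rewrite ge0_integralTE//; apply: ge_ereal_sup => _ [s sf <-].
by rewrite -integralT_nnsfun; exact: sg.
Qed.

(* [X] and [Y] need not be measurable, so additivity of the integral is not
   available; only the set along which the domination is split must be. *)
Lemma le_integral_split (A : set T) f X Y : measurable A ->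
  (forall x, 0 <= X x) -> (forall x, 0 <= Y x) ->
  {ae mu, forall x, A x -> f x <= X x} ->
  {ae mu, forall x, ~ A x -> f x <= Y x} ->
  \int[mu]_x f x <= \int[mu]_x X x + \int[mu]_x Y x.
Proof.
move=> mA X0 Y0 fX fY; apply: integral_pos_le => s sf.
have ms : measurable_fun setT (EFin \o s) by exact/measurable_EFinP/measurable_funP.
rewrite -[in leLHS](setUv A) ge0_integral_setU ?setUv//; last 3 first.
- exact: measurableC.
- by move=> x _; rewrite lee_fin.
- by rewrite disj_set2E setICr.
apply: leeD; rewrite integral_mkcond; apply: le_integral_ae.
  apply: filterS fX => x fX; rewrite patchE; case: ifPn => [|_]; last exact: X0.
  rewrite inE => /fX fXx; rewrite (le_trans (sf x))//.
  by rewrite !funeposE ge_max fXx X0.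
apply: filterS fY => x fY; rewrite patchE; case: ifPn => [|_]; last exact: Y0.
rewrite inE => /fY fYx; rewrite (le_trans (sf x))//.
by rewrite !funeposE ge_max fYx Y0.
Qed.

(** For a simple function [s] below the positive part of [f], the set where [s <= Z] is measurable
    because [Z] is. On it [s] is charged to [Z], off it to [X], and [le_integral_split] applies. *)
Lemma le_integral_max f X Z : (forall x, 0 <= X x) -> (forall x, 0 <= Z x) ->
  measurable_fun setT Z -> {ae mu, forall x, f x <= maxe (X x) (Z x)} ->
  \int[mu]_x f x <= \int[mu]_x X x + \int[mu]_x Z x.
Proof.
move=> X0 Z0 mZ fXZ; apply: integral_pos_le => s sf.
have ms : measurable_fun setT (EFin \o s) by exact/measurable_EFinP/measurable_funP.
rewrite addeC; apply: (@le_integral_split [set x | (s x)%:E <= Z x]) => //.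
- by rewrite -[X in measurable X]setTI; exact: measurable_lee.
- by apply: nearW => x.
- apply: filterS fXZ => x fx /= /negP; rewrite -ltNge => Zs.
  have := sf x; rewrite funeposE le_max => /orP[sfx|].
    by have := le_trans sfx fx; rewrite le_max => /orP[//|/(lt_le_trans Zs)]; rewrite ltxx.
  by move=> s0; exact: le_trans s0 (X0 x).
Qed.

End lower_integral.

(** * Lebesgue measure and Euclidean balls *)

Section dilation.
Context (R : realType).
Local Notation leb := (@lebesgue_measure R).

(** Up to the factor [l], the image of Lebesgue measure under the dilation gives every half-open
    interval its length, and this determines Lebesgue measure. *)
Lemma lebesgue_measure_dilation (l : R) (A : set R) : 0 < l -> measurable A ->
  leb ((fun x => l * x) @^-1` A) = ((l^-1)%:E * leb A)%E.
Proof.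
move=> l0 mA.
pose fl : measurableTypeR R -> measurableTypeR R := fun x : R => l * x.
have ml : measurable_fun setT fl by exact: measurable_funM.
have l0' : 0 <= l by exact: ltW.
have -> : leb A = pushforward (mscale (NngNum l0') leb) fl A.
  apply: lebesgue_measure_unique => // _ [[a b] /= ab <-].
  rewrite /pushforward /fl /mscale/=.
  rewrite (_ : _ @^-1` _ = `](a / l), (b / l)]%classic); last first.
    apply/seteqP; split => x /=; rewrite !in_itv/= ltr_pdivrMr// ler_pdivlMr//;
      by rewrite ![_ * l]mulrC.
  rewrite !lebesgue_measure_itv/= !lte_fin ltr_pM2r ?invr_gt0//.
  case: ifPn => _; last by rewrite mule0.
  by rewrite -!EFinD -EFinM; congr EFin; rewrite -mulrBl mulrCA divff ?mulr1// gt_eqF.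
rewrite /pushforward /mscale/=.
by rewrite muleA -EFinM mulVf ?mul1e// gt_eqF.
Qed.

Lemma ge0_integral_dilation (l : R) (f : R -> \bar R) : 0 < l ->
  measurable_fun setT f -> (forall x, (0 <= f x)%E) ->
  (\int[leb]_x f (l * x)%R = (l^-1)%:E * \int[leb]_x f x)%E.
Proof.
move=> l0 mf f0.
pose fl : measurableTypeR R -> measurableTypeR R := fun x : R => l * x.
have ml : measurable_fun setT fl by exact: measurable_funM.
have l0' : 0 <= l^-1 by rewrite invr_ge0 ltW.
rewrite -(ge0_integral_mscale leb measurableT (NngNum l0')) //.
have := @ge0_integral_pushforward _ _ _ (measurableTypeR R) R fl ml leb setT f measurableT mf.
rewrite preimage_setT => <-; last by move=> y _; exact: f0.
apply: eq_measure_integral => A mA _.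
by rewrite /= /mscale /=; exact: lebesgue_measure_dilation.
Qed.

End dilation.

Section rV_geometry.
Context (R : realType).

Lemma lebesgue_rVS n (A : set 'rV[R]_n.+1) :
  lebesgue_rV R n.+1 A = (@lebesgue_measure R \x lebesgue_rV R n)%E (@rV_cons R n @^-1` A).
Proof. by []. Qed.

Lemma measurable_rV_cons_preimage n (A : set 'rV[R]_n.+1) :
  measurable A -> measurable (@rV_cons R n @^-1` A).
Proof. by move=> mA; rewrite -[X in measurable X]setTI; exact: measurable_rV_cons. Qed.

Lemma lebesgue_rV_dilation n (l : R) (A : set 'rV[R]_n) : 0 < l -> measurable A ->
  lebesgue_rV R n ((fun x => l *: x) @^-1` A) = ((l ^- n)%:E * lebesgue_rV R n A)%E.
Proof.
move=> l0; elim: n A => [|n IH] A mA.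
  rewrite expr0 invr1 mul1e /= !diracE; congr ((nat_of_bool _)%:R%:E).
  by apply/idP/idP; rewrite !inE /= scaler0.
have mB := measurable_rV_cons_preimage mA.
rewrite !lebesgue_rVS /product_measure1 /=.
transitivity (\int[@lebesgue_measure R]_x ((l ^- n)%:E *
    lebesgue_rV R n (xsection (@rV_cons R n @^-1` A) (l * x)%R)))%E.
  apply: eq_integral => x _; rewrite -IH; last exact: measurable_xsection.
  have E v : l *: rV_cons (x, v) = rV_cons (l * x, l *: v).
    by apply/rowP => i; rewrite !mxE; case: (unlift _ _) => [j|] //=; rewrite mxE.
  by congr (lebesgue_rV R n _); apply/seteqP; split => v;
    rewrite /xsection /= !inE /= E.
have mx := @measurable_fun_xsection _ _ _ _ _ (lebesgue_rV R n) _ mB.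
rewrite ge0_integralZl//; last 2 first.
- by apply: (measurableT_comp mx); exact: measurable_funM.
- by rewrite lee_fin invr_ge0 exprn_ge0// ltW.
rewrite (ge0_integral_dilation l0 mx)//.
by rewrite muleA -EFinM -invfM -exprSr.
Qed.

Lemma measurable_sqnorm n : measurable_fun setT (fun x : 'rV[R]_n => \sum_i x ord0 i ^+ 2).
Proof.
apply: measurable_sum => i; apply: measurable_funX.
exact: (measurable_rV_coord i).
Qed.

Lemma measurable_enorm n : measurable_fun setT (@enorm R n).
Proof.
apply: (measurableT_comp (continuous_measurable_fun (@sqrt_continuous R))).
exact: measurable_sqnorm.
Qed.

Lemma sqnorm_ge0 n (x : 'rV[R]_n) : 0 <= \sum_i x ord0 i ^+ 2.
Proof. by apply: sumr_ge0 => i _; exact: sqr_ge0. Qed.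

Lemma sqr_enorm n (x : 'rV[R]_n) : enorm x ^+ 2 = \sum_i x ord0 i ^+ 2.
Proof. by rewrite /enorm sqr_sqrtr// sqnorm_ge0. Qed.

Lemma enorm_ge0 n (x : 'rV[R]_n) : 0 <= enorm x.
Proof. exact: sqrtr_ge0. Qed.

Lemma enormZ n (l : R) (x : 'rV[R]_n) : enorm (l *: x) = `|l| * enorm x.
Proof.
rewrite /enorm -sqrtr_sqr -sqrtrM ?sqr_ge0// mulr_sumr; congr Num.sqrt.
by apply: eq_bigr => i _; rewrite mxE exprMn.
Qed.

Lemma ler_coord_enorm n (x : 'rV[R]_n) i : `|x ord0 i| <= enorm x.
Proof.
rewrite -(ler_pXn2r (n:=2)) ?nnegrE ?enorm_ge0// sqr_enorm real_normK ?num_real//.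
by rewrite (bigD1 i)//= lerDl; apply: sumr_ge0 => j _; exact: sqr_ge0.
Qed.

Lemma measurable_eball n (r : R) : measurable (@eball R n r).
Proof.
rewrite (_ : eball r = @enorm R n @^-1` `]-oo, r[%classic).
  by rewrite -[X in measurable X]setTI; apply: measurable_enorm.
by apply/seteqP; split => x; rewrite /eball /= in_itv.
Qed.

Definition box n (b : R) : set 'rV[R]_n := [set x | forall i, `|x ord0 i| <= b].

Lemma measurable_coord_set n (i : 'I_n) (A : set R) : measurable A ->
  measurable [set x : 'rV[R]_n | A (x ord0 i)].
Proof.
move=> mA; rewrite (_ : mkset _ = setT `&` @rV_coord R n i @^-1` A).
  exact: measurable_rV_coord.
by rewrite setTI.
Qed.

Lemma measurable_forall_coord n (A : 'I_n -> set R) : (forall i, measurable (A i)) ->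
  measurable [set x : 'rV[R]_n | forall i, A i (x ord0 i)].
Proof.
move=> mA; rewrite (_ : mkset _ = \bigcap_(i in [set: 'I_n]) [set x : 'rV[R]_n | A i (x ord0 i)]).
  by apply: fin_bigcap_measurable => // i _; exact: measurable_coord_set.
by apply/seteqP; split => [x xA i _|x xA i]; exact: xA.
Qed.

Lemma measurable_box n b : measurable (@box n b).
Proof.
apply: (@measurable_forall_coord _ (fun=> [set x | `|x| <= b])) => _.
rewrite (_ : mkset _ = `[-b, b]%classic)//.
by apply/seteqP; split => x /=; rewrite in_itv/= ler_norml.
Qed.

Lemma lebesgue_rV_box n (b : R) : 0 <= b ->
  lebesgue_rV R n (@box n b) = ((b *+ 2) ^+ n)%:E.
Proof.
move=> b0; elim: n => [|n IH].
  by rewrite expr0 /= diracE mem_set// => -[].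
rewrite lebesgue_rVS (_ : _ @^-1` _ = `[-b, b]%classic `*` @box n b).
  rewrite product_measure1E//; last exact: measurable_box.
  rewrite IH /= lebesgue_measure_itv/= lte_fin.
  have [->|b0'] := eqVneq b 0.
    by rewrite oppr0 ltxx mul0e mul0rn exprS mul0r.
  rewrite ifT; last by apply: gtrN; rewrite lt_neqAle eq_sym b0' b0.
  by rewrite -EFinD -EFinM opprK -mulr2n exprS.
apply/seteqP; split => -[x v] /=.
  move=> xv; split; first by have := xv ord0; rewrite mxE unlift_none/= in_itv/= ler_norml.
  by move=> i; have := xv (lift ord0 i); rewrite mxE liftK.
move=> [xb vb] i; rewrite mxE; case: unliftP => [j _|_] /=; first exact: vb.
by move: xb; rewrite in_itv/= ler_norml.
Qed.

Lemma eball_sub_box n (r : R) : @eball R n r `<=` @box n r.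
Proof. by move=> x xr i; exact: le_trans (ler_coord_enorm _ _) (ltW xr). Qed.

Definition unit_ball_volume n : R := fine (lebesgue_rV R n (@eball R n 1)).

Lemma eball_dilation n (r : R) : 0 < r ->
  @eball R n r = (fun x => r^-1 *: x) @^-1` @eball R n 1.
Proof.
move=> r0; apply/seteqP; split => x; rewrite /eball /= enormZ ger0_norm ?invr_ge0 ?(ltW r0)//;
  by rewrite mulrC ltr_pdivrMr// mul1r.
Qed.

Lemma lebesgue_rV_eball n (r : R) : 0 < r ->
  lebesgue_rV R n (@eball R n r) = (unit_ball_volume n * r ^+ n)%:E.
Proof.
move=> r0; rewrite (eball_dilation _ r0) lebesgue_rV_dilation ?invr_gt0//; last first.
  exact: measurable_eball.
rewrite -exprVn invrK EFinM muleC fineK// ge0_fin_numE ?measure_ge0//.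
apply: (@le_lt_trans _ _ (lebesgue_rV R n (@box n 1))).
  apply: le_measure; rewrite ?inE; [exact: measurable_eball|exact: measurable_box|].
  exact: eball_sub_box.
by rewrite lebesgue_rV_box// ltry.
Qed.

Lemma unit_ball_volume_gt0 n : 0 < unit_ball_volume n.
Proof.
(* The cube of side 2 lies in this ball since n < (n + 1)^2, and scaling brings positivity back to
   radius 1. The radius n + 1 is positive also for n = 0. *)
have : (0 < lebesgue_rV R n (@eball R n n.+1%:R))%E.
  apply: (@lt_le_trans _ _ (lebesgue_rV R n (@box n 1))).
    by rewrite lebesgue_rV_box// lte_fin exprn_gt0.
  apply: le_measure; rewrite ?inE; [exact: measurable_box|exact: measurable_eball|].
  move=> x x1; rewrite /eball /= -(ltr_pXn2r (n:=2)) ?nnegrE ?enorm_ge0// sqr_enorm.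
  apply: (@le_lt_trans _ _ n%:R).
    rewrite (_ : n%:R = \sum_(i < n) 1); last by rewrite sumr_const card_ord.
    apply: ler_sum => i _; rewrite -real_normK ?num_real//.
    by rewrite expr_le1.
  by rewrite -natrX ltr_nat expnS expn1; nia.
rewrite lebesgue_rV_eball// lte_fin pmulr_lgt0// exprn_gt0//.
Qed.

End rV_geometry.

Section radial_measure.
Context (R : realType) (n' : nat).
Local Notation n := n'.+1.
Local Notation mu := (lebesgue_rV R n).
Local Notation leb := (@lebesgue_measure R).
Local Notation vol := (@unit_ball_volume R n).

Lemma measurable_enorm_preimage m (A : set R) : measurable A ->
  measurable (@enorm R m @^-1` A).
Proof. by move=> mA; rewrite -[X in measurable X]setTI; exact: measurable_enorm. Qed.

Lemma lebesgue_rV_shell (a b : R) : 0 < a -> a <= b ->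
  mu (@enorm R n @^-1` `[a, b[%classic) = (vol * (b ^+ n - a ^+ n))%:E.
Proof.
move=> a0 ab; have b0 : 0 < b by exact: lt_le_trans ab.
rewrite (_ : _ @^-1` _ = @eball R n b `\` @eball R n a); last first.
  apply/seteqP; split => x; rewrite /eball/= in_itv/=.
    by case/andP=> ax xb; split => //; apply/negP; rewrite -leNgt.
  by case=> -> /negP; rewrite -leNgt => ->.
have E : eball b `&` eball a = @eball R n a.
  by rewrite setIidr// => x /= xa; exact: lt_le_trans ab.
transitivity (mu (eball b) - mu (eball b `&` eball a))%E.
  apply: measureD; [exact: measurable_eball..|].
  by have /= := @lebesgue_rV_eball R n _ b0 => ->; rewrite ltry.
rewrite E.
by rewrite !lebesgue_rV_eball// -EFinB mulrBr.
Qed.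

Lemma exprB_le (a b : R) : 0 <= a -> a <= b ->
  b ^+ n - a ^+ n <= n%:R * b ^+ n' * (b - a).
Proof.
move=> a0 ab; rewrite subrXX mulrC ler_wpM2r ?subr_ge0//.
rewrite (_ : n%:R * b ^+ n' = \sum_(i < n) b ^+ n'); last first.
  by rewrite sumr_const card_ord mulr_natl.
apply: ler_sum => i _; have -> : b ^+ n' = b ^+ (n.-1 - i) * b ^+ i.
  by rewrite -exprD subnK// -ltnS.
rewrite ler_wpM2l ?exprn_ge0 ?(le_trans a0)// lerXn2r ?nnegrE//.
exact: le_trans ab.
Qed.

Lemma lebesgue_rV_shell_le (a b M : R) : 0 <= a -> a <= b -> b <= M ->
  (mu (@enorm R n @^-1` `]a, b[%classic) <= (vol * n%:R * M ^+ n' * (b - a))%:E)%E.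
Proof.
move=> a0 ab bM; have v0 := @unit_ball_volume_gt0 R n.
have b0 := le_trans a0 ab.
have [->|ab'] := eqVneq a b.
  rewrite (_ : _ @^-1` _ = set0) ?measure0; last first.
    by apply/seteqP; split => x //=; rewrite in_itv/=; lra.
  by rewrite subrr mulr0.
have {}ab' : a < b by rewrite lt_neqAle ab'.
have {}b0 : 0 < b by exact: le_lt_trans ab'.
apply: (@le_trans _ _ (vol * (b ^+ n - a ^+ n))%:E).
  move: a0; rewrite le_eqVlt => /predU1P[<-|a0].
    rewrite expr0n/= subr0 -lebesgue_rV_eball//.
    apply: le_measure; rewrite ?inE; [exact: measurable_enorm_preimage|exact: measurable_eball|].
    by move=> x /=; rewrite in_itv/= => /andP[].
  rewrite -lebesgue_rV_shell//; apply: le_measure; rewrite ?inE.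
  - exact: measurable_enorm_preimage.
  - exact: measurable_enorm_preimage.
  - by move=> x /=; rewrite !in_itv/= => /andP[/ltW -> ->].
rewrite lee_fin -!mulrA ler_pM2l//; apply: (le_trans (exprB_le a0 ab)).
rewrite -mulrA ler_wpM2l// ler_wpM2r ?subr_ge0// lerXn2r ?nnegrE//.
- exact: ltW.
- by apply: le_trans bM; exact: ltW.
Qed.

(** The image of the measure under the norm has density [vol * n * r ^ (n - 1)]; this is its value
    at the right end of []0, M[]. *)
Definition radial_density_bound (M : R) : R := vol * n%:R * M ^+ n'.

Lemma radial_density_bound_gt0 M : 0 < M -> 0 < radial_density_bound M.
Proof.
by move=> M0; rewrite /radial_density_bound !mulr_gt0 ?exprn_gt0// unit_ball_volume_gt0.
Qed.

(** Both sides are compared on a cover of [A] by open intervals cut to []0, M[]: a shell has volume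
    at most the density bound times its thickness, and outer Lebesgue measure is the infimum over
    such covers. This upper bound transports null sets and finite integrals from radii to R^n. *)
Lemma lebesgue_rV_radial_le (M : R) (A : set R) : 0 < M -> measurable A ->
  A `<=` `]0, M[%classic ->
  (mu (@enorm R n @^-1` A) <= (radial_density_bound M)%:E * leb A)%E.
Proof.
move=> M0 mA AM; have C0 := radial_density_bound_gt0 M0.
rewrite -lee_pdivrMl//.
have -> : leb A = ((@wlength R idfun)^* A)%mu by [].
rewrite outer_measure_open_itv_cover; apply: le_ereal_inf_tmp => _ [F [Fitv AF] <-].
rewrite lee_pdivrMl// -nneseriesZl; last first.
  by move=> i _; have [ab ->] := Fitv i; exact: wlength_ge0.
pose G k := @enorm R n @^-1` (F k `&` `]0, M[%classic).
have mF k : measurable (G k).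
  apply: measurable_enorm_preimage.
  by apply: measurableI => //; have [ab ->] := Fitv k.
have mUF := bigcupT_measurable _ mF.
have H1 : (mu (@enorm R n @^-1` A) <= mu (\bigcup_k G k))%E.
  apply: le_measure; rewrite ?inE//; first exact: measurable_enorm_preimage.
  by move=> x /= Ax; have [k _ Fk] := AF _ Ax; exists k => //; split => //; exact: AM.
apply: (le_trans H1).
apply: (le_trans (measure_sigma_subadditive mu mF mUF (@subset_refl _ _))).
apply: lee_nneseries => k _ //.
rewrite /G; have [[x y] ->] := Fitv k; rewrite /=.
have [xy|xy] := ltP (Num.max x 0) (Num.min y M); last first.
  rewrite (_ : _ @^-1` _ = set0).
    by rewrite measure0 mule_ge0 ?wlength_ge0// lee_fin ltW.
  apply/seteqP; split => z //=; rewrite !in_itv/= => -[/andP[xz zy] /andP[z0 zM]].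
  have h1 : Num.max x 0 < enorm z by rewrite gt_max xz.
  have h2 : enorm z < Num.min y M by rewrite lt_min zy.
  by have := lt_trans h1 h2; rewrite ltNge xy.
have E : `]x, y[%classic `&` `]0, M[%classic = `]Num.max x 0, Num.min y M[%classic :> set R.
  apply/seteqP; split => z /=; rewrite !in_itv/= gt_max lt_min.
    by move=> [/andP[-> ->] /andP[-> ->]].
  by move=> /andP[/andP[-> ->] /andP[-> ->]].
rewrite E; apply: (le_trans (@lebesgue_rV_shell_le _ _ M _ (ltW xy) _)).
- by rewrite le_max lexx orbT.
- by rewrite ge_min lexx orbT.
have xy' : x < y.
  by move: xy; rewrite lt_min !gt_max => /andP[/andP[? _] _].
rewrite wlength_itv/= lte_fin xy' -EFinB -EFinM lee_fin ler_wpM2l ?(ltW C0)//.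
by apply: lerB; rewrite ?ge_min ?le_max lexx.
Qed.

Lemma lebesgue_rV_origin : mu [set x | enorm x = 0] = 0%E.
Proof.
apply/eqP; rewrite eq_le measure_ge0 andbT; apply/lee_addgt0Pr => e e0.
rewrite add0e; have v0 := @unit_ball_volume_gt0 R n.
pose r := Num.min 1 (e / vol).
have r0 : 0 < r by rewrite lt_min ltr01/= divr_gt0.
apply: (@le_trans _ _ (mu (@eball R n r))).
  apply: le_measure; rewrite ?inE; [|exact: measurable_eball|].
    exact: (measurable_enorm_preimage (measurable_set1 0)).
  by move=> x; rewrite /eball /= => ->.
rewrite lebesgue_rV_eball// lee_fin mulrC -ler_pdivlMr//.
apply: (@le_trans _ _ r); last by rewrite ge_min lexx orbT.
by rewrite exprS ler_piMr ?(ltW r0)// exprn_ile1 ?(ltW r0)// ge_min lexx.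
Qed.

Lemma ae_enorm_gt0 : {ae mu, forall x, 0 < enorm x}.
Proof.
exists [set x | enorm x = 0]; split.
- exact: (measurable_enorm_preimage (measurable_set1 0)).
- exact: lebesgue_rV_origin.
- move=> x /= /negP; rewrite -leNgt => x0; apply/eqP; rewrite eq_le x0; exact: enorm_ge0.
Qed.

(** The density bound is for bounded radii, so the null set of radii is exhausted by bounded pieces;
    the origin is a null set by itself. *)
Lemma ae_enorm (P : R -> Prop) :
  {ae leb, forall r, P r} -> {ae mu, forall x, P (enorm x)}.
Proof.
move=> [A [mA A0 PA]].
have : mu.-negligible (\bigcup_k (@enorm R n @^-1` (A `&` `]0, k.+1%:R[%classic))).
  apply: negligible_bigcup => k; apply/negligibleP.
    by apply: measurable_enorm_preimage; exact: measurableI.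
  have mI : measurable (A `&` `]0, k.+1%:R[%classic) by exact: measurableI.
  have := @lebesgue_rV_radial_le k.+1%:R _ _ mI (@subIsetr _ _ _).
  have -> : leb (A `&` `]0, k.+1%:R[%classic) = 0%E.
    apply/eqP; rewrite eq_le measure_ge0 andbT -A0.
    by apply: le_measure; rewrite ?inE.
  by rewrite mule0 ltr0Sn => /(_ isT) h; apply/eqP; rewrite eq_le h measure_ge0.
move=> Z; have := negligibleU ae_enorm_gt0 Z; apply: negligibleS => x /= Px.
have [x0|x0] := ltP 0 (enorm x); last by left => /=.
right; exists (Num.truncn (enorm x)) => //; split => /=; first exact: PA.
by rewrite in_itv/= x0/= truncnS_gt.
Qed.

Lemma ge0_integral_radial_le (M : R) (D : set R) (f : R -> \bar R) : 0 < M ->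
  measurable D -> D `<=` `]0, M[%classic -> measurable_fun setT f ->
  (forall r, (0 <= f r)%E) ->
  (\int[mu]_(x in @enorm R n @^-1` D) f (enorm x) <=
   (radial_density_bound M)%:E * \int[leb]_(r in D) f r)%E.
Proof.
move=> M0 mD DM mf f0; have C0 := radial_density_bound_gt0 M0.
have C0' := ltW C0.
pose e : 'rV[R]_n -> measurableTypeR R := @enorm R n.
have me : measurable_fun setT e by exact: measurable_enorm.
have := @ge0_integral_pushforward _ _ _ (measurableTypeR R) R e me mu D f mD.
move=> <-; last 2 first.
- exact: measurable_funS mf.
- by move=> y _; exact: f0.
rewrite -(ge0_integral_mscale leb mD (NngNum C0'))//; last exact: measurable_funS mf.
rewrite (eq_measure_integral (mrestr (pushforward mu e) mD)); last first.
  by move=> A mA AD; rewrite /mrestr; congr (pushforward mu e _); rewrite setIidl.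
rewrite [leRHS](eq_measure_integral (mrestr (mscale (NngNum C0') leb) mD)); last first.
  by move=> A mA AD; rewrite /mrestr; congr (mscale _ leb _); rewrite setIidl.
apply: ge0_le_measure_integral => // S mS.
rewrite /mrestr /mscale /= /pushforward; apply: lebesgue_rV_radial_le => //.
- exact: measurableI.
- by move=> x [_ /DM].
Qed.

End radial_measure.

(** * Smooth steps *)

Section derivative_calculus.
Context (R : realType).
Implicit Types f g : R -> R.

Lemma is_derive_line (V : normedModType R) (f : V -> R) (x v : V) (d : R) :
  is_derive (0 : R) 1 (fun h : R => f (h *: v + x)) d <-> is_derive x v f d.
Proof.
have E : 'D_1 (fun h : R => f (h *: v + x)) 0 = 'D_v f x.
  rewrite /derive; set g1 := fun h => h^-1 *: _; set g2 := fun h => h^-1 *: _.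
  suff -> : g1 = g2 by [].
  by apply/funext => h; rewrite /g1 /g2 /= addr0 scale0r add0r [_%:A]mulr1.
split => -[fd <-].
  by rewrite E; apply: derivableP; apply: (proj2 (derivable1P f x v)).
by rewrite -E; apply: derivableP; apply: (proj1 (derivable1P f x v)).
Qed.

Lemma is_derive_comp_line (V : normedModType R) (f : R -> R) (g : V -> R) (x v : V) (a b : R) :
  is_derive (g x) 1 f a -> is_derive x v g b -> is_derive x v (f \o g) (a * b).
Proof.
move=> fa /is_derive_line gb; apply/is_derive_line.
apply: (@is_derive1_comp R f (fun h => g (h *: v + x))) gb.
by rewrite scale0r add0r.
Qed.

(** The derivative is existentially quantified, so closure under an operation is proved by
    exhibiting it, by induction on the order. Continuity of the last derivative is not included. *)
Fixpoint smooth_upto (k : nat) f : Prop :=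
  match k with
  | 0 => True
  | k'.+1 => exists f', (forall x : R, is_derive x (1 : R) f (f' x)) /\ smooth_upto k' f'
  end.

Definition smooth f := forall k, smooth_upto k f.

Lemma smooth_uptoW k f : smooth_upto k.+1 f -> smooth_upto k f.
Proof.
elim: k f => [//|k IH] f [f' [df sf']]; exists f'; split => //; exact: IH.
Qed.

Lemma is_derive_continuous f f' : (forall x : R, is_derive x (1 : R) f (f' x)) -> continuous f.
Proof.
by move=> df x; apply: differentiable_continuous; apply/derivable1_diffP; case: (df x).
Qed.

Lemma smooth_cst c : smooth (fun=> c).
Proof.
move=> k; elim: k c => [//|k IH] c; exists (fun=> 0); split => [x|]; last exact: IH.
exact: is_derive_cst.
Qed.

Lemma smooth_uptoD k f g : smooth_upto k f -> smooth_upto k g ->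
  smooth_upto k (fun x => f x + g x).
Proof.
elim: k f g => [//|k IH] f g [f' [df sf]] [g' [dg sg]].
exists (fun x => f' x + g' x); split; last exact: IH.
by move=> x; exact: is_deriveD.
Qed.

Lemma smooth_uptoM k f g : smooth_upto k f -> smooth_upto k g ->
  smooth_upto k (fun x => f x * g x).
Proof.
elim: k f g => [//|k IH] f g /[dup] /smooth_uptoW sf0 [f' [df sf]].
move=> /[dup] /smooth_uptoW sg0 [g' [dg sg]].
exists (fun x => f x * g' x + g x * f' x); split.
  by move=> x; exact: is_deriveM.
by apply: smooth_uptoD; exact: IH.
Qed.

Lemma smooth_uptoV k f : (forall x, f x != 0) -> smooth_upto k f ->
  smooth_upto k (fun x => (f x)^-1).
Proof.
move=> f0; elim: k => [//|k IH] /[dup] /smooth_uptoW /IH sV [f' [df sf]].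
exists (fun x => (-1) * ((f x)^-1 * ((f x)^-1 * f' x))); split.
  move=> x; have := @is_deriveV R f x _ _ (f0 x) (df x).
  by rewrite -exprVn expr2 scaleNr /GRing.scale/= -mulrA mulN1r.
by repeat apply: smooth_uptoM => //; exact: smooth_cst.
Qed.

Lemma smooth_upto_affine k f a b : smooth_upto k f -> smooth_upto k (fun x => f (a * x + b)).
Proof.
elim: k f => [//|k IH] f [f' [df sf]].
exists (fun x => f' (a * x + b) * a); split; last first.
  apply: (@smooth_uptoM _ (fun x => f' (a * x + b)) (fun=> a)); first exact: IH.
  exact: smooth_cst.
move=> x; apply: (@is_derive1_comp R f (fun x => a * x + b)) => //.
have -> : a = a *: 1 + 0 :> R by rewrite addr0 /GRing.scale/= mulr1.
rewrite [X in fun x => X * x + b](_ : _ = a); last by rewrite addr0 /GRing.scale/= mulr1.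
exact: (is_deriveD (is_deriveZ a (is_derive_id x 1)) (is_derive_cst b x 1)).
Qed.

End derivative_calculus.

Section flat_functions.
Context (R : realType).
Implicit Type p : {poly R}.

Definition flat p (t : R) : R := if 0 < t then p.[t^-1] * expR (- t^-1) else 0.

(** The exponential series gives (1/t)^(i+1) <= (i+1)! exp(1/t), so each monomial of p(1/t), times
    exp(-1/t), is at most (i+1)! t. *)
Lemma flat_lipschitz0 p : exists2 C, 0 <= C & forall t, `|flat p t| <= C * `|t|.
Proof.
exists (\sum_(i < size p) `|p`_i| * i.+1`!%:R).
  by apply: sumr_ge0 => i _; rewrite mulr_ge0.
move=> t; rewrite /flat; case: ifPn => [t0|_]; last first.
  by rewrite normr0 mulr_ge0//; apply: sumr_ge0 => i _; rewrite mulr_ge0.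
rewrite horner_coef mulr_suml (le_trans (ler_norm_sum _ _ _))//.
rewrite mulr_suml; apply: ler_sum => i _.
have y0 : 0 < t^-1 by rewrite invr_gt0.
rewrite -mulrA normrM -mulrA ler_wpM2l//.
rewrite ger0_norm; last by rewrite mulr_ge0 ?expR_ge0// exprn_ge0// ltW.
rewrite expRN ler_pdivrMr ?expR_gt0// gtr0_norm//.
have h := expR_ge1Dxn i (ltW y0).
have f0 : 0 < i.+1`!%:R :> R by rewrite ltr0n fact_gt0.
have h' : t^-1 ^+ i.+1 <= expR t^-1 * i.+1`!%:R.
  by rewrite -ler_pdivrMr//; apply: le_trans h; rewrite lerDr.
rewrite (_ : t^-1 ^+ i = t^-1 ^+ i.+1 * t); last by rewrite exprSr -mulrA mulVf ?mulr1// gt_eqF.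
by rewrite -mulrA mulrCA mulrC ler_wpM2l ?(ltW t0)// mulrC.
Qed.

(* The derivative of p(1/t) exp(-1/t) is q(1/t) exp(-1/t) with q = (p - p') X^2,
   so these functions are closed under differentiation, also at the origin. *)
Lemma is_derive_flat p (t : R) : is_derive t (1 : R) (flat p) (flat ((p - p^`()) * 'X^2) t).
Proof.
have [t0|t0|->] := ltgtP t 0.
- apply: (@near_eq_is_derive _ _ _ (cst 0)).
    near=> s; rewrite /flat ifF//; apply/negbTE; rewrite -leNgt ltW//.
    by near: s; exact: lt_nbhsl.
  by rewrite /flat ltNge (ltW t0)/=; exact: is_derive_cst.
- apply: (@near_eq_is_derive _ _ _ (fun s : R => p.[s^-1] * expR (- s^-1))).
    by near=> s; rewrite /flat ifT//; near: s; exact: lt_nbhsr.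
  have di : is_derive t (1 : R) (fun s : R => s^-1) (- t ^- 2).
    have := @is_deriveV R id t (1 : R) (1 : R) _ _; rewrite /GRing.scale/= mulr1; apply.
    by rewrite gt_eqF.
  have dp := @is_derive1_comp R (horner p) _ t _ _ (is_derive_poly p t^-1) di.
  have de := @is_derive1_comp R expR _ t _ _ (is_derive_expR (- t^-1)) (is_deriveN di).
  apply: (is_derive_eq (is_deriveM dp de)).
  rewrite /flat t0 !hornerE/= /GRing.scale/= [(- _) t]/(- t^-1) expr2 invfM; ring.
(* At the origin the difference quotient of [flat p] is [flat (p * 'X)], which is continuous there
   by the linear bound. *)
- apply/is_derive1_caratheodory; exists (flat (p * 'X)); split.
  + move=> z; rewrite /flat ltxx !subr0; case: ifPn => z0; last by rewrite mul0r.
    by rewrite !hornerE/=; field; rewrite gt_eqF.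
  + have [C C0 hC] := flat_lipschitz0 (p * 'X).
    have E0 : flat (p * 'X) 0 = 0 by rewrite /flat ltxx.
    change (flat (p * 'X) z @[z --> (0 : R)] --> flat (p * 'X) 0); rewrite E0.
    apply/cvgr0Pnorm_lt => e e0; near=> z.
    apply: (le_lt_trans (hC z)); rewrite (@le_lt_trans _ _ ((C + 1) * `|z|))//.
      by rewrite ler_wpM2r// lerDl.
    rewrite mulrC -ltr_pdivlMr ?ltr_wpDl//.
    near: z; apply: (@nbhs0_lt _ R^o); by rewrite divr_gt0// ltr_wpDl.
  + by rewrite /flat ltxx.
Unshelve. all: by end_near. Qed.

Lemma smooth_flat p : smooth (flat p).
Proof.
move=> k; elim: k p => [//|k IH] p; exists (flat ((p - p^`()) * 'X^2)).
by split => // x; exact: is_derive_flat.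
Qed.

Lemma flat1_gt0 t : 0 < t -> 0 < flat 1 t.
Proof. by move=> t0; rewrite /flat t0 hornerC mul1r expR_gt0. Qed.

Lemma flat1_ge0 t : 0 <= flat 1 t.
Proof. by rewrite /flat; case: ifPn => // _; rewrite hornerC mul1r expR_ge0. Qed.

Lemma flat1_le0 p t : t <= 0 -> flat p t = 0.
Proof. by rewrite /flat leNgt => /negbTE ->. Qed.

End flat_functions.

Section smooth_step.
Context (R : realType).
Local Notation e := (@flat R 1).
Local Notation e' := (@flat R ((1 - 1^`()) * 'X^2)).

Let den (t : R) := e t + e (1 - t).

Let den_gt0 t : 0 < den t.
Proof.
rewrite /den; have [t0|t0] := ltP 0 t.
  by rewrite ltr_wpDr ?flat1_gt0// flat1_ge0.
by rewrite ltr_wpDl ?flat1_ge0// flat1_gt0//; lra.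
Qed.

Definition smooth_step (t : R) : R := e t / (e t + e (1 - t)).

(** The quotient rule after cancellation of the two terms [e t * e' t]; what is left is visibly
    nonnegative. *)
Definition smooth_step' (t : R) : R :=
  (e' t * e (1 - t) + e t * e' (1 - t)) / (e t + e (1 - t)) ^+ 2.

Let is_derive_flip p (t : R) : is_derive t (1 : R) (fun t => flat p (1 - t))
  (- flat ((p - p^`()) * 'X^2) (1 - t)).
Proof.
have d1 : is_derive t (1 : R) (fun s : R => 1 - s) (0 - 1).
  exact: (is_deriveB (is_derive_cst (1 : R) t 1) (is_derive_id t 1)).
apply: (is_derive_eq (@is_derive1_comp R (flat p) _ t _ _ (is_derive_flat p (1 - t)) d1)).
by rewrite sub0r mulrN1.
Qed.

Lemma is_derive_smooth_step (t : R) : is_derive t (1 : R) smooth_step (smooth_step' t).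
Proof.
have d0 := den_gt0 t.
have dd : is_derive t (1 : R) den (e' t - e' (1 - t)).
  exact: (is_deriveD (is_derive_flat 1 t) (is_derive_flip 1 t)).
have dn0 : den t != 0 by rewrite gt_eqF.
apply: (is_derive_eq (is_deriveM (is_derive_flat 1 t) (is_deriveV dn0 dd))).
rewrite /smooth_step' /GRing.scale/= -/(den t).
have -> : e (1 - t) = den t - e t by rewrite /den; ring.
by field.
Qed.

Lemma smooth_smooth_step : smooth smooth_step.
Proof.
have sf p : smooth (fun t : R => flat p (1 - t)).
  move=> k; rewrite (_ : (fun _ => _) = fun t => flat p ((-1) * t + 1)).
    by apply: smooth_upto_affine; exact: smooth_flat.
  by apply/funext => t; congr flat; ring.
move=> k; apply: smooth_uptoM; first exact: smooth_flat.
apply: smooth_uptoV; first by move=> x; rewrite gt_eqF// den_gt0.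
by apply: smooth_uptoD; [exact: smooth_flat|exact: sf].
Qed.

Lemma smooth_step_le0 t : t <= 0 -> smooth_step t = 0.
Proof. by move=> t0; rewrite /smooth_step flat1_le0// mul0r. Qed.

Lemma smooth_step_ge1 t : 1 <= t -> smooth_step t = 1.
Proof.
move=> t1; rewrite /smooth_step (@flat1_le0 _ _ (1 - t)) ?subr_le0// addr0.
by rewrite divff// gt_eqF// flat1_gt0//; lra.
Qed.

Lemma smooth_step_ge0 t : 0 <= smooth_step t.
Proof. by rewrite /smooth_step divr_ge0 ?flat1_ge0// ltW// den_gt0. Qed.

Lemma smooth_step_le1 t : smooth_step t <= 1.
Proof. by rewrite /smooth_step ler_pdivrMr ?den_gt0// mul1r lerDl flat1_ge0. Qed.

Let flat1' t : e' t = if 0 < t then t^-1 ^+ 2 * expR (- t^-1) else 0.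
Proof.
by rewrite /flat; case: ifPn => // t0; rewrite derivC subr0 mul1r hornerXn.
Qed.

Let flat1'_ge0 t : 0 <= e' t.
Proof. by rewrite flat1'; case: ifPn => // _; rewrite mulr_ge0 ?expR_ge0// sqr_ge0. Qed.

Lemma smooth_step'_ge0 t : 0 <= smooth_step' t.
Proof.
by rewrite /smooth_step' divr_ge0 ?sqr_ge0// addr_ge0// mulr_ge0 ?flat1_ge0.
Qed.

Lemma smooth_step'_gt0 t : 0 < t < 1 -> 0 < smooth_step' t.
Proof.
move=> /andP[t0 t1]; have t1' : 0 < 1 - t by rewrite subr_gt0.
rewrite /smooth_step' divr_gt0 ?exprn_gt0 ?den_gt0//.
rewrite ltr_wpDr ?mulr_ge0 ?flat1_ge0// mulr_gt0 ?flat1_gt0// flat1' t0.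
by rewrite mulr_gt0 ?expR_gt0// exprn_gt0// invr_gt0.
Qed.

Lemma smooth_step'_out t : t <= 0 \/ 1 <= t -> smooth_step' t = 0.
Proof.
rewrite /smooth_step'; case => t01.
  by rewrite (flat1_le0 1 t01) (flat1_le0 _ t01) !mul0r addr0 mul0r.
have t01' : 1 - t <= 0 by rewrite subr_le0.
by rewrite (flat1_le0 1 t01') (flat1_le0 _ t01') !mulr0 addr0 mul0r.
Qed.

Lemma continuous_smooth_step' : continuous smooth_step'.
Proof.
have [f' [df [f'' [df' _]]]] := smooth_smooth_step 2.
have -> : smooth_step' = f'.
  apply/funext => t.
  by have [_ <-] := is_derive_smooth_step t; have [_ <-] := df t.
exact: is_derive_continuous df'.
Qed.

Lemma smooth_step'_bound : exists2 B, 0 < B & forall t, smooth_step' t <= B.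
Proof.
have [c _ hc] := @EVT_max R smooth_step' 0 1 ler01
  (continuous_subspaceT continuous_smooth_step').
exists (smooth_step' c + 1); first by rewrite ltr_wpDl ?smooth_step'_ge0.
move=> t; have [t01|t01] := boolP (t \in `[0, 1]).
  by rewrite (le_trans (hc _ t01))// lerDl.
rewrite smooth_step'_out ?addr_ge0 ?smooth_step'_ge0//.
by move: t01; rewrite in_itv/= negb_and -!ltNge => /orP[/ltW|/ltW]; [left|right].
Qed.

(** Positivity inside []0, 1[] and compactness. This keeps the mass of the sphere kernels away from
    0. *)
Lemma smooth_step'_lower_bound :
  exists2 b, 0 < b & forall t, 1 / 3 <= t <= 2 / 3 -> b <= smooth_step' t.
Proof.
have le : 1 / 3 <= 2 / 3 :> R by lra.
have [c c13 hc] := @EVT_min R smooth_step' _ _ le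
  (continuous_subspaceT continuous_smooth_step').
exists (smooth_step' c) => [|t t13]; last by apply: hc; rewrite in_itv.
by apply: smooth_step'_gt0; move: c13; rewrite in_itv/=; lra.
Qed.

End smooth_step.

(** * Borel sets and differentiable functions of several variables *)

Section Borel_rV.
Context (R : realType) (n : nat).
Implicit Types (U : set 'rV[R]_n) (f : 'rV[R]_n -> R).

(** Cubes with rational centre and half-side 1/(k + 1): a countable base of the topology, measurable
    coordinate by coordinate. *)
Let qball (q : 'rV[rat]_n) (k : nat) : set 'rV[R]_n :=
  [set x | forall i, `|x ord0 i - ratr (q ord0 i)| < k.+1%:R^-1].

Let measurable_qball q k : measurable (qball q k).
Proof.
apply: (@measurable_forall_coord _ _
  (fun i => [set t : R | `|t - ratr (q ord0 i)| < k.+1%:R^-1])) => i.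
rewrite (_ : mkset _ = ball (ratr (q ord0 i) : R) k.+1%:R^-1); first exact: measurable_ball.
by apply/seteqP; split => t; rewrite /ball/= distrC.
Qed.

Lemma open_measurable_rV U : open U -> measurable U.
Proof.
move=> oU; pose G m : set 'rV[R]_n :=
  if unpickle m is Some (q, k) then [set x | qball q k x /\ qball q k `<=` U] else set0.
rewrite (_ : U = \bigcup_m G m); last first.
  apply/seteqP; split => [x Ux|x [m _]]; last first.
    by rewrite /G; case: (unpickle m) => [[q k]|] //= [qx]; exact.
  have /nbhs_ballP[e /= e0 eU] := open_nbhs_nbhs (conj oU Ux).
  (* Two points of such a cube differ in each coordinate by less than twice its half-side, so a cube
     that contains [x] lies in the ball of radius [e]. *)
  have [k ke] : exists k : nat, 2 * k.+1%:R^-1 < e.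
    exists (Num.truncn (2 / e)); rewrite -ltr_pdivlMl// invf_plt ?posrE//; last first.
      by rewrite mulr_gt0// invr_gt0.
    by rewrite invfM invrK; exact: truncnS_gt.
  have k0 : 0 < k.+1%:R^-1 :> R by rewrite invr_gt0.
  move: k0 ke; set d : R := k.+1%:R^-1 => k0 ke.
  have hq i : exists q, `|x ord0 i - ratr q| < d.
    have [|q] := @rat_in_itvoo R (x ord0 i - d) (x ord0 i + d).
      by lra.
    by rewrite in_itv/= => qx; exists q; rewrite ltr_norml; lra.
  pose q : 'rV[rat]_n := \row_i projT1 (cid (hq i)).
  have qx i : `|x ord0 i - ratr (q ord0 i)| < d.
    by rewrite mxE; case: cid.
  exists (pickle (q, k)) => //; rewrite /G pickleK; split => // y qy.
  apply: eU; split => // i j; rewrite (ord1 i) /ball/=.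
  rewrite (le_lt_trans (ler_distD (ratr (q ord0 j)) _ _))//.
  by have := qx j; have := qy j; rewrite -/d (distrC (y ord0 j)); lra.
apply: bigcupT_measurable => m; rewrite /G; case: (unpickle m) => [[q k]|//].
have [qU|qU] := pselect (qball q k `<=` U).
  rewrite (_ : mkset _ = qball q k)//.
  by apply/seteqP; split => x //= [].
by rewrite (_ : mkset _ = set0)//; apply/seteqP; split => // x [_ /qU].
Qed.

Lemma closed_measurable_rV (A : set 'rV[R]_n) : closed A -> measurable A.
Proof. by move=> cA; rewrite -(setCK A); apply: measurableC; apply: open_measurable_rV; exact: closed_openC. Qed.

Lemma continuous_measurable_rV f : continuous f -> measurable_fun setT f.
Proof.
move=> cf; apply: (measurability _ (RGenOpens.measurableE R)).
move=> _ [_ [a [b ->] <-]]; rewrite setTI; apply: open_measurable_rV.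
by move/continuousP : cf; apply; exact: interval_open.
Qed.

Lemma compact_box (M : R) : compact (@box R n M).
Proof.
rewrite (_ : box M = [set v : 'rV[R]_n | forall i, `[- M, M]%classic (v ord0 i)]).
  by apply: (@rV_compact R n (fun=> `[- M, M]%classic)) => i; exact: segment_compact.
by apply/seteqP; split => x xM i; have := xM i; rewrite /= in_itv/= ler_norml.
Qed.

Lemma compact_sub_box (A : set 'rV[R]_n) : compact A -> exists2 M : R, 0 < M & A `<=` @box R n M.
Proof.
move=> /compact_bounded[M [Mr hM]]; exists (`|M| + 1); first by rewrite ltr_wpDl.
move=> x Ax i; apply: le_trans (hM (`|M| + 1) _ x Ax); last first.
  by rewrite (le_lt_trans (ler_norm _))// ltrDl.
rewrite [leRHS]/Num.norm /= mx_normrE; apply/bigmax_geP; right => /=.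
by exists (ord0, i).
Qed.

Lemma compact_sub_closed_box (A : set 'rV[R]_n) M : closed A -> A `<=` @box R n M -> compact A.
Proof. by move=> cA AM; apply: (subclosed_compact cA (@compact_box M) AM). Qed.

End Borel_rV.

Section Ck_calculus.
Context (R : realType) (N : nat).
Local Notation RN := 'rV[R]_N.
Local Notation e_ i := (delta_mx ord0 i : RN).
Implicit Types f g : RN -> R.

Lemma Ck_continuous k f : Ck k f -> continuous f.
Proof. by case: k => [//|k []]. Qed.

Lemma CkW k f : Ck k.+1 f -> Ck k f.
Proof.
elim: k f => [f []//|k IH] f [cf hf]; split => // i; have [df pf] := hf i.
by split => //; exact: IH.
Qed.

Lemma CkS k f (df : 'I_N -> RN -> R) : continuous f ->
  (forall i x, is_derive x (e_ i) f (df i x)) -> (forall i, Ck k (df i)) -> Ck k.+1 f.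
Proof.
move=> cf hf hdf; split => // i; split=> [x|]; first by case: (hf i x).
by rewrite (_ : partial i f = df i)//; apply/funext => x; case: (hf i x).
Qed.

Lemma Ck_is_derive k f i x : Ck k.+1 f -> is_derive x (e_ i) f (partial i f x).
Proof. by case=> _ /(_ i)[df _]; split. Qed.

Lemma Ck_partial k f i : Ck k.+1 f -> Ck k (partial i f).
Proof. by case=> _ /(_ i)[]. Qed.

Lemma Ck_cst k c : Ck k (fun _ : RN => c).
Proof.
elim: k c => [|k IH] c; first exact: cst_continuous.
apply: (@CkS k _ (fun _ _ => 0)) => //; exact: cst_continuous.
Qed.

Lemma CkD k f g : Ck k f -> Ck k g -> Ck k (fun x => f x + g x).
Proof.
elim: k f g => [|k IH] f g hf hg.
  by move=> x; apply: continuousD; [exact: hf|exact: hg].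
apply: (@CkS k _ (fun i x => partial i f x + partial i g x)).
- by move=> x; apply: continuousD; [exact: (Ck_continuous hf)|exact: (Ck_continuous hg)].
- by move=> i x; apply: is_deriveD; [exact: (Ck_is_derive i x hf)|exact: (Ck_is_derive i x hg)].
- by move=> i; apply: IH; exact: Ck_partial.
Qed.

Lemma CkM k f g : Ck k f -> Ck k g -> Ck k (fun x => f x * g x).
Proof.
elim: k f g => [|k IH] f g hf hg.
  by move=> x; apply: continuousM; [exact: hf|exact: hg].
apply: (@CkS k _ (fun i x => f x * partial i g x + g x * partial i f x)).
- by move=> x; apply: continuousM; [exact: (Ck_continuous hf)|exact: (Ck_continuous hg)].
- by move=> i x; apply: is_deriveM; [exact: (Ck_is_derive i x hf)|exact: (Ck_is_derive i x hg)].
- by move=> i; apply: CkD; apply: IH; (try exact: Ck_partial); exact: CkW.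
Qed.

Lemma is_derive_coord (j i : 'I_N) (x : RN) :
  is_derive x (e_ i) (fun x : RN => x ord0 j) ((i == j)%:R).
Proof.
apply/is_derive_line.
rewrite (_ : (fun _ => _) = (fun h : R => (i == j)%:R * h + x ord0 j)); last first.
  by apply/funext => h; rewrite !mxE eqxx/= mulrC eq_sym.
have := is_deriveD (is_deriveZ ((i == j)%:R : R) (is_derive_id (0 : R) 1)) (is_derive_cst (x ord0 j) (0 : R) 1).
by rewrite addr0 /GRing.scale/= mulr1.
Qed.

Lemma Ck_coord k (j : 'I_N) : Ck k (fun x : RN => x ord0 j).
Proof.
case: k => [|k]; first by move=> x; exact: coord_continuous.
apply: (@CkS k _ (fun i _ => (i == j)%:R)).
- by move=> x; exact: coord_continuous.
- by move=> i x; exact: is_derive_coord.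
- by move=> i; exact: Ck_cst.
Qed.

(** [Ck k] includes continuity of the derivatives of order [k], which [smooth_upto] yields for [f]
    only one order further. *)
Lemma Ck_comp k (f : R -> R) g : smooth_upto k.+1 f -> Ck k g -> Ck k (fun x => f (g x)).
Proof.
elim: k f g => [|k IH] f g [f' [df sf]] hg; have cf := is_derive_continuous df.
  by move=> x; apply: continuous_comp; [exact: hg|exact: cf].
apply: (@CkS k _ (fun i x => f' (g x) * partial i g x)).
- by move=> x; apply: continuous_comp; [exact: (Ck_continuous hg)|exact: cf].
- by move=> i x; apply: is_derive_comp_line => //; exact: (Ck_is_derive i x hg).
- by move=> i; apply: CkM; [apply: IH => //; exact: CkW|exact: Ck_partial].
Qed.

Lemma Ck_sum k m (F : 'I_m -> RN -> R) : (forall j, Ck k (F j)) ->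
  Ck k (fun x => \sum_(j < m) F j x).
Proof.
elim: m F => [|m IH] F hF.
  rewrite (_ : (fun _ => _) = fun=> 0); first exact: Ck_cst.
  by apply/funext => x; rewrite big_ord0.
rewrite (_ : (fun _ => _) = fun x => \sum_(j < m) F (widen_ord (leqnSn m) j) x + F ord_max x).
  by apply: CkD => //; apply: IH.
by apply/funext => x; rewrite big_ord_recr.
Qed.

Lemma Ck_prod k m (F : 'I_m -> RN -> R) : (forall j, Ck k (F j)) ->
  Ck k (fun x => \prod_(j < m) F j x).
Proof.
elim: m F => [|m IH] F hF.
  rewrite (_ : (fun _ => _) = fun=> 1); first exact: Ck_cst.
  by apply/funext => x; rewrite big_ord0.
rewrite (_ : (fun _ => _) = fun x => (\prod_(j < m) F (widen_ord (leqnSn m) j) x) * F ord_max x).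
  by apply: CkM => //; apply: IH.
by apply/funext => x; rewrite big_ord_recr.
Qed.

Lemma Ck_sqr_enorm k : Ck k (fun x : RN => enorm x ^+ 2).
Proof.
rewrite (_ : (fun _ => _) = fun x : RN => \sum_i x ord0 i * x ord0 i).
  by apply: Ck_sum => j; apply: CkM; exact: Ck_coord.
by apply/funext => x; rewrite sqr_enorm.
Qed.

Lemma is_derive_sqr_enorm i x : is_derive x (e_ i) (fun x : RN => enorm x ^+ 2) (2 * x ord0 i).
Proof.
rewrite (_ : (fun _ => _) = \sum_j (fun x : RN => x ord0 j) * (fun x : RN => x ord0 j)).
  apply: (is_derive_eq (is_derive_sum (fun j => is_deriveM (is_derive_coord j i x) (is_derive_coord j i x)))).
  rewrite (bigD1 i)//= big1 ?addr0; last first.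
    by move=> j ji; rewrite eq_sym (negbTE ji) scaler0 addr0.
  by rewrite eqxx /GRing.scale/= mulr1 mulr_natl mulr2n.
by apply/funext => y; rewrite sqr_enorm fct_sumE; apply: eq_bigr => j _; rewrite expr2.
Qed.

(** Composing with the square of the norm, and not with the norm, keeps the function smooth at the
    origin. *)
Definition radial_smooth (chi : R -> R) (x : RN) : R := chi (enorm x ^+ 2).

Lemma Ck_radial_smooth chi k : smooth chi -> Ck k (radial_smooth chi).
Proof. by move=> sc; apply: Ck_comp => //; exact: Ck_sqr_enorm. Qed.

Lemma is_derive_radial_smooth chi chi' i x : (forall t : R, is_derive t (1 : R) chi (chi' t)) ->
  is_derive x (e_ i) (radial_smooth chi) (2 * x ord0 i * chi' (enorm x ^+ 2)).
Proof.
move=> dc; have := is_derive_comp_line (dc _) (is_derive_sqr_enorm i x).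
by rewrite mulrC.
Qed.

Lemma continuous_enorm : continuous (@enorm R N).
Proof.
move=> x; apply: (@continuous_comp _ _ _ (fun x : RN => \sum_i x ord0 i ^+ 2) Num.sqrt).
  have E : (fun y : RN => enorm y ^+ 2) = fun y : RN => \sum_i y ord0 i ^+ 2.
    by apply/funext => y; rewrite sqr_enorm.
  by rewrite -E; exact: (Ck_continuous (Ck_sqr_enorm 0)).
exact: sqrt_continuous.
Qed.

Lemma test_function_supp (phi : RN -> R) M : (forall k, Ck k phi) ->
  (forall x, M < enorm x -> phi x = 0) -> test_function phi.
Proof.
move=> cphi sphi; split => //.
have cB : closed [set x : RN | enorm x <= M].
  rewrite (_ : mkset _ = @enorm R N @^-1` [set t | t <= M])//.
  by apply: closed_comp; [move=> x _; exact: continuous_enorm|exact: closed_le].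
have sB : closure [set x | phi x != 0] `<=` [set x : RN | enorm x <= M].
  rewrite closureE; apply: smallest_sub => // x /= px; rewrite leNgt.
  by apply/negP => /sphi px0; rewrite px0 eqxx in px.
apply: (@compact_sub_closed_box _ _ _ M); first exact: closed_closure.
by move=> x /sB xM i; exact: le_trans (ler_coord_enorm _ _) xM.
Qed.

End Ck_calculus.

(** * Radial profiles *)

Section slicing.
Context (R : realType).
Local Notation leb := (@lebesgue_measure R).

(** A nondecreasing map that does not stretch sends an open interval into a closed one that is no
    longer, so a cover of [T] gives a cover of the image of no larger total length. *)
Lemma negligible_lipschitz_image (h : R -> R) (T : set R) :
  {homo h : x y / x <= y} -> (forall x y, x <= y -> h y - h x <= y - x) ->
  leb.-negligible T -> leb.-negligible (h @` T).
Proof.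
move=> hh hlip /negligible_outer_measure T0; apply/negligible_outer_measure.
apply/eqP; rewrite eq_le outer_measure_ge0 andbT; apply/lee_addgt0Pr => e e0.
rewrite add0e; have [F [Fitv TF] Fe] : exists2 I_, open_itv_cover T I_ &
    (\sum_(0 <= k <oo) wlength idfun (I_ k) < ((wlength idfun)^*)%mu T + e%:E)%E.
  rewrite outer_measure_open_itv_cover.
  have : (((@wlength R idfun)^*)%mu T) \is a fin_num by rewrite T0.
  rewrite outer_measure_open_itv_cover.
  by move=> /lb_ereal_inf_adherent-/(_ _ e0)[_/= [F]] AF <- Fe; exists F.
rewrite T0 add0e in Fe.
pose G k : set R := h @` (F k).
have hT : h @` T `<=` \bigcup_k G k.
  by move=> _ [t Tt <-]; have [k _ Fk] := TF _ Tt; exists k => //; exists t.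
apply: (@le_trans _ _ (((@wlength R idfun)^*)%mu (\bigcup_k G k))); first exact: le_outer_measure.
apply: (le_trans (outer_measure_sigma_subadditive _ _)).
apply: le_trans (ltW Fe); apply: lee_nneseries => [k _ _|k _]; first exact: outer_measure_ge0.
have [[a b] Fab] := Fitv k; rewrite /G Fab /=.
have [ab|ab] := ltP a b; last first.
  have -> : h @` `]a, b[%classic = set0.
    by apply/seteqP; split => // y [t /=]; rewrite in_itv/= => /andP[at_ tb]; lra.
  by rewrite outer_measure0 wlength_ge0.
have hab : h @` `]a, b[%classic `<=` `[h a, h b]%classic.
  move=> _ [t /= +] <-; rewrite !in_itv/= => /andP[at_ tb].
  by rewrite !hh// ltW.
apply: (@le_trans _ _ (((@wlength R idfun)^*)%mu `[h a, h b]%classic)); first exact: le_outer_measure.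
have -> : (((@wlength R idfun)^*)%mu `[h a, h b]%classic = leb `[h a, h b]%classic)%E by [].
rewrite lebesgue_measure_itv/= wlength_itv/= !lte_fin ab.
case: ifPn => _; last by rewrite -EFinB lee_fin subr_ge0 ltW.
by rewrite -!EFinB lee_fin hlip// ltW.
Qed.

Lemma sqrt_hypot_lipschitz (c x y : R) : 0 <= c -> 0 <= x -> x <= y ->
  Num.sqrt (y ^+ 2 + c) - Num.sqrt (x ^+ 2 + c) <= y - x.
Proof.
move=> c0 x0 xy; rewrite lerBlDl.
have sx : x <= Num.sqrt (x ^+ 2 + c).
  by rewrite -[leLHS](ger0_norm x0) -sqrtr_sqr ler_wsqrtr// lerDl.
have s0 : 0 <= Num.sqrt (x ^+ 2 + c) by exact: sqrtr_ge0.
have s2 : Num.sqrt (x ^+ 2 + c) ^+ 2 = x ^+ 2 + c by rewrite sqr_sqrtr// addr_ge0// sqr_ge0.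
rewrite -(ler_pXn2r (n:=2)) ?nnegrE ?sqrtr_ge0//; last by lra.
rewrite sqr_sqrtr ?addr_ge0 ?sqr_ge0//.
move: sx s0 s2; set s := Num.sqrt _ => sx s0 s2; nra.
Qed.

Lemma ae_slice_null n (Z : set 'rV[R]_n.+1) : measurable Z -> lebesgue_rV R n.+1 Z = 0%E ->
  {ae lebesgue_rV R n, forall v, leb [set s | Z (rV_cons (s, v))] = 0%E}.
Proof.
move=> mZ Z0; have mB := measurable_rV_cons_preimage mZ.
set B := _ @^-1` _ in mB.
pose f := EFin \o (\1_B : R * 'rV[R]_n -> R).
have mf : measurable_fun setT f by apply/measurable_EFinP; exact: measurable_indic.
have f0 z : (0 <= f z)%E by rewrite lee_fin.
have slice v : (\int[leb]_x f (x, v) = leb [set s | Z (rV_cons (s, v))])%E.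
  rewrite (_ : (fun x => f (x, v)) = EFin \o \1_(ysection B v)).
    rewrite integral_indic ?setIT//; last exact: measurable_ysection.
    by congr (leb _); apply/seteqP; split => s; rewrite /ysection/= inE.
  apply/funext => x; rewrite /f /= !indicE; congr ((nat_of_bool _)%:R%:E).
  by apply/idP/idP; rewrite /ysection !inE /= ?inE.
have mG := measurable_fun_fubini_tonelli_G (m1 := leb) f mf f0.
have : (\int[lebesgue_rV R n]_v fubini_G leb f v = 0)%E.
  rewrite -(fubini_tonelli2 (m1 := leb) (m2 := lebesgue_rV R n) f mf f0).
  by rewrite integral_indic ?setIT//.
move=> G0.
have : ae_eq (lebesgue_rV R n) setT (fubini_G leb f) (cst 0%E).
  apply/(ae_eq_integral_abs (lebesgue_rV R n) measurableT mG).
  rewrite -[RHS]G0; apply: eq_integral => v _; rewrite gee0_abs//.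
  exact: integral_ge0.
apply: filterS => v /(_ I) /= <-; by rewrite /fubini_G slice.
Qed.

Lemma eball_meets_ae n (P : 'rV[R]_n -> Prop) r : 0 < r ->
  {ae lebesgue_rV R n, forall v, P v} -> exists2 v, enorm v < r & P v.
Proof.
move=> r0 [A [mA A0 PA]]; apply: contrapT => H.
have : (lebesgue_rV R n (eball r) <= lebesgue_rV R n A)%E.
  apply: le_measure; rewrite ?inE//; first exact: measurable_eball.
  by move=> v vr; apply: PA => /= Pv; apply: H; exists v.
rewrite A0 lebesgue_rV_eball// lee_fin leNgt mulr_gt0 ?exprn_gt0//.
exact: unit_ball_volume_gt0.
Qed.

Lemma sqr_enorm_cons n (s : R) (v : 'rV[R]_n) :
  enorm (rV_cons (s, v)) ^+ 2 = s ^+ 2 + enorm v ^+ 2.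
Proof.
rewrite !sqr_enorm big_ord_recl !mxE unlift_none/=; congr (_ + _).
by apply: eq_bigr => i _; rewrite mxE liftK.
Qed.

(* The radial profile of [u] is read off a line parallel to the first axis that
   meets the exceptional set in a null set: this is what makes it measurable. *)
Lemma radial_profile n (u : 'rV[R]_n.+1 -> R) (rho : R) :
  measurable_fun setT u -> radial u -> 0 < rho ->
  exists F : R -> R, measurable_fun setT F /\
    {ae lebesgue_rV R n.+1, forall x, rho < enorm x -> u x = F (enorm x)}.
Proof.
move=> mu_ [f [Z [mZ Z0 ufZ]]] rho0.
(* By Tonelli almost every line parallel to the first axis meets [Z] in a null set. This one passes
   at distance less than [rho] from the origin, so it crosses every sphere of radius greater than
   [rho]. *)
have [v vrho Zv] := eball_meets_ae rho0 (ae_slice_null mZ Z0).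
pose s (r : R) := Num.sqrt (r ^+ 2 - enorm v ^+ 2).
have ms : measurable_fun setT s.
  apply: (measurableT_comp (continuous_measurable_fun (@sqrt_continuous R))).
  by apply: measurable_funB => //; exact: measurable_funX.
exists (fun r => u (rV_cons (s r, v))); split.
  apply: (measurableT_comp mu_); apply: (measurableT_comp (@measurable_rV_cons R n)).
  by apply/measurable_fun_pairP; split => //=; exact: measurable_cst.
(* The radius of the point at height [t >= 0] on the line, extended by a constant to [t < 0]. It is
   nondecreasing and does not stretch, so the radii of the exceptional points of the line form a
   null set. *)
pose h (t : R) := Num.sqrt (Num.max t 0 ^+ 2 + enorm v ^+ 2).
have h0 : 0 <= enorm v ^+ 2 by exact: sqr_ge0.
have m0 (x : R) : 0 <= Num.max x 0 by rewrite le_max lexx orbT.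
have hh : {homo h : x y / x <= y}.
  move=> x y xy; rewrite /h ler_wsqrtr// lerD2r lerXn2r ?nnegrE//.
  by rewrite ge_max !le_max lexx xy orbT.
have hlip x y : x <= y -> h y - h x <= y - x.
  move=> xy; apply: (le_trans (sqrt_hypot_lipschitz h0 (m0 x) _)).
    by rewrite ge_max !le_max lexx xy orbT.
  have [x0|x0] := leP x 0; have [y0|y0] := leP y 0; lra.
have mT : measurable [set t | Z (rV_cons (t, v))].
  have := measurable_ysection v (measurable_rV_cons_preimage mZ).
  by congr measurable; apply/seteqP; split => t; rewrite /ysection/= inE.
have nT : leb.-negligible (h @` [set t | Z (rV_cons (t, v))]).
  by apply: negligible_lipschitz_image => //; exact/negligibleP.
have := @ae_enorm R n (fun r => ~ (h @` [set t | Z (rV_cons (t, v))]) r).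
have nT' : {ae leb, forall r, ~ (h @` [set t | Z (rV_cons (t, v))]) r}.
  by apply: negligibleS nT => r /= /contrapT.
move=> /(_ nT') hx.
have uf : {ae lebesgue_rV R n.+1, forall x, u x = f (enorm x)} by exists Z.
move: hx uf; apply: filterS2 => x hx ufx xrho.
rewrite ufx.
have s2 : s (enorm x) ^+ 2 = enorm x ^+ 2 - enorm v ^+ 2.
  rewrite sqr_sqrtr// subr_ge0 lerXn2r ?nnegrE ?enorm_ge0//.
  exact: ltW (lt_trans vrho xrho).
have ex : enorm (rV_cons (s (enorm x), v)) = enorm x.
  apply/eqP; rewrite -(eqrXn2 (n:=2)) ?enorm_ge0//.
  by rewrite sqr_enorm_cons s2 subrK.
apply: contrapT => neq; apply: hx; exists (s (enorm x)) => /=.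
  by apply: ufZ => /= E; apply: neq; rewrite E ex.
rewrite /h max_l ?sqrtr_ge0// s2 subrK sqrtr_sqr ger0_norm// enorm_ge0//.
Qed.

End slicing.

Section volume_coordinate.
Context (R : realType) (n' : nat).
Local Notation n := n'.+1.
Local Notation mu := (lebesgue_rV R n).
Local Notation leb := (@lebesgue_measure R).
Local Notation vol := (@unit_ball_volume R n).

(* The volume of the ball of radius |x|.  As a coordinate on ]0, +oo[ it carries
   the Lebesgue measure of R^n to the one of R, so no radial density is needed. *)
Definition ball_volume (x : 'rV[R]_n) : measurableTypeR R := vol * enorm x ^+ n.

Lemma measurable_ball_volume : measurable_fun setT ball_volume.
Proof.
by apply: measurable_funM => //; apply: measurable_funX; exact: measurable_enorm.
Qed.

Lemma lebesgue_rV_sphere (r : R) : 0 < r -> mu (@enorm R n @^-1` [set r]) = 0%E.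
Proof.
move=> r0; apply/eqP; rewrite eq_le measure_ge0 andbT.
have r1 : 0 < r + 1 by lra.
have := @lebesgue_rV_radial_le R n' _ _ r1 (measurable_set1 r).
rewrite lebesgue_measure_set1 mule0; apply => x /= ->.
by rewrite in_itv/= r0 ltrDl ltr01.
Qed.

Lemma lebesgue_rV_cball (r : R) : 0 <= r ->
  mu (@enorm R n @^-1` `]-oo, r]%classic) = (vol * r ^+ n)%:E.
Proof.
rewrite le_eqVlt => /predU1P[<-|r0].
  rewrite (_ : _ @^-1` _ = [set x | enorm x = 0]).
    by rewrite expr0n/= mulr0 lebesgue_rV_origin.
  apply/seteqP; split => x /=; rewrite in_itv/=; last by move=> ->.
  by move=> x0; apply/eqP; rewrite eq_le x0 enorm_ge0.
have mS := @measurable_enorm_preimage R n _ (measurable_set1 r).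
have mB := @measurable_eball R n r.
have mC := @measurable_enorm_preimage R n _ (measurable_itv `]-oo, r]).
rewrite -lebesgue_rV_eball//; apply/eqP; rewrite eq_le; apply/andP; split.
  have : (mu (eball r `|` @enorm R n @^-1` [set r]) <= mu (eball r) + mu (@enorm R n @^-1` [set r]))%E.
    exact: measureU2.
  rewrite lebesgue_rV_sphere// adde0.
  apply: le_trans; apply: le_measure; rewrite ?inE//; first exact: measurableU.
  move=> x /=; rewrite in_itv/= le_eqVlt => /predU1P[->|xr]; first by right.
  by left.
apply: le_measure; rewrite ?inE//.
by move=> x /= xr; rewrite in_itv/= ltW.
Qed.

Definition volume_radius (t : R) : R := (t / vol) `^ n%:R^-1.

Lemma volume_radius_ge0 t : 0 <= volume_radius t. Proof. exact: powR_ge0. Qed.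

Lemma volume_radiusK t : 0 <= t -> vol * volume_radius t ^+ n = t.
Proof.
move=> t0; have v0 := @unit_ball_volume_gt0 R n.
rewrite -powR_mulrn ?volume_radius_ge0// -powRrM mulVf ?pnatr_eq0// powRr1.
  by rewrite mulrC divfK// gt_eqF.
by rewrite divr_ge0// ltW.
Qed.

Lemma ball_volumeK x : volume_radius (ball_volume x) = enorm x.
Proof.
have v0 := @unit_ball_volume_gt0 R n.
apply/eqP; rewrite -(eqrXn2 (n:=n)) ?volume_radius_ge0 ?enorm_ge0//.
rewrite -(inj_eq (mulfI (lt0r_neq0 v0))) volume_radiusK//.
by rewrite mulr_ge0 ?exprn_ge0 ?enorm_ge0// ltW.
Qed.

Lemma ball_volume_le t x : 0 <= t -> (ball_volume x <= t) = (enorm x <= volume_radius t).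
Proof.
move=> t0; have v0 := @unit_ball_volume_gt0 R n.
rewrite -{1}(volume_radiusK t0) /ball_volume ler_pM2l// ler_pXn2r// nnegrE.
  exact: enorm_ge0.
exact: volume_radius_ge0.
Qed.

Lemma lebesgue_rV_ball_volume_itv (a b : R) : 0 <= a -> a <= b ->
  mu (ball_volume @^-1` `]a, b]%classic) = (b - a)%:E.
Proof.
move=> a0 ab; have b0 := le_trans a0 ab.
pose B t := @enorm R n @^-1` `]-oo, volume_radius t]%classic.
have mB t : measurable (B t) by exact: measurable_enorm_preimage.
have muB t : 0 <= t -> mu (B t) = t%:E.
  by move=> t0; rewrite lebesgue_rV_cball ?volume_radius_ge0// volume_radiusK.
have BE t : 0 <= t -> B t = [set x | ball_volume x <= t].
  by move=> t0; apply/seteqP; split => x; rewrite /B /= in_itv/= ball_volume_le.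
rewrite (_ : _ @^-1` _ = B b `\` B a); last first.
  rewrite !BE//; apply/seteqP; split => x /=; rewrite in_itv/=.
    by case/andP => ax xb; split => //; apply/negP; rewrite -ltNge.
  by case => -> /negP; rewrite -ltNge => ->.
have E : B b `&` B a = B a.
  by rewrite setIidr// !BE// => x /= xa; exact: le_trans ab.
transitivity (mu (B b) - mu (B b `&` B a))%E.
  apply: measureD => //; change (mu (B b) < +oo)%E; by rewrite muB// ltry.
by rewrite E !muB.
Qed.

(** The image measure lives on the positive half-line, while uniqueness of Lebesgue measure concerns
    the whole line: Lebesgue measure on []-oo, 0]] is added to it, and [A] does not meet this
    half-line. *)
Lemma lebesgue_rV_ball_volume (A : set R) : measurable A -> A `<=` `]0, +oo[%classic ->
  mu (ball_volume @^-1` A) = leb A.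
Proof.
move=> mA A0; have mN : measurable (`]-oo, 0%R]%classic : set R) by exact: measurable_itv.
have mt := measurable_ball_volume.
have B0 x : 0 <= ball_volume x.
  by rewrite mulr_ge0 ?exprn_ge0 ?enorm_ge0// ltW// unit_ball_volume_gt0.
have H X : ocitv X -> leb X = measure_add (pushforward mu ball_volume) (mrestr leb mN) X.
  move=> [[a b] /= ab <-]; rewrite measure_addE /= /pushforward /mrestr.
  have [a0|a0] := leP 0 a.
    rewrite (_ : _ `&` _ = set0) ?measure0 ?adde0; last first.
      by apply/seteqP; split => x //=; rewrite !in_itv/= => -[/andP[xa _] x0]; lra.
    have [ba|{}ab] := ltP b a.
      have -> : `]a, b]%classic = set0 :> set R.
        by apply/seteqP; split => x //=; rewrite in_itv/= => /andP[xa xb]; lra.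
      by rewrite preimage_set0 !measure0.
    rewrite lebesgue_rV_ball_volume_itv// lebesgue_measure_itv/= lte_fin.
    case: ifPn => //; rewrite -leNgt => ba.
    by rewrite (_ : b = a) ?subrr//; apply/eqP; rewrite eq_le ab ba.
  have [b0|b0] := ltP b 0.
    rewrite (_ : _ @^-1` _ = set0); last first.
      apply/seteqP; split => x //=; rewrite in_itv/= => /andP[_ xb].
      by have := le_lt_trans (le_trans (B0 x) xb) b0; rewrite ltxx.
    rewrite measure0 add0e setIidl// => x /=; rewrite !in_itv/= => /andP[_ xb].
    exact: le_trans (ltW b0).
  rewrite (_ : _ @^-1` _ = @enorm R n @^-1` `]-oo, volume_radius b]%classic); last first.
    apply/seteqP; split => x; rewrite /= !in_itv/= ball_volume_le//; first by case/andP.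
    by move=> ->; rewrite andbT; exact: lt_le_trans (B0 x).
  rewrite (_ : _ `&` _ = `]a, 0%R]%classic); last first.
    apply/seteqP; split => x /=; rewrite !in_itv/=; first by move=> [/andP[-> _] ->].
    by move=> /andP[-> x0]; rewrite x0 (le_trans x0).
  rewrite [X in (X + _)%E]lebesgue_rV_cball ?volume_radius_ge0// volume_radiusK//.
  rewrite [X in (_ + X)%E]lebesgue_measure_itv lebesgue_measure_itv/= !lte_fin a0.
  by rewrite (lt_le_trans a0 b0) -!EFinB -EFinD sub0r.
rewrite (lebesgue_measure_unique (H mt) mA).
transitivity (mu (ball_volume @^-1` A) + leb (A `&` `]-oo, 0%R]))%E; last first.
  exact/esym/measure_addE.
rewrite (_ : A `&` _ = set0) ?measure0 ?adde0//.
by apply/seteqP; split => x // -[/A0]; rewrite /= !in_itv/= => x0; lra.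
Qed.

Lemma ball_volume_eq0 x : (ball_volume x == 0) = (enorm x == 0).
Proof. by rewrite mulf_eq0 gt_eqF ?unit_ball_volume_gt0//= expf_eq0. Qed.

Lemma ball_volume_gt0 x : (0 < ball_volume x) = (0 < enorm x).
Proof.
have B0 : 0 <= ball_volume x.
  by rewrite mulr_ge0 ?exprn_ge0 ?enorm_ge0// ltW// unit_ball_volume_gt0.
by rewrite !lt_neqAle B0 enorm_ge0 !andbT !(eq_sym 0) ball_volume_eq0.
Qed.

Lemma ae_ball_volume (P : R -> Prop) :
  {ae leb, forall t, P t} -> {ae mu, forall x, P (ball_volume x)}.
Proof.
move=> [A [mA A0 PA]].
have mI : measurable (A `&` `]0, +oo[%classic) by exact: measurableI.
have Z : mu.-negligible (ball_volume @^-1` (A `&` `]0, +oo[%classic)).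
  apply/negligibleP; first by rewrite -[X in measurable X]setTI; exact: measurable_ball_volume.
  transitivity (leb (A `&` `]0, +oo[%classic)); first exact: lebesgue_rV_ball_volume.
  apply/eqP; rewrite eq_le measure_ge0 andbT -A0.
  by apply: le_measure; rewrite ?inE.
have := negligibleU (@ae_enorm_gt0 R n') Z; apply: negligibleS => x /= Px.
have [x0|x0] := ltP 0 (enorm x); last by left => /=.
by right; split => /=; [exact: PA|rewrite in_itv/= andbT ball_volume_gt0].
Qed.

Lemma ge0_integral_ball_volume (D : set R) (f : R -> \bar R) :
  measurable D -> D `<=` `]0, +oo[%classic -> measurable_fun setT f ->
  (forall r, (0 <= f r)%E) ->
  (\int[mu]_(x in ball_volume @^-1` D) f (ball_volume x) = \int[leb]_(r in D) f r)%E.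
Proof.
move=> mD D0 mf f0.
have := @ge0_integral_pushforward _ _ _ (measurableTypeR R) R _ measurable_ball_volume mu D f mD.
move=> <-; last 2 first.
- exact: measurable_funS mf.
- by move=> y _; exact: f0.
apply: eq_measure_integral; first exact: measurable_ball_volume.
move=> mt A mA AD; exact: (lebesgue_rV_ball_volume mA (subset_trans AD D0)).
Qed.

End volume_coordinate.

(** * Pointwise decay of radial functions *)

Section bounded_multiplier.
Context d (T : measurableType d) (R : realType).
Variable mu : {measure set T -> \bar R}.
Implicit Types (f theta : T -> R) (S : set T).

Lemma integrable_mul_bounded S f theta M : measurable S ->
  mu.-integrable S (EFin \o f) -> measurable_fun setT f -> measurable_fun setT theta ->
  (forall x, `|theta x| <= M) -> (forall x, ~ S x -> theta x = 0) ->
  mu.-integrable setT (EFin \o (fun x => f x * theta x)) /\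
  `|\int[mu]_x (f x * theta x)| <= M * \int[mu]_(x in S) `|f x|.
Proof.
move=> mS intf mf mth thM thS.
have intn : mu.-integrable S (EFin \o (fun x => M * `|f x|)).
  have := integrableZl mS M (integrable_norm intf).
  by apply: eq_integrable.
have ib : mu.-integrable setT (EFin \o ((fun x => M * `|f x|) \_ S)).
  by rewrite -restrict_EFin; apply/(integrable_mkcond _ mS).
have le x : `|f x * theta x| <= ((fun x => M * `|f x|) \_ S) x.
  rewrite patchE; case: ifPn => [_|].
    by rewrite normrM mulrC ler_wpM2r.
  by rewrite notin_setE => /thS ->; rewrite mulr0 normr0.
have ift : mu.-integrable setT (EFin \o (fun x => f x * theta x)).
  apply: le_integrable ib => //.
    by apply/measurable_EFinP; exact: measurable_funM.
  by move=> x _ /=; rewrite lee_fin (le_trans (le x))// ler_norm.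
split => //; apply: (le_trans (le_normr_Rintegral measurableT ift)).
apply: (@le_trans _ _ (\int[mu]_x ((fun x => M * `|f x|) \_ S) x)).
  apply: le_Rintegral => //; exact: integrable_norm.
by rewrite -Rintegral_mkcond RintegralZl//; exact: integrable_norm.
Qed.

Lemma Rintegral_sum D m (F : 'I_m -> T -> R) : measurable D ->
  (forall j, mu.-integrable D (EFin \o F j)) ->
  mu.-integrable D (EFin \o (fun x => \sum_j F j x)) /\
  \int[mu]_(x in D) (\sum_j F j x) = \sum_j \int[mu]_(x in D) F j x.
Proof.
move=> mD; elim: m F => [|m IH] F intF.
  split.
    apply: (eq_integrable mD (cst 0%E)); last exact: integrable0.
    by move=> x _; rewrite /= big_ord0.
  under eq_Rintegral do rewrite big_ord0.
  by rewrite big_ord0 Rintegral_cst// mul0r.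
have [i1 e1] := IH (fun j => F (lift ord0 j)) (fun j => intF _).
split.
  apply: (eq_integrable mD (fun x => (F ord0 x)%:E + (\sum_j F (lift ord0 j) x)%:E)%E).
    by move=> x _; rewrite /= big_ord_recl EFinD.
  exact: (integrableD mD (intF ord0) i1).
under eq_Rintegral do rewrite big_ord_recl.
by rewrite RintegralD// e1 big_ord_recl.
Qed.

End bounded_multiplier.

Section weak_gradient_facts.
Context (R : realType) (N : nat).
Local Notation RN := 'rV[R]_N.
Local Notation mu := (lebesgue_rV R N).

Lemma locally_L1_measurable (f : RN -> R) : locally_L1 f -> measurable_fun setT f.
Proof.
move=> lf; have -> : [set: RN] = \bigcup_k @box R N k%:R.
  apply/esym; rewrite -subTset => x _; exists (Num.truncn (enorm x)).+1 => // i.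
  by rewrite (le_trans (ler_coord_enorm _ _))// ltW// truncnS_gt.
apply/measurable_fun_bigcup => [k|k]; first exact: measurable_box.
have /integrableP[mf _] := lf _ (@compact_box R N k%:R).
exact/measurable_EFinP.
Qed.

Lemma locally_L1_bounded (f : RN -> R) S M : locally_L1 f -> measurable S ->
  (forall x, S x -> enorm x <= M) -> mu.-integrable S (EFin \o f).
Proof.
move=> lf mS SM; apply: (integrableS (@measurable_box R N M) mS); last first.
  exact: lf (@compact_box R N M).
by move=> x /SM xM i; exact: le_trans (ler_coord_enorm _ _) xM.
Qed.

Lemma measurable_enorm_comp d (T : measurableType d) (g : T -> RN) :
  (forall i, measurable_fun setT (fun x => g x ord0 i)) ->
  measurable_fun setT (fun x => enorm (g x)).
Proof.
by move=> mg; apply: (measurableT_comp (@measurable_enorm R N)); exact: measurable_fun_rV.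
Qed.

Lemma integrable_enorm_gradient (u : RN -> R) (g : RN -> RN) S M : is_weak_gradient u g ->
  measurable S -> (forall x, S x -> enorm x <= M) ->
  mu.-integrable S (EFin \o (fun x => enorm (g x))).
Proof.
move=> [_ hg] mS SM.
have mg i : measurable_fun setT (fun x => g x ord0 i).
  by apply: locally_L1_measurable; have [] := hg i.
have ig i : mu.-integrable S (EFin \o (fun x => `|g x ord0 i|)).
  by apply: integrable_norm; apply: (locally_L1_bounded _ mS SM); have [] := hg i.
have [is_ _] := Rintegral_sum mS ig.
apply: le_integrable is_ => //.
  apply/measurable_EFinP; apply: measurable_funTS; exact: measurable_enorm_comp.
move=> x _ /=; rewrite lee_fin ger0_norm ?enorm_ge0// ger0_norm; last exact: sumr_ge0.
rewrite -(ler_pXn2r (n:=2)) ?nnegrE ?enorm_ge0 ?sumr_ge0// sqr_enorm.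
rewrite expr2 big_distrl/=; apply: ler_sum => i _; rewrite -real_normK ?num_real// expr2.
by rewrite ler_wpM2l// (bigD1 i)//= lerDl sumr_ge0.
Qed.

End weak_gradient_facts.

(** * Testing the weak gradient against radial vector fields *)

Section radial_test.
Context (R : realType) (N : nat).
Local Notation RN := 'rV[R]_N.
Local Notation mu := (lebesgue_rV R N).
Context (u : RN -> R) (g : RN -> RN).
Hypothesis ug : is_weak_gradient u g.
Context (chi chi' : R -> R) (a b C : R).
Hypothesis schi : smooth chi.
Hypothesis dchi : forall t : R, is_derive t (1 : R) chi (chi' t).
Hypothesis chi_supp : forall t, 0 <= t -> ~ (a < t < b) -> chi (t ^+ 2) = 0.
Hypothesis chi'_supp : forall t, 0 <= t -> ~ (a < t < b) -> chi' (t ^+ 2) = 0.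
Hypothesis chi_bound : forall t, `|chi t| <= 1.
Hypothesis chi'_bound : forall t, `|chi' t| <= C.

Local Notation S := (@enorm R N @^-1` `]a, b[%classic).

Let phi (i : 'I_N) (x : RN) : R := x ord0 i * radial_smooth chi x.

Let test_phi i : test_function (phi i).
Proof.
apply: (@test_function_supp _ _ _ b) => [k|x bx].
  by apply: CkM; [exact: Ck_coord|exact: Ck_radial_smooth].
rewrite /phi /radial_smooth chi_supp ?mulr0 ?enorm_ge0//.
by move=> /andP[_]; rewrite ltNge (ltW bx).
Qed.

Let partial_phi i x : partial i (phi i) x =
  radial_smooth chi x + 2 * (x ord0 i ^+ 2 * chi' (enorm x ^+ 2)).
Proof.
have [_ E] := is_deriveM (is_derive_coord i i x) (is_derive_radial_smooth i x dchi).
rewrite /partial (_ : phi i = (fun x : RN => x ord0 i) * radial_smooth chi)// E.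
by rewrite eqxx /GRing.scale/=; ring.
Qed.

Let mS : measurable S. Proof. exact: measurable_enorm_preimage. Qed.

Let Sb x : S x -> enorm x <= b.
Proof. by rewrite /= in_itv/= => /andP[_ /ltW]. Qed.

Let notS x : ~ S x -> ~ (a < enorm x < b). Proof. by rewrite /= in_itv. Qed.

Let mu_ : measurable_fun setT u.
Proof. by apply: locally_L1_measurable; case: ug. Qed.

Let mg i : measurable_fun setT (fun x => g x ord0 i).
Proof. by apply: locally_L1_measurable; have [_ /(_ i)[]] := ug. Qed.

Let iu : mu.-integrable S (EFin \o u).
Proof. by apply: (locally_L1_bounded _ mS Sb); case: ug. Qed.

Let ig i : mu.-integrable S (EFin \o (fun x => g x ord0 i)).
Proof. by apply: (locally_L1_bounded _ mS Sb); have [_ /(_ i)[]] := ug. Qed.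

Let mchi : measurable_fun setT (@radial_smooth R N chi).
Proof. by apply: continuous_measurable_rV; apply: (@Ck_continuous _ _ 0); exact: Ck_radial_smooth. Qed.

Let mchi' : measurable_fun setT (fun x : RN => chi' (enorm x ^+ 2)).
Proof.
have [f' [df [f'' [df' _]]]] := schi 2.
have -> : chi' = f' by apply/funext => t; have [_ <-] := dchi t; have [_ <-] := df t.
apply: (measurableT_comp (continuous_measurable_fun (is_derive_continuous df'))).
by apply: measurable_funX; exact: measurable_enorm.
Qed.

Let mphi i : measurable_fun setT (phi i).
Proof. by apply: measurable_funM => //; exact: measurable_rV_coord. Qed.

(** Summed over i, the partial derivatives of x_i chi(|x|^2) give the divergence N chi + 2 |x|^2
    chi' of a radial field. The second term stays on the left; the first is bounded by |chi| <= 1,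
    and each product with a component of the gradient by |x_i| <= b. *)
Lemma radial_test_bound :
  2 * `|\int[mu]_x (u x * (enorm x ^+ 2 * chi' (enorm x ^+ 2)))| <=
  N%:R * \int[mu]_(x in S) `|u x| + N%:R * b * \int[mu]_(x in S) enorm (g x).
Proof.
have [b0|b0] := ltP 0 b; last first.
  have E x : enorm x ^+ 2 * chi' (enorm x ^+ 2) = 0.
    rewrite chi'_supp ?mulr0 ?enorm_ge0// => /andP[_ xb].
    by have := le_lt_trans (enorm_ge0 x) (lt_le_trans xb b0); rewrite ltxx.
  under eq_Rintegral do rewrite E mulr0.
  have -> : S = set0.
    apply/seteqP; split => x //=; rewrite in_itv/= => /andP[_ xb].
    by have := le_lt_trans (enorm_ge0 x) (lt_le_trans xb b0); rewrite ltxx.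
  by rewrite !Rintegral_set0 Rintegral_cst// mul0r normr0 !mulr0 addr0.
have [iuc bc] := @integrable_mul_bounded _ _ _ mu S u (radial_smooth chi) 1 mS iu mu_ mchi
  (fun x => chi_bound _) (fun x nS => chi_supp (enorm_ge0 x) (notS nS)).
pose th (i : 'I_N) (x : RN) := x ord0 i ^+ 2 * chi' (enorm x ^+ 2).
have mth i : measurable_fun setT (th i).
  by apply: measurable_funM => //; apply: measurable_funX; exact: (measurable_rV_coord i).
have thS i x : ~ S x -> th i x = 0.
  by move=> nS; rewrite /th chi'_supp ?mulr0 ?enorm_ge0//; exact: notS.
have thb i x : `|th i x| <= b ^+ 2 * C.
  have C0 : 0 <= C by exact: le_trans (chi'_bound 0).
  have [xb|bx] := leP (enorm x) b; last first.
    have nS : ~ S x by move=> /Sb xb; have := lt_le_trans bx xb; rewrite ltxx.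
    by rewrite thS// normr0 mulr_ge0// sqr_ge0.
  rewrite normrM ler_pM// normrX lerXn2r ?nnegrE//; first exact: ltW.
  exact: le_trans (ler_coord_enorm _ _) xb.
have iuth i : mu.-integrable setT (EFin \o (fun x => u x * th i x)).
  by have [] := @integrable_mul_bounded _ _ _ mu S u (th i) _ mS iu mu_ (mth i) (thb i) (@thS i).
have [_ sumE] := Rintegral_sum measurableT iuth.
have key i : 2 * \int[mu]_x (u x * th i x) =
    - (\int[mu]_x (u x * radial_smooth chi x)) - (\int[mu]_x (g x ord0 i * phi i x)).
  have [_ /(_ i)[_ /(_ _ (test_phi i))]] := ug.
  under eq_Rintegral do rewrite partial_phi mulrDr (mulrCA _ 2).
  rewrite RintegralD//; last first.
    have := integrableZl measurableT 2 (iuth i).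
    by apply: eq_integrable.
  rewrite RintegralZl//; last exact: (iuth i).
  by move=> h; rewrite -h -[X in 2 * X]/(\int[mu]_x (u x * th i x)); ring.
have gb i : `|\int[mu]_x (g x ord0 i * phi i x)| <= b * \int[mu]_(x in S) enorm (g x).
  have phib x : `|phi i x| <= b.
    have [xb|bx] := leP (enorm x) b; last first.
      rewrite /phi /radial_smooth chi_supp ?mulr0 ?normr0 ?enorm_ge0//; first exact: ltW.
      by move=> /andP[_]; rewrite ltNge (ltW bx).
    rewrite normrM -[leRHS]mulr1 ler_pM//; last exact: chi_bound.
    exact: le_trans (ler_coord_enorm _ _) xb.
  have phiS x : ~ S x -> phi i x = 0.
    by move=> nS; rewrite /phi /radial_smooth chi_supp ?mulr0 ?enorm_ge0//; exact: notS.
  have [_ h] := @integrable_mul_bounded _ _ _ mu S _ (phi i) b mS (ig i) (mg i) (mphi i) phib phiS.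
  apply: (le_trans h); rewrite ler_wpM2l ?(ltW b0)//; apply: le_Rintegral => //.
  - exact: integrable_norm.
  - exact: (integrable_enorm_gradient ug mS Sb).
  - by move=> x _; exact: ler_coord_enorm.
have -> : \int[mu]_x (u x * (enorm x ^+ 2 * chi' (enorm x ^+ 2))) =
    \sum_i \int[mu]_x (u x * th i x).
  rewrite -sumE; apply: eq_Rintegral => x _.
  by rewrite -mulr_sumr -mulr_suml sqr_enorm.
rewrite -[2 in leLHS]ger0_norm// -normrM mulr_sumr.
apply: (le_trans (ler_norm_sum _ _ _)).
have -> : N%:R * \int[mu]_(x in S) `|u x| + N%:R * b * \int[mu]_(x in S) enorm (g x) =
    \sum_(i < N) (\int[mu]_(x in S) `|u x| + b * \int[mu]_(x in S) enorm (g x)).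
  by rewrite sumr_const card_ord -[RHS]mulr_natl mulrDr mulrA.
apply: ler_sum => i _; rewrite key -opprD normrN (le_trans (ler_normD _ _))//.
by rewrite lerD// (le_trans bc)// mul1r.
Qed.

End radial_test.

Section radial_kernel.
Context (R : realType) (N : nat).
Local Notation RN := 'rV[R]_N.
Local Notation mu := (lebesgue_rV R N).
Local Notation P := (@smooth_step R).
Local Notation P' := (@smooth_step' R).

(* An approximation, as e tends to 0, of a multiple of the surface measure of the
   sphere of radius a. *)
Definition sphere_kernel (a e : R) (x : RN) : R :=
  enorm x ^+ 2 * (P' ((enorm x ^+ 2 - a ^+ 2) / e) / e).

Lemma measurable_sphere_kernel a e : measurable_fun setT (sphere_kernel a e).
Proof.
have mx : measurable_fun setT (fun x : RN => enorm x ^+ 2).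
  by apply: measurable_funX; exact: measurable_enorm.
apply: measurable_funM => //; apply: measurable_funM => //.
apply: (measurableT_comp (continuous_measurable_fun (@continuous_smooth_step' R))).
by apply: measurable_funM => //; exact: measurable_funB.
Qed.

Lemma sphere_kernel_ge0 a e x : 0 < e -> 0 <= sphere_kernel a e x.
Proof.
by move=> e0; rewrite /sphere_kernel mulr_ge0 ?sqr_ge0// divr_ge0 ?smooth_step'_ge0// ltW.
Qed.

Lemma sphere_kernel_out a e x : 0 < e ->
  ~ (a ^+ 2 < enorm x ^+ 2 < a ^+ 2 + e) -> sphere_kernel a e x = 0.
Proof.
move=> e0 /negP; rewrite negb_and -!leNgt => h.
rewrite /sphere_kernel smooth_step'_out ?mul0r ?mulr0//.
case/orP : h => h; [left|right].
  by rewrite pmulr_lle0 ?invr_gt0// subr_le0.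
by rewrite ler_pdivlMr// mul1r lerBrDl.
Qed.

Lemma sphere_kernel_le a e M B x : 0 < e -> (forall t, P' t <= B) ->
  a ^+ 2 + e <= M -> `|sphere_kernel a e x| <= M * B / e.
Proof.
move=> e0 PB aM.
have B0 : 0 <= B by exact: le_trans (smooth_step'_ge0 0) (PB 0).
have M0 : 0 <= M by apply: le_trans aM; rewrite addr_ge0 ?sqr_ge0// ltW.
have [/andP[_ xM]|xo] := pselect (a ^+ 2 < enorm x ^+ 2 < a ^+ 2 + e).
  rewrite ger0_norm ?sphere_kernel_ge0// /sphere_kernel -mulrA ler_pM ?sqr_ge0//.
  - by rewrite divr_ge0 ?smooth_step'_ge0// ltW.
  - exact: le_trans (ltW xM) aM.
  - by rewrite ler_wpM2r// invr_ge0 ltW.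
by rewrite sphere_kernel_out// normr0 divr_ge0 ?mulr_ge0// ltW.
Qed.

Context (u : RN -> R) (g : RN -> RN) (B : R).
Hypothesis ug : is_weak_gradient u g.
Hypothesis PB : forall t, P' t <= B.

(** |x|^2 chi' is the difference of the kernels of width [e] and [l = a^2 d]. The second is not
    thin: it is bounded by a multiple of 1/d and moves to the right-hand side, which is then
    independent of [e]. *)
Lemma sphere_average_bound (a d e : R) : 0 < a -> 0 < d -> d <= 1 -> 0 < e -> e <= a ^+ 2 * d ->
  `|\int[mu]_x (u x * sphere_kernel a e x)| <=
  (4 * B / d + N%:R) * \int[mu]_(x in @enorm R N @^-1` `]a, a * (1 + d)[%classic) `|u x| +
  2 * a * N%:R * \int[mu]_(x in @enorm R N @^-1` `]a, a * (1 + d)[%classic) enorm (g x).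
Proof.
move=> a0 d0 d1 e0 el; set b := a * (1 + d); set S := _ @^-1` _.
(* Both layers lie in the shell because a^2 + l <= (a (1 + d))^2. *)
set l := a ^+ 2 * d in el; have l0 : 0 < l by exact: lt_le_trans el.
have ab : a <= b by rewrite /b ler_pMr// lerDl ltW.
have b2a : b <= 2 * a by rewrite /b mulrC ler_wpM2r ?(ltW a0)//; lra.
have b0 : 0 <= b by exact: le_trans (ltW a0) ab.
have lb : a ^+ 2 + l <= b ^+ 2.
  rewrite /b exprMn /l -[X in X + _]mulr1 -mulrDr ler_wpM2l ?sqr_ge0//; nra.
pose arg (e t : R) := e^-1 * t + (- (a ^+ 2 / e)).
have argE (c t : R) : arg c t = (t - a ^+ 2) / c by rewrite /arg; ring.
pose chi (t : R) := P (arg e t) + (-1) * P (arg l t).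
pose chi' (t : R) := P' (arg e t) / e + (-1) * (P' (arg l t) / l).
have schi : smooth chi.
  move=> k; apply: smooth_uptoD; first by apply: smooth_upto_affine; exact: smooth_smooth_step.
  apply: smooth_uptoM; first exact: smooth_cst.
  by apply: smooth_upto_affine; exact: smooth_smooth_step.
have darg (c : R) t : is_derive t (1 : R) (fun t => P (arg c t)) (P' (arg c t) / c).
  apply: (@is_derive1_comp R P (arg c)); first exact: is_derive_smooth_step.
  have := is_deriveD (is_deriveZ (c^-1 : R) (is_derive_id t (1 : R))) (is_derive_cst (- (a ^+ 2 / c)) t (1 : R)).
  by rewrite addr0 /GRing.scale/= mulr1.
have dchi t : is_derive t (1 : R) chi (chi' t).
  exact: (is_deriveD (darg e t) (is_deriveZ (-1 : R) (darg l t))).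
have aout t : 0 <= t -> ~ (a < t < b) -> t ^+ 2 - a ^+ 2 <= 0 \/ l <= t ^+ 2 - a ^+ 2.
  move=> t0 /negP; rewrite negb_and -!leNgt => /orP[ta|bt]; [left|right].
    by rewrite subr_le0 lerXn2r ?nnegrE// ltW.
  by rewrite lerBrDl (le_trans lb)// lerXn2r ?nnegrE.
have arg0 (c t : R) : 0 < c -> t <= 0 -> t / c <= 0 by move=> c0 t0; rewrite pmulr_lle0 ?invr_gt0.
have arg1 (c t : R) : 0 < c -> c <= t -> 1 <= t / c by move=> c0 ct; rewrite ler_pdivlMr// mul1r.
have csupp t : 0 <= t -> ~ (a < t < b) -> chi (t ^+ 2) = 0.
  move=> t0 /(aout _ t0)[h|h]; rewrite /chi !argE.
    by rewrite !smooth_step_le0 ?arg0// mulr0 addr0.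
  by rewrite !smooth_step_ge1 ?arg1// ?(le_trans el)// mulr1 subrr.
have c'supp t : 0 <= t -> ~ (a < t < b) -> chi' (t ^+ 2) = 0.
  move=> t0 /(aout _ t0)[h|h]; rewrite /chi' !argE.
    by rewrite !smooth_step'_out ?mul0r ?mulr0 ?addr0//; left; exact: arg0.
  by rewrite !smooth_step'_out ?mul0r ?mulr0 ?addr0//; right; apply: arg1 => //; exact: le_trans el h.
have cb t : `|chi t| <= 1.
  rewrite /chi mulN1r ler_norml.
  have := @smooth_step_ge0 R (arg e t); have := @smooth_step_ge0 R (arg l t).
  have := @smooth_step_le1 R (arg e t); have := @smooth_step_le1 R (arg l t).
  by move=> *; apply/andP; split; lra.
have c'b t : `|chi' t| <= B / e + B / l.
  have q (c s : R) : 0 < c -> `|P' s / c| <= B / c.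
    move=> c0; rewrite normrM (ger0_norm (smooth_step'_ge0 s)) gtr0_norm ?invr_gt0//.
    by rewrite ler_wpM2r// invr_ge0 ltW.
  by rewrite /chi' mulN1r (le_trans (ler_normB _ _))// lerD ?q.
have := radial_test_bound ug schi dchi csupp c'supp cb c'b.
rewrite -/S.
have mS : measurable S by exact: measurable_enorm_preimage.
have Sb x : S x -> enorm x <= b by rewrite /S /= in_itv/= => /andP[_ /ltW].
have mu_ : measurable_fun setT u by apply: locally_L1_measurable; case: ug.
have iu : mu.-integrable S (EFin \o u) by apply: (locally_L1_bounded _ mS Sb); case: ug.
have kS (c : R) x : 0 < c -> c <= l -> ~ S x -> sphere_kernel a c x = 0.
  move=> c0 cl nS; apply: sphere_kernel_out => // /andP[h1 h2]; apply: nS.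
  rewrite /S /= in_itv/=; apply/andP; split.
    by move: h1; rewrite ltr_pXn2r ?nnegrE ?enorm_ge0// ltW.
  rewrite -(ltr_pXn2r (n:=2)) ?nnegrE ?enorm_ge0//; apply: lt_le_trans lb.
  by apply: lt_le_trans h2 _; rewrite lerD2l.
have kle (c : R) x : 0 < c -> c <= l -> `|sphere_kernel a c x| <= b ^+ 2 * B / c.
  move=> c0 cl; apply: sphere_kernel_le => //.
  by apply: le_trans lb; rewrite lerD2l.
have [ie _] := @integrable_mul_bounded _ _ _ mu S u _ _ mS iu mu_
  (measurable_sphere_kernel a e) (fun x => kle _ x e0 el) (fun x => kS _ x e0 el).
have [il bl] := @integrable_mul_bounded _ _ _ mu S u _ _ mS iu mu_
  (measurable_sphere_kernel a l) (fun x => kle _ x l0 (lexx l)) (fun x => kS _ x l0 (lexx l)).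
have -> : \int[mu]_x (u x * (enorm x ^+ 2 * chi' (enorm x ^+ 2))) =
    \int[mu]_x (u x * sphere_kernel a e x) - \int[mu]_x (u x * sphere_kernel a l x).
  rewrite -RintegralB//; apply: eq_Rintegral => x _.
  by rewrite /chi' !argE /sphere_kernel; ring.
have u0 : 0 <= \int[mu]_(x in S) `|u x| by exact: Rintegral_ge0.
have g0 : 0 <= \int[mu]_(x in S) enorm (g x) by apply: Rintegral_ge0 => x _; exact: enorm_ge0.
have B0 : 0 <= B by exact: le_trans (smooth_step'_ge0 0) (PB 0).
have bl' : b ^+ 2 * B / l <= 4 * B / d.
  rewrite /l invfM mulrA ler_wpM2r ?invr_ge0 ?(ltW d0)//.
  rewrite mulrAC ler_wpM2r// ler_pdivrMr ?exprn_gt0//.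
  have -> : 4 * a ^+ 2 = (2 * a) ^+ 2 by ring.
  by rewrite lerXn2r ?nnegrE// mulr_ge0// ltW.
move: u0 g0 bl; set U := \int[mu]_(x in S) `|u x|; set G := \int[mu]_(x in S) enorm (g x).
set X := \int[mu]_x (u x * sphere_kernel a e x).
set Y := \int[mu]_x (u x * sphere_kernel a l x) => U0 G0 bl h.
have hY : `|Y| <= 4 * B / d * U by apply: (le_trans bl); rewrite ler_wpM2r.
have hX : `|X| <= `|X - Y| + `|Y| by rewrite -{1}(subrK Y X) ler_normD.
have n0 : 0 <= N%:R :> R by [].
have h2 : N%:R * b * G <= N%:R * (2 * a) * G by rewrite ler_wpM2r// ler_wpM2l.
have h3 : 0 <= N%:R * U by rewrite mulr_ge0.
have h4 : 0 <= N%:R * (2 * a) * G by rewrite !mulr_ge0// ltW.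
rewrite mulrDl (_ : 2 * a * N%:R * G = N%:R * (2 * a) * G); last by ring.
lra.
Qed.

End radial_kernel.

(** * Lebesgue points of the radial profile *)

Section lebesgue_points.
Context (R : realType) (m : nat).
Local Notation n := m.+2.
Local Notation RN := 'rV[R]_n.
Local Notation mu := (lebesgue_rV R n).
Local Notation leb := (@lebesgue_measure R).
Local Notation vol := (@unit_ball_volume R n).
Local Notation P' := (@smooth_step' R).

Context (B c0 : R).
Hypothesis PB : forall t, P' t <= B.
Hypothesis c0_gt0 : 0 < c0.
Hypothesis Pc0 : forall t, 1 / 3 <= t <= 2 / 3 -> c0 <= P' t.

Let v0 : 0 < vol := @unit_ball_volume_gt0 R n.

Let B0 : 0 <= B.
Proof. exact: le_trans (smooth_step'_ge0 0) (PB 0). Qed.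

Definition kernel_mass : R := vol * c0 / 3.

Lemma kernel_mass_gt0 : 0 < kernel_mass.
Proof. by rewrite /kernel_mass !mulr_gt0// invr_gt0. Qed.

(** On the middle third of the layer, measured in |x|^2, the kernel is at least a^2 c0 / e, and this
    part has volume at least vol a^(n-2) e / 3; the product does not depend on [e]. *)
Lemma sphere_kernel_mass (a e : R) : 0 < a -> 0 < e ->
  mu.-integrable setT (EFin \o @sphere_kernel R n a e) ->
  kernel_mass * a ^+ n <= \int[mu]_x sphere_kernel a e x.
Proof.
move=> a0 e0 ik.
pose p := Num.sqrt (a ^+ 2 + e / 3); pose q := Num.sqrt (a ^+ 2 + 2 * e / 3).
have a20 : 0 < a ^+ 2 by rewrite exprn_gt0.
have p2 : p ^+ 2 = a ^+ 2 + e / 3 by rewrite sqr_sqrtr// addr_ge0 ?ltW// divr_gt0.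
have q2 : q ^+ 2 = a ^+ 2 + 2 * e / 3 by rewrite sqr_sqrtr// addr_ge0 ?ltW// divr_gt0// mulr_gt0.
have q0 : 0 <= q by exact: sqrtr_ge0.
have ap : a <= p.
  rewrite -(ler_pXn2r (n:=2)) ?nnegrE ?sqrtr_ge0 ?(ltW a0)// p2 lerDl.
  by rewrite divr_ge0// ltW.
have p0 : 0 < p by exact: lt_le_trans ap.
have pq : p <= q.
  by rewrite -(ler_pXn2r (n:=2)) ?nnegrE ?(ltW p0)// p2 q2 lerD2l; lra.
pose Q : set RN := @enorm R n @^-1` `[p, q[%classic.
have mQ : measurable Q by exact: measurable_enorm_preimage.
have muQ : mu Q = (vol * (q ^+ n - p ^+ n))%:E by exact: lebesgue_rV_shell.
(* With a square split off, the increment q^n - p^n is compared with q^2 - p^2 = e / 3. *)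
have nE (r : R) : r ^+ n = r ^+ m * r ^+ 2 by rewrite -exprD addn2.
have vQ : vol * (a ^+ m * (e / 3)) <= vol * (q ^+ n - p ^+ n).
  rewrite ler_pM2l//.
  have -> : e / 3 = q ^+ 2 - p ^+ 2 by rewrite q2 p2; lra.
  apply: (@le_trans _ _ (p ^+ m * (q ^+ 2 - p ^+ 2))).
    rewrite ler_wpM2r//; first by rewrite subr_ge0 lerXn2r ?nnegrE// ltW.
    by rewrite lerXn2r ?nnegrE// ltW.
  rewrite mulrBr -nE lerB// nE ler_wpM2r ?sqr_ge0//.
  by rewrite lerXn2r ?nnegrE// ltW.
apply: (@le_trans _ _ (\int[mu]_(x in Q) (a ^+ 2 * c0 / e))).
  rewrite Rintegral_cst// (_ : fine _ = vol * (q ^+ n - p ^+ n)); last by rewrite [X in fine X]muQ.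
  have -> : kernel_mass * a ^+ n = a ^+ 2 * c0 / e * (vol * (a ^+ m * (e / 3))).
    by rewrite /kernel_mass nE; field; rewrite gt_eqF.
  by rewrite ler_wpM2l// divr_ge0 ?mulr_ge0 ?ltW.
rewrite Rintegral_mkcond; apply: le_Rintegral => //.
  rewrite -restrict_EFin; apply/(integrable_mkcond _ mQ).
  apply/integrableP; split; first exact: measurable_cst.
  under eq_integral do rewrite /= .
  by rewrite integral_cst// [X in (_ * X)%E]muQ -EFinM ltry.
move=> x _; rewrite patchE; case: ifPn => [|_]; last exact: sphere_kernel_ge0.
rewrite inE /Q /= in_itv/= => /andP[px xq].
have px2 : p ^+ 2 <= enorm x ^+ 2 by rewrite lerXn2r ?nnegrE ?enorm_ge0// ltW.
have xq2 : enorm x ^+ 2 <= q ^+ 2 by rewrite lerXn2r ?nnegrE ?enorm_ge0// ltW.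
rewrite p2 in px2; rewrite q2 in xq2.
rewrite /sphere_kernel -mulrA ler_pM ?sqr_ge0 ?divr_ge0 ?(ltW e0) ?(ltW c0_gt0)//.
  by apply: le_trans px2; rewrite lerDl divr_ge0// ltW.
rewrite ler_wpM2r ?invr_ge0 ?(ltW e0)//; apply: Pc0.
by rewrite ler_pdivlMr// ler_pdivrMr//; apply/andP; split; lra.
Qed.

(** This locates the support of the kernel in the volume coordinate: an interval to the right of the
    value at radius [a], of length proportional to [e]. The constant is the Lipschitz bound of the
    volume on [[a, 2 a]] times 1/a, as |x| - a < e/a. *)
Lemma ball_volume_shift (a e : R) (x : RN) : 0 < a -> 0 < e -> e <= a ^+ 2 ->
  a ^+ 2 < enorm x ^+ 2 < a ^+ 2 + e ->
  vol * a ^+ n < ball_volume x < vol * a ^+ n + vol * n%:R * (2 * a) ^+ m.+1 / a * e.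
Proof.
move=> a0 e0 ea /andP[ax xe].
have ax' : a < enorm x by move: ax; rewrite ltr_pXn2r ?nnegrE ?enorm_ge0// ltW.
have x2a : enorm x <= 2 * a.
  rewrite -(ler_pXn2r (n:=2)) ?nnegrE ?enorm_ge0 ?mulr_ge0 ?(ltW a0)//.
  by rewrite exprMn; have := sqr_ge0 a; lra.
have xa : (enorm x - a) * a < e.
  apply: (@le_lt_trans _ _ ((enorm x - a) * (enorm x + a))).
    by rewrite ler_wpM2l ?subr_ge0 ?(ltW ax')// lerDr enorm_ge0.
  by rewrite -subr_sqr; lra.
rewrite /ball_volume ltr_pM2l// ltr_pXn2r ?nnegrE ?enorm_ge0 ?(ltW a0)// ax'/=.
rewrite -ltrBlDl -mulrBr -!mulrA ltr_pM2l//.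
apply: (le_lt_trans (exprB_le _ (ltW a0) (ltW ax'))).
rewrite -mulrA ltr_pM2l ?ltr0n//.
apply: (@le_lt_trans _ _ ((2 * a) ^+ m.+1 * (enorm x - a))).
  by rewrite ler_wpM2r ?subr_ge0 ?(ltW ax')// lerXn2r ?nnegrE ?enorm_ge0 ?mulr_ge0// ltW.
rewrite ltr_pM2l ?exprn_gt0 ?mulr_gt0//.
by rewrite mulrC ltr_pdivlMr.
Qed.

Context (u : RN -> R).
Hypothesis lu : locally_L1 u.
Hypothesis ru : radial u.

Let mu_ : measurable_fun setT u. Proof. exact: locally_L1_measurable. Qed.

(* At a Lebesgue point of the radial profile, taken in the volume coordinate, the
   averages of [u] against [sphere_kernel] tend to a multiple of the value of [u]. *)
Lemma radial_lebesgue_point (rho M : R) : 0 < rho -> rho < M ->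
  {ae mu, forall x, rho < enorm x < M -> forall L l : R, 0 < l ->
    (forall e, 0 < e -> e <= l -> `|\int[mu]_y (u y * sphere_kernel (enorm x) e y)| <= L) ->
    `|u x| * (kernel_mass * enorm x ^+ n) <= L}.
Proof.
move=> rho0 rhoM; have M0 : 0 < M by exact: lt_trans rhoM.
have [F [mF uF]] := radial_profile mu_ ru rho0.
pose Fh (t : R) := F (@volume_radius R m.+1 t).
have mFh : measurable_fun setT Fh.
  apply: (measurableT_comp mF).
  by apply: (measurableT_comp (measurable_powR _)); exact: measurable_funM.
pose t1 := vol * rho ^+ n; pose t2 := vol * M ^+ n.
have t10 : 0 < t1 by rewrite mulr_gt0// exprn_gt0.
pose D : set R := `]t1, t2[%classic.
have D0 : D `<=` `]0, +oo[%classic.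
  by move=> t; rewrite /D /= !in_itv/= andbT => /andP[t1t _]; exact: lt_trans t1t.
have tauD (x : RN) : D (ball_volume x) <-> rho < enorm x < M.
  have E : ball_volume x = vol * enorm x ^+ n :> R by [].
  rewrite /D /t1 /t2 /= in_itv/= E !ltr_pM2l// !ltr_pXn2r ?nnegrE ?enorm_ge0 ?ltW//.
have mD : measurable D by exact: measurable_itv.
have mtau (A : set R) : measurable A -> measurable (@ball_volume R m.+1 @^-1` A).
  by move=> mA; rewrite -[X in measurable X]setTI; exact: measurable_ball_volume.
have uFh : {ae mu, forall x, D (ball_volume x) -> u x = Fh (ball_volume x)}.
  by apply: filterS uF => x ux /tauD/andP[/ux -> _]; rewrite /Fh ball_volumeK.
have intFh : leb.-integrable D (EFin \o Fh).
  apply/integrableP; split; first by apply/measurable_EFinP; exact: measurable_funTS.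
  have := @ge0_integral_ball_volume R m.+1 D (fun t => `|Fh t|%:E) mD D0.
  rewrite /= => <-; last 2 first.
  - by apply/measurable_EFinP; exact: measurableT_comp.
  - by move=> r; rewrite lee_fin.
  have iu : mu.-integrable (@ball_volume R m.+1 @^-1` D) (EFin \o u).
    by apply: (@locally_L1_bounded _ _ _ _ M lu (mtau _ mD)) => x /tauD/andP[_ /ltW].
  have /integrableP[_] := iu.
  apply: le_lt_trans; rewrite integral_mkcond [leRHS]integral_mkcond.
  apply: le_integral_ae; apply: filterS uFh => x ux; rewrite !patchE.
  by case: ifPn => //=; rewrite inE => /ux <-.
have /lebesgue_differentiation ld := integrable_locally_restrict mD intFh.
have ld' := ae_ball_volume m.+1 ld.
move: ld' uFh => ld' uFh; have uFh' := uFh; move: ld' uFh'.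
apply: filterS2 => x lp ux xM L l l0 hL.
set a := enorm x; set t : R := ball_volume x in lp ux.
have Dt : D t by apply/tauD.
have aa0 : 0 < a by move/andP : xM => [rx _]; exact: lt_trans rx.
pose F0 := Fh \_ D.
have F0t : F0 t = u x by rewrite /F0 patchE mem_set// ux.
pose C1 := vol * n%:R * (2 * a) ^+ m.+1 / a.
have C10 : 0 < C1 by rewrite /C1 divr_gt0// !mulr_gt0 ?ltr0n// exprn_gt0// mulr_gt0.
apply/ler_addgt0Pr => eta eta0.
pose K := 2 * a ^+ 2 * B.
have K0 : 0 <= K by rewrite /K mulr_ge0// mulr_ge0// sqr_ge0.
(* The kernel is at most K/e, and the oscillation over an interval of length r = C1 e will be at
   most 2 eta' r; the product 2 K C1 eta' is at most [eta] whatever [e] is. *)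
pose eta' := eta / (2 * K * C1 + 1).
have KC0 : 0 <= K * C1 by rewrite mulr_ge0// ltW.
have den0 : 0 < 2 * K * C1 + 1 by rewrite -mulrA; lra.
have eta'0 : 0 < eta' by rewrite divr_gt0.
have [r0 r00 hr0] : exists2 r0 : R, 0 < r0 & forall r, 0 < r -> r < r0 ->
    (\int[leb]_(y in ball t r) `|(F0 y - F0 t)%:E| <= (eta' * (r * 2))%:E)%E.
  have : \forall r \near (0 : R)^'+, (davg F0 t r < eta'%:E)%E.
    by apply: (lp (fun y => (y < eta'%:E)%E)); apply: open_ereal_lt'; rewrite lte_fin.
  move=> [r0 /= r00 hr0]; exists r0 => // r rp rr0.
  have := hr0 r; rewrite /= sub0r normrN gtr0_norm// => /(_ rr0 rp).
  rewrite /davg /iavg lebesgue_measure_ball ?(ltW rp)//.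
  rewrite inver mulrn_eq0/= gt_eqF//= lte_pdivrMl ?mulrn_wgt0// => /ltW h.
  by rewrite (le_trans h)// -EFinM lee_fin mulrC -[r *+ 2]mulr_natr lexx.
(* The four bounds serve in turn the hypothesis on [L], [ball_volume_shift], the radius [r0] of
   differentiation, and the inclusion of the interval [I] in [D]. *)
pose e := Num.min (Num.min l (a ^+ 2)) (Num.min (r0 / (2 * C1)) ((t2 - t) / C1)).
have t2t : 0 < t2 - t by move: Dt; rewrite /D /= in_itv/= subr_gt0 => /andP[].
have e0 : 0 < e.
  rewrite /e !lt_min l0 exprn_gt0 ?aa0//=; apply/andP; split; first by rewrite divr_gt0//; lra.
  by rewrite divr_gt0.
have el : e <= l by rewrite /e !ge_min lexx.
have ea : e <= a ^+ 2 by rewrite /e !ge_min lexx orbT.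
have er : C1 * e < r0.
  have : e <= r0 / (2 * C1) by rewrite /e !ge_min lexx !orbT.
  have C12 : 0 < 2 * C1 by lra.
  have eC : 0 < C1 * e by apply: mulr_gt0.
  by rewrite ler_pdivlMr//; lra.
have et : C1 * e <= t2 - t.
  have : e <= (t2 - t) / C1 by rewrite /e !ge_min lexx !orbT.
  by rewrite ler_pdivlMr// mulrC.
pose r := C1 * e; have rp : 0 < r by apply: mulr_gt0.
pose I : set R := `]t, (t + r)[%classic.
have tt1 : t1 < t by move: Dt; rewrite /D /= in_itv/= => /andP[].
have t0 : 0 < t by exact: lt_trans tt1.
have ID : I `<=` D.
  move=> s; rewrite /I /D /= !in_itv/= => /andP[ts str]; apply/andP; split.
    exact: lt_trans ts.
  by apply: lt_le_trans str _; rewrite -lerBrDl.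
have mI : measurable I by exact: measurable_itv.
have I0 : I `<=` `]0, +oo[%classic by exact: subset_trans ID D0.
pose T : set RN := @ball_volume R m.+1 @^-1` I.
have mT : measurable T by exact: mtau.
have muT : mu T = r%:E.
  rewrite [LHS](lebesgue_rV_ball_volume m.+1 mI I0) /I lebesgue_measure_itv/= lte_fin ltrDl rp.
  by rewrite -EFinB addrAC subrr add0r.
have Tb y : T y -> enorm y <= M by move=> /ID /tauD/andP[_ /ltW].
have iuT : mu.-integrable T (EFin \o u) by exact: (locally_L1_bounded lu mT Tb).
have icT : mu.-integrable T (EFin \o (fun=> u x)).
  apply/integrableP; split; first exact: measurable_cst.
  by rewrite /= integral_cst// [X in (_ * X)%E]muT -EFinM ltry.
have iuxT : mu.-integrable T (EFin \o (fun y => u y - u x)).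
  exact: (integrableB mT iuT icT).
have kT (y : RN) : ~ T y -> sphere_kernel a e y = 0.
  move=> nT; apply: sphere_kernel_out => // h; apply: nT.
  by have := ball_volume_shift aa0 e0 ea h; rewrite /T /I /= in_itv/=.
have kb (y : RN) : `|sphere_kernel a e y| <= K / e.
  by apply: sphere_kernel_le => //; lra.
have mk := @measurable_sphere_kernel R n a e.
have [iuk _] := @integrable_mul_bounded _ _ _ mu T u _ _ mT iuT mu_ mk kb kT.
have mux : measurable_fun setT (fun y => u y - u x) by exact: measurable_funB.
have [iuxk bux] := @integrable_mul_bounded _ _ _ mu T _ _ _ mT iuxT mux mk kb kT.
have [ick _] := @integrable_mul_bounded _ _ _ mu T (fun=> u x) _ _ mT icT (measurable_cst _) mk kb kT.
have [i1k _] : mu.-integrable setT (EFin \o (fun y => 1 * sphere_kernel a e y)) /\ True.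
  split => //; have i1 : mu.-integrable T (EFin \o (fun=> 1 : R)).
    apply/integrableP; split; first exact: measurable_cst.
    by rewrite /= integral_cst// [X in (_ * X)%E]muT -EFinM ltry.
  by have [] := @integrable_mul_bounded _ _ _ mu T (fun=> 1) _ _ mT i1 (measurable_cst _) mk kb kT.
have ik : mu.-integrable setT (EFin \o @sphere_kernel R n a e).
  by apply: eq_integrable i1k => // y _; rewrite /= mul1r.
have mass := sphere_kernel_mass aa0 e0 ik.
have osc : \int[mu]_(y in T) `|u y - u x| <= eta' * (r * 2).
  rewrite -lee_fin fineK; last first.
    by apply: integrable_fin_num => //; exact: integrable_norm.
  rewrite (le_trans _ (hr0 _ rp er))//.
  apply: (@le_trans _ _ (\int[leb]_(s in I) `|(F0 s - F0 t)%:E|)%E); last first.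
    apply: ge0_subset_integral => //; first exact: measurable_ball.
      apply/measurable_EFinP; apply: measurableT_comp => //.
      apply: measurable_funTS; apply: measurable_funB => //.
      by apply/(measurable_restrictT _ mD); exact: measurable_funTS.
    by move=> s; rewrite /I /ball /= in_itv/= => /andP[ts st]; rewrite ltr_norml; lra.
  have := @ge0_integral_ball_volume R m.+1 I (fun s => `|(F0 s - F0 t)%:E|%E) mI I0.
  move=> <-; last 2 first.
  - apply: measurableT_comp => //; apply/measurable_EFinP; apply: measurable_funB => //.
    by apply/(measurable_restrictT _ mD); exact: measurable_funTS.
  - by move=> s; exact: abse_ge0.
  rewrite integral_mkcond [leRHS]integral_mkcond; apply: le_integral_ae.
  apply: filterS uFh => y uy; rewrite !patchE; case: ifPn => //; rewrite inE => yT.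
  by rewrite /F0 patchE mem_set ?uy//; [rewrite -/F0 F0t|exact: ID|exact: ID].
(* [u x] times the mass of the kernel is the integral of [u] against it minus that of the
   oscillation. *)
have split_ : \int[mu]_y ((u y - u x) * sphere_kernel a e y) =
    (\int[mu]_y (u y * sphere_kernel a e y)) - u x * (\int[mu]_y sphere_kernel a e y).
  rewrite -RintegralZl// -RintegralB//.
  by apply: eq_Rintegral => y _; rewrite mulrBl.
have small : `|\int[mu]_y ((u y - u x) * sphere_kernel a e y)| <= eta.
  apply: (le_trans bux); apply: (@le_trans _ _ (K / e * (eta' * (r * 2)))).
    by rewrite ler_wpM2l// divr_ge0// ltW.
  have -> : K / e * (eta' * (r * 2)) = eta' * (2 * K * C1).
    by rewrite /r; field; rewrite gt_eqF.
  rewrite /eta' mulrAC ler_pdivrMr// ler_wpM2l ?(ltW eta0)//.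
  by rewrite lerDl.
have := hL e e0 el; rewrite -/a.
move: split_ small mass.
set X := \int[mu]_y (u y * _); set Y := \int[mu]_y (_ * _); set Z := \int[mu]_y _.
move=> E hY hZ hX.
have km : 0 <= kernel_mass * a ^+ n by rewrite mulr_ge0 ?exprn_ge0 ?ltW// kernel_mass_gt0.
apply: (@le_trans _ _ (`|u x| * Z)); first by rewrite ler_wpM2l.
have -> : `|u x| * Z = `|X - Y|.
  by rewrite -[in LHS](ger0_norm (le_trans km hZ)) -normrM E; congr `|_|; ring.
by rewrite (le_trans (ler_normB _ _))// lerD.
Qed.

End lebesgue_points.

Section young.
Context d (T : measurableType d) (R : realType).
Variable mu : {measure set T -> \bar R}.

Lemma powRDp (a r s : R) : 0 < a -> a `^ (r + s) = a `^ r * a `^ s.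
Proof. by move=> a0; rewrite powRD// (gt_eqF a0) implybT. Qed.

(** Either x <= 1/l, or l x >= 1 and its power of exponent p - 1 is at least 1. *)
Lemma le_power_young (p l x : R) : 1 < p -> 0 < l -> 0 <= x ->
  x <= l `^ (p - 1) * x `^ p + l^-1.
Proof.
move=> p1 l0 x0; have [xl|lx] := leP x l^-1.
  by rewrite (le_trans xl)// lerDr mulr_ge0 ?powR_ge0.
have x0' : 0 < x by apply: lt_trans lx; rewrite invr_gt0.
rewrite -[leLHS]addr0 lerD ?invr_ge0 ?(ltW l0)//.
have -> : x `^ p = x `^ (p - 1) * x by rewrite -{3}(powRr1 x0) -powRDp// subrK.
rewrite mulrA -powRM ?(ltW l0)// ler_peMl//.
have lx1 : 1 <= l * x by rewrite mulrC -ler_pdivrMr// mul1r ltW.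
have e1 : 1 = (1 : R) `^ (p - 1) by rewrite powR1.
by rewrite [leLHS]e1 ge0_ler_powR ?nnegrE ?subr_ge0 ?(ltW p1) ?mulr_ge0 ?(ltW l0).
Qed.

(** A form of Hölder's inequality with a free parameter: the optimal [l] would give it back up to a
    constant, and the decay estimate takes for [l] a power of the radius. *)
Lemma Rintegral_young (S : set T) (f : T -> R) (p l A m : R) : measurable S ->
  1 < p -> 0 < l -> (forall x, 0 <= f x) -> measurable_fun setT f ->
  mu.-integrable S (EFin \o f) ->
  (\int[mu]_(x in S) (f x `^ p)%:E <= A%:E)%E -> (mu S <= m%:E)%E ->
  \int[mu]_(x in S) f x <= l `^ (p - 1) * A + m / l.
Proof.
move=> mS p1 l0 f0 mf intf hA hm.
have l10 : 0 <= l `^ (p - 1) by exact: powR_ge0.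
have mfp : measurable_fun setT (fun x => f x `^ p) by exact: (measurableT_comp (measurable_powR p)).
rewrite -lee_fin fineK; last exact: integrable_fin_num.
apply: (@le_trans _ _ (\int[mu]_(x in S) ((l `^ (p - 1))%:E * (f x `^ p)%:E + (l^-1)%:E))%E).
  apply: ge0_le_integral => //.
  - by move=> x _; rewrite lee_fin.
  - by apply/measurable_EFinP; exact: measurable_funTS.
  - apply/measurable_EFinP; apply: measurable_funTS.
    by apply: measurable_funD => //; exact: measurable_funM.
  - by move=> x _; rewrite -EFinM -EFinD lee_fin le_power_young.
have mfS : measurable_fun S (fun x => (f x `^ p)%:E).
  by apply/measurable_EFinP; exact: measurable_funTS.
have lfS : measurable_fun S (fun x => ((l `^ (p - 1))%:E * (f x `^ p)%:E)%E).
  by apply/measurable_EFinP; apply: measurable_funTS; exact: measurable_funM.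
have fp0 x : S x -> (0 <= (f x `^ p)%:E)%E by rewrite lee_fin powR_ge0.
have lfp0 x : S x -> (0 <= (l `^ (p - 1))%:E * (f x `^ p)%:E)%E.
  by rewrite -EFinM lee_fin mulr_ge0// powR_ge0.
have lV0 x : S x -> (0 <= (l^-1)%:E)%E by rewrite lee_fin invr_ge0 ltW.
rewrite ge0_integralD//.
rewrite ge0_integralZl//.
rewrite integral_cst// EFinD leeD//.
  by rewrite EFinM lee_wpmul2l// lee_fin.
by rewrite mulrC EFinM lee_wpmul2l// lee_fin invr_ge0 ltW.
Qed.

End young.

(** * Decay of radial functions of bounded energy *)

Section radial_decay.
Context (R : realType) (m : nat).
Local Notation n := m.+2.
Local Notation RN := 'rV[R]_n.
Local Notation mu := (lebesgue_rV R n).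
Local Notation leb := (@lebesgue_measure R).
Local Notation vol := (@unit_ball_volume R n).
Local Notation shell a d := (@enorm R n @^-1` `]a, a * (1 + d)[%classic).

(** The exceptional set is fixed before [d], which may then depend on |x|. It is a countable union,
    over shells that exhaust the positive radii. *)
Lemma radial_pointwise : exists2 C : R, 0 < C & forall (u : RN -> R) (g : RN -> RN),
  is_weak_gradient u g -> radial u ->
  {ae mu, forall x, 0 < enorm x -> forall d : R, 0 < d <= 1 ->
    `|u x| * enorm x ^+ n <=
    C * (d^-1 * (\int[mu]_(y in shell (enorm x) d) `|u y|) +
         enorm x * (\int[mu]_(y in shell (enorm x) d) enorm (g y)))}.
Proof.
have [B B0 PB] := @smooth_step'_bound R.
have [c0 c00 Pc0] := @smooth_step'_lower_bound R.
have km0 := @kernel_mass_gt0 R m _ c00.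
pose C := (4 * B + 2 * n%:R) / @kernel_mass R m c0.
have n0 : 0 < n%:R :> R by rewrite ltr0n.
exists C => [|u g ug ru]; first by rewrite /C divr_gt0//; lra.
have lu : locally_L1 u by case: ug.
have h : {ae mu, forall x, forall k, k.+1%:R^-1 < enorm x < k.+2%:R -> forall L l : R, 0 < l ->
    (forall e, 0 < e -> e <= l -> `|\int[mu]_y (u y * sphere_kernel (enorm x) e y)| <= L) ->
    `|u x| * (@kernel_mass R m c0 * enorm x ^+ n) <= L}.
  apply/ae_foralln => k.
  apply: (@radial_lebesgue_point R m B c0 PB c00 Pc0 u lu ru k.+1%:R^-1 k.+2%:R).
    by rewrite invr_gt0.
  by rewrite (@le_lt_trans _ _ 1)// ?ltr1n// invf_le1// ler1n.
apply: filterS h => x hx x0 d /andP[d0 d1].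
set a := enorm x in x0 hx *.
have [k /andP[ka ak]] : exists k : nat, k.+1%:R^-1 < a < k.+2%:R.
  exists (maxn (Num.truncn a^-1) (Num.truncn a)); apply/andP; split.
    rewrite invf_plt ?posrE//; apply: (lt_le_trans (truncnS_gt _)).
    by rewrite ler_nat ltnS leq_maxl.
  apply: (lt_le_trans (truncnS_gt _)).
  by rewrite ler_nat ltnS (leq_trans (leq_maxr (Num.truncn a^-1) _)).
have l0 : 0 < a ^+ 2 * d by rewrite mulr_gt0// exprn_gt0.
have := hx k _ _ _ l0 (fun e e0 el => sphere_average_bound ug PB x0 d0 d1 e0 el).
rewrite ka ak => /(_ isT).
set U := \int[mu]_(y in _) `|u y|; set G := \int[mu]_(y in _) enorm (g y) => H.
have U0 : 0 <= U by exact: Rintegral_ge0.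
have G0 : 0 <= G by apply: Rintegral_ge0 => y _; exact: enorm_ge0.
rewrite /C mulrAC ler_pdivlMr// -mulrA [X in _ * X <= _]mulrC (le_trans H)//.
have dU : U <= d^-1 * U by rewrite ler_peMl// invf_ge1.
have nU : n%:R * U <= n%:R * (d^-1 * U) by rewrite ler_wpM2l// ltW.
have BG : 0 <= B * (a * G) by rewrite !mulr_ge0// ltW.
have nU0 : 0 <= n%:R * (d^-1 * U) by rewrite !mulr_ge0// ?invr_ge0 ltW.
have -> : (4 * B / d + n%:R) * U + 2 * a * n%:R * G =
  4 * (B * (d^-1 * U)) + n%:R * U + 2 * (n%:R * (a * G)) by ring.
have -> : (4 * B + 2 * n%:R) * (d^-1 * U + a * G) =
  4 * (B * (d^-1 * U)) + 4 * (B * (a * G)) + 2 * (n%:R * (d^-1 * U)) + 2 * (n%:R * (a * G)) by ring.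
by lra.
Qed.

Context (p gamma cV R1 : R) (V : R -> \bar R).
Hypotheses (p1 : 1 < p) (pgamma : p <= gamma) (cV0 : 0 < cV).
Hypothesis V0 : forall r, 0 < r -> (0 <= V r)%E.
Hypothesis hV : {ae leb, forall r, 0 < r < R1 -> ((cV * r `^ (- gamma))%:E <= V r)%E}.

Definition decay_exponent : R := (n%:R - 1 - gamma + gamma / p) / p.

Lemma radial_decay : exists2 C : R, 0 < C & forall (u : RN -> R) (g : RN -> RN),
  is_weak_gradient u g -> radial u ->
  (\int[mu]_x (enorm (g x) `^ p)%:E <= 1)%E ->
  (\int[mu]_x (V (enorm x) * (`|u x| `^ p)%:E) <= 1)%E ->
  {ae mu, forall x, 0 < enorm x < Num.min 1 (R1 / 2) ->
    `|u x| <= C * enorm x `^ (- decay_exponent)}.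
Proof.
have [C C0 hC] := radial_pointwise.
have v0 := @unit_ball_volume_gt0 R n.
pose D := vol * n%:R * 2 ^+ m.+1.
have D0 : 0 < D by rewrite /D !mulr_gt0// ?ltr0n// exprn_gt0.
(* On a shell within radius 2 a, V is at least cV (2 a)^(-gamma), so the integral of |u|^p over it
   is at most A a^gamma. The constant [D] is the one in the bound of its volume by a^n d. *)
pose A := 2 `^ gamma / cV.
have A0 : 0 < A by rewrite /A divr_gt0// powR_gt0.
exists (C * (A + D + 1 + D)); first by rewrite mulr_gt0//; lra.
move=> u g ug ru hg hu; apply: filterS (hC u g ug ru) => x hx /andP[x0].
set a := enorm x in x0 hx *; rewrite lt_min => /andP[a1 aR].
have p0 : 0 < p by exact: lt_trans p1.
pose d := a `^ (gamma / p - 1).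
have d0 : 0 < d by exact: powR_gt0.
have d1 : d <= 1.
  by rewrite -(powRr0 a) ger_powR ?x0 ?(ltW a1)// subr_ge0 ler_pdivlMr// mul1r.
have := hx x0 d; rewrite d0 d1 => /(_ isT).
set S := _ @^-1` _; set U := \int[mu]_(y in S) `|u y|; set G := \int[mu]_(y in S) enorm (g y).
have mS : measurable S by exact: measurable_enorm_preimage.
have ad : a <= a * (1 + d) by rewrite ler_pMr// lerDl ltW.
have a2 : a * (1 + d) <= 2 * a by rewrite mulrC ler_wpM2r ?(ltW x0)//; lra.
have Sb y : S y -> enorm y <= 2 * a.
  by rewrite /S /= in_itv/= => /andP[_ /ltW /le_trans]; apply.
have muS : (mu S <= (D * a `^ (n%:R + (gamma / p - 1)))%:E)%E.
  have := @lebesgue_rV_shell_le R m.+1 _ _ _ (ltW x0) ad a2.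
  move=> /le_trans; apply; rewrite lee_fin.
  rewrite powRDp// powR_mulrn ?(ltW x0)// -/d.
  rewrite (_ : a * (1 + d) - a = a * d); last by ring.
  by rewrite exprMn /D (exprSr a m.+1) le_eqVlt; apply/orP; left; apply/eqP; ring.
have mu_ : measurable_fun setT u by apply: locally_L1_measurable; case: ug.
have mnu : measurable_fun setT (fun y => `|u y|) by exact: measurableT_comp.
have iu : mu.-integrable S (EFin \o (fun y => `|u y|)).
  by apply: integrable_norm; apply: (locally_L1_bounded _ mS Sb); case: ug.
have mg : measurable_fun setT (fun y => enorm (g y)).
  apply: measurable_enorm_comp => i; apply: locally_L1_measurable.
  by have [_ /(_ i)[]] := ug.
have ig := integrable_enorm_gradient ug mS Sb.
have hgS : (\int[mu]_(y in S) (enorm (g y) `^ p)%:E <= 1%:E)%E.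
  apply: le_trans hg; rewrite integral_mkcond; apply: le_integral_ae; apply: nearW => y.
  by rewrite patchE; case: ifPn => // _; rewrite lee_fin powR_ge0.
have ga0 : 0 <= gamma by apply: le_trans pgamma; exact: ltW.
have huS : (\int[mu]_(y in S) (`|u y| `^ p)%:E <= (A * a `^ gamma)%:E)%E.
  pose k := cV * (2 * a) `^ (- gamma).
  have k0 : 0 < k by rewrite mulr_gt0// powR_gt0// mulr_gt0.
  have -> : A * a `^ gamma = k^-1.
    by rewrite /k /A invfM powRN invrK powRM ?(ltW x0)//; ring.
  rewrite -[leRHS]mule1 -lee_pdivrMl ?invr_gt0// invrK.
  have mupS : measurable_fun S (fun y => (`|u y| `^ p)%:E).
    apply/measurable_EFinP; apply: measurable_funTS.
    exact: (measurableT_comp (measurable_powR p)).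
  have up0 y : S y -> (0 <= (`|u y| `^ p)%:E)%E by rewrite lee_fin powR_ge0.
  have kE : (0 <= k%:E)%E by rewrite lee_fin ltW.
  rewrite -ge0_integralZl//.
  apply: le_trans hu; rewrite integral_mkcond; apply: le_integral_ae.
  have := ae_enorm m.+1 hV; have := @ae_enorm_gt0 R m.+1; apply: filterS2 => y y0 Vy.
  rewrite patchE; case: ifPn => [|_]; last first.
    by rewrite mule_ge0 ?V0// lee_fin powR_ge0.
  rewrite inE => Sy; rewrite lee_wpmul2r ?lee_fin ?powR_ge0//.
  have yR : enorm y < R1 by apply: le_lt_trans (Sb _ Sy) _; lra.
  apply: le_trans (Vy _); last by rewrite y0.
  rewrite lee_fin /k ler_pM2l// !powRN lef_pV2 ?posrE ?powR_gt0 ?mulr_gt0//.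
  by rewrite ge0_ler_powR ?nnegrE ?enorm_ge0 ?mulr_ge0 ?(ltW x0)// Sb.
pose nu := decay_exponent.
(* With parameter a^nu for [u] and a^e for the gradient, the two terms of Young's inequality have
   the same order in [a]; after the factors d^-1 and [a] all four are of order a^(n - nu). *)
pose e := (gamma / p - 1 + n%:R) / p.
have hU := Rintegral_young mS p1 (powR_gt0 nu x0) (fun y => normr_ge0 _) mnu iu huS muS.
have hG := Rintegral_young mS p1 (powR_gt0 e x0) (fun y => enorm_ge0 _) mg ig hgS muS.
have pn0 : p != 0 by rewrite gt_eqF.
have E1 : d^-1 * ((a `^ nu) `^ (p - 1) * (A * a `^ gamma) +
    D * a `^ (n%:R + (gamma / p - 1)) / a `^ nu) = (A + D) * a `^ (n%:R - nu).
  rewrite /d -!powRN -powRrM.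
  have -> : a `^ (- (gamma / p - 1)) * (a `^ (nu * (p - 1)) * (A * a `^ gamma) +
     D * a `^ (n%:R + (gamma / p - 1)) * a `^ (- nu)) =
     A * (a `^ (- (gamma / p - 1)) * a `^ (nu * (p - 1)) * a `^ gamma) +
     D * (a `^ (- (gamma / p - 1)) * a `^ (n%:R + (gamma / p - 1)) * a `^ (- nu)) by ring.
  rewrite -!powRDp// mulrDl; congr (_ * a `^ _ + _ * a `^ _).
    by rewrite /nu /decay_exponent; field.
  by ring.
have E2 : a * ((a `^ e) `^ (p - 1) * 1 + D * a `^ (n%:R + (gamma / p - 1)) / a `^ e) =
    (1 + D) * a `^ (n%:R - nu).
  rewrite -powRN -powRrM mulr1.
  have -> : a * (a `^ (e * (p - 1)) + D * a `^ (n%:R + (gamma / p - 1)) * a `^ (- e)) =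
     1 * (a `^ 1 * a `^ (e * (p - 1))) + D * (a `^ 1 * a `^ (n%:R + (gamma / p - 1)) * a `^ (- e)).
    by rewrite powRr1 ?(ltW x0)//; ring.
  rewrite -!powRDp// mulrDl; congr (_ * a `^ _ + _ * a `^ _).
    by rewrite /e /nu /decay_exponent; field.
  by rewrite /e /nu /decay_exponent; field.
move=> H; have an0 : 0 < a ^+ n by rewrite exprn_gt0.
rewrite -(ler_pM2r an0) (le_trans H)//.
have -> : C * (A + D + 1 + D) * a `^ (- decay_exponent) * a ^+ n =
    C * ((A + D) * a `^ (n%:R - nu) + (1 + D) * a `^ (n%:R - nu)).
  by rewrite powRDp// powR_mulrn ?(ltW x0)// /nu; ring.
rewrite ler_pM2l// lerD//.
  by rewrite -E1 ler_wpM2l// invr_ge0 ltW.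
by rewrite -E2 ler_wpM2l// ltW.
Qed.

End radial_decay.

(** * Bounds on the supremum *)

Section lower_integral_scale.
Local Open Scope ereal_scope.
Context d (T : measurableType d) (R : realType).
Variable mu : {measure set T -> \bar R}.
Import HBNNSimple.

(** The scaling is done on the simple functions below the integrand. Applied to the inverse scalar,
    this inequality also gives the reverse one. *)
Lemma le_integralZ (k : R) (f : T -> \bar R) : (0 < k)%R -> (forall x, 0 <= f x) ->
  \int[mu]_x (k%:E * f x) <= k%:E * \int[mu]_x f x.
Proof.
move=> k0 f0; have k0' := ltW k0.
rewrite ge0_integralTE; last by move=> x; rewrite mule_ge0// lee_fin.
apply: ge_ereal_sup => _ [s sf <-]; rewrite -integralT_nnsfun.
have ms : measurable_fun setT (EFin \o s) by exact/measurable_EFinP/measurable_funP.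
have kV0 : 0 <= (k^-1)%:E by rewrite lee_fin invr_ge0.
have s0 x : setT x -> 0 <= (s x)%:E by rewrite lee_fin.
rewrite -lee_pdivrMl// -ge0_integralZl//.
apply: le_integral_ae; apply: nearW => x.
by rewrite lee_pdivrMl.
Qed.

(** [X] on [A] and [Y] off it are glued into one function; the maximum with the measurable [Z] is
    taken apart before the split along [A]. *)
Lemma le_integral_split_max (A : set T) (f X Y Z : T -> \bar R) (k : R) : (0 < k)%R ->
  measurable A -> measurable_fun setT Z ->
  (forall x, 0 <= X x) -> (forall x, 0 <= Y x) -> (forall x, 0 <= Z x) ->
  {ae mu, forall x, A x -> f x <= maxe (k%:E * X x) (Z x)} ->
  {ae mu, forall x, ~ A x -> f x <= maxe (k%:E * Y x) (Z x)} ->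
  \int[mu]_x f x <= k%:E * (\int[mu]_x X x + \int[mu]_x Y x) + \int[mu]_x Z x.
Proof.
move=> k0 mA mZ X0 Y0 Z0 fX fY; have k0' := ltW k0.
pose W x := if x \in A then k%:E * X x else k%:E * Y x.
have kX0 x : 0 <= k%:E * X x by rewrite mule_ge0 ?lee_fin.
have kY0 x : 0 <= k%:E * Y x by rewrite mule_ge0 ?lee_fin.
have W0 x : 0 <= W x by rewrite /W; case: ifPn.
apply: (@le_trans _ _ (\int[mu]_x W x + \int[mu]_x Z x)).
  apply: le_integral_max => //.
  move: fX fY; apply: filterS2 => x fX fY; rewrite /W; case: ifPn => [xA|].
    by apply: fX; rewrite inE in xA.
  by rewrite notin_setE => xA; exact: fY.
apply: leeD => //; rewrite ge0_muleDr ?integral_ge0//.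
apply: (@le_trans _ _ (\int[mu]_x (k%:E * X x) + \int[mu]_x (k%:E * Y x))).
  apply: (le_integral_split mA) => //; apply: nearW => x xA; rewrite /W.
    by rewrite mem_set.
  by rewrite memNset.
by apply: leeD; exact: le_integralZ.
Qed.

End lower_integral_scale.

Section small_ball.
Context (R : realType).
Local Notation leb := (@lebesgue_measure R).

Let is_derive_powR_prim (b t : R) : -1 < b -> 0 < t ->
  is_derive t (1 : R) (fun t => t `^ (b + 1) / (b + 1)) (t `^ b).
Proof.
move=> b1 t0; have b10 : b + 1 != 0 by rewrite gt_eqF//; lra.
have := is_deriveZ ((b + 1)^-1 : R) (is_derive1_powR (b + 1) t0).
rewrite (_ : _ \*: _ = fun t => t `^ (b + 1) / (b + 1)); last first.
  by apply/funext => s; rewrite /GRing.scale/= mulrC.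
by rewrite /GRing.scale/= mulrA mulVf// mul1r addrK.
Qed.

Lemma integral_powR_le (b c T : R) : -1 < b -> 0 < c -> c < T ->
  (\int[leb]_(t in `[c, T]) (t `^ b)%:E <= (T `^ (b + 1) / (b + 1))%:E)%E.
Proof.
move=> b1 c0 cT; pose F t := t `^ (b + 1) / (b + 1).
have dF (t : R) : 0 < t -> derivable F t 1.
  by move=> t0; have [] := is_derive_powR_prim b1 t0.
have cF (t : R) : 0 < t -> {for t, continuous F}.
  by move=> t0; apply: differentiable_continuous; apply/derivable1_diffP; exact: dF.
have b10 : 0 < b + 1 by lra.
rewrite (@continuous_FTC2 R (fun t => t `^ b) F)//.
- by rewrite -EFinB lee_fin lerBlDr lerDl divr_ge0 ?powR_ge0// ltW.
- apply/continuous_in_subspaceT => t; rewrite inE/= in_itv/= => /andP[ct _].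
  have t0 : 0 < t by exact: lt_le_trans ct.
  apply: differentiable_continuous; apply/derivable1_diffP.
  by have [] := is_derive1_powR b t0.
- split.
  + by move=> t; rewrite in_itv/= => /andP[ct _]; apply: dF; exact: lt_trans ct.
  + by apply: cvg_at_right_filter; exact: cF.
  + by apply: cvg_at_left_filter; apply: cF; exact: lt_trans cT.
- move=> t; rewrite in_itv/= => /andP[ct _].
  have t0 : 0 < t by exact: lt_trans ct.
  by rewrite derive1E; have [_ ->] := is_derive_powR_prim b1 t0.
Qed.

Lemma integral_powR0_le (b T : R) : -1 < b -> 0 < T ->
  (\int[leb]_(t in `]0%R, T[) (t `^ b)%:E <= (T `^ (b + 1) / (b + 1))%:E)%E.
Proof.
move=> b1 T0; pose I k : set R := `]k.+1%:R^-1, T[%classic.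
have b10 : 0 < b + 1 by lra.
have mp : measurable_fun setT (fun t : R => (t `^ b)%:E).
  by apply/measurable_EFinP; exact: measurable_powR.
have -> : `]0%R, T[%classic = \bigcup_k I k.
  apply/seteqP; split => t.
    rewrite /= in_itv/= => /andP[t0 tT]; exists (Num.truncn t^-1) => //.
    rewrite /I /= in_itv/= tT andbT invf_plt ?posrE//; exact: truncnS_gt.
  move=> [k _]; rewrite /I /= !in_itv/= => /andP[kt ->]; rewrite andbT.
  by apply: lt_trans kt; rewrite invr_gt0.
have nI : nondecreasing_seq I.
  move=> k l kl; apply/subsetPset => t; rewrite /I /= !in_itv/= => /andP[kt ->].
  rewrite andbT; apply: le_lt_trans kt; rewrite lef_pV2 ?posrE ?ltr0n//.
  by rewrite ler_nat ltnS.
have cvgI : (\int[leb]_(t in I k) (t `^ b)%:E)%E @[k --> \oo] -->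
    (\int[leb]_(t in \bigcup_k I k) (t `^ b)%:E)%E.
  apply: ge0_nondecreasing_set_cvg_integral => // [k|k|k t _].
  - exact: measurable_itv.
  - exact: measurable_funTS.
  by rewrite lee_fin powR_ge0.
apply: (cvge_to_le cvgI).
apply: nearW => k.
have [kT|Tk] := ltP k.+1%:R^-1 T; last first.
  rewrite (_ : I k = set0) ?integral_set0 ?lee_fin ?divr_ge0 ?powR_ge0 ?ltW//.
  by apply/seteqP; split => t //; rewrite /I /= in_itv/= => /andP[h1 h2];
    have := lt_trans h1 h2; rewrite ltNge Tk.
apply: le_trans (integral_powR_le b1 _ kT); last by rewrite invr_gt0.
apply: ge0_subset_integral; [exact: measurable_itv|exact: measurable_itv| | |].
- exact: measurable_funTS.
- by move=> t _; rewrite lee_fin powR_ge0.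
- by move=> t; rewrite /I /= !in_itv/= => /andP[/ltW -> /ltW ->].
Qed.

End small_ball.

(** * Powers of the norm on small balls *)

Section small_ball_rV.
Context (R : realType) (n' : nat).
Local Notation n := n'.+1.
Local Notation mu := (lebesgue_rV R n).
Local Notation vol := (@unit_ball_volume R n).

(** In the volume coordinate t, |x|^a is a multiple of t^(a/n), and a > -n is the condition a/n > -1
    of integrability at 0. *)
Lemma integral_power_small_ball (a : R) : - n%:R < a -> forall eta : R, 0 < eta ->
  exists2 r0 : R, 0 < r0 & forall r, 0 < r -> r <= r0 ->
  (\int[mu]_(x in eball r) (enorm x `^ a)%:E <= eta%:E)%E.
Proof.
move=> na eta eta0; have v0 := @unit_ball_volume_gt0 R n.
have n0 : 0 < n%:R :> R by rewrite ltr0n.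
pose b := a / n%:R.
have b1 : -1 < b by rewrite /b ltr_pdivlMr// mulN1r.
have b10 : 0 < b + 1 by lra.
pose k := vol `^ (- b); have k0 : 0 < k by exact: powR_gt0.
have bound r : 0 < r -> (\int[mu]_(x in eball r) (enorm x `^ a)%:E <=
    (k * ((vol * r ^+ n) `^ (b + 1) / (b + 1)))%:E)%E.
  move=> r0; set T := vol * r ^+ n; have T0 : 0 < T by rewrite mulr_gt0// exprn_gt0.
  pose D : set R := `]0, T[%classic.
  have D0 : D `<=` `]0, +oo[%classic.
    by move=> t; rewrite /D /= !in_itv/= andbT => /andP[].
  have mD : measurable D by exact: measurable_itv.
  have mf : measurable_fun setT (fun t : R => (k * t `^ b)%:E).
    by apply/measurable_EFinP; apply: measurable_funM => //; exact: measurable_powR.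
  have f0 t : (0 <= (k * t `^ b)%:E)%E by rewrite lee_fin mulr_ge0 ?powR_ge0// ltW.
  apply: (@le_trans _ _ (\int[mu]_(x in @ball_volume R n' @^-1` D) (k * ball_volume x `^ b)%:E)%E).
    rewrite integral_mkcond [leRHS]integral_mkcond; apply: le_integral_ae.
    apply: filterS (@ae_enorm_gt0 R n') => x x0; rewrite !patchE.
    have E : (x \in @ball_volume R n' @^-1` D) = (x \in @eball R n r).
      apply/idP/idP; rewrite !inE /D /eball /= in_itv/= ball_volume_gt0 x0/=;
        have -> : ball_volume x = vol * enorm x ^+ n :> R by [];
        by rewrite /T ltr_pM2l// ltr_pXn2r ?nnegrE ?enorm_ge0// ltW.
    rewrite E; case: ifPn => // _; rewrite lee_fin le_eqVlt; apply/orP; left; apply/eqP.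
    have -> : ball_volume x = vol * enorm x ^+ n :> R by [].
    rewrite powRM ?(ltW v0) ?exprn_ge0 ?enorm_ge0// mulrA -powRD; last by rewrite (gt_eqF v0) implybT.
    rewrite addNr powRr0 mul1r -powR_mulrn ?enorm_ge0// -powRrM /b mulrCA divff ?mulr1//.
  rewrite (ge0_integral_ball_volume n' mD D0 mf f0).
  under eq_integral do rewrite EFinM.
  have mpD : measurable_fun D (fun t => (t `^ b)%:E).
    by apply/measurable_EFinP; apply: measurable_funTS; exact: measurable_powR.
  have pD0 t : D t -> (0 <= (t `^ b)%:E)%E by rewrite lee_fin powR_ge0.
  have kE0 : (0 <= k%:E)%E by rewrite lee_fin ltW.
  rewrite ge0_integralZl//.
  rewrite EFinM lee_pmul2l// ?lte_fin//; exact: integral_powR0_le.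
have c0 : 0 < k * (vol `^ (b + 1) / (b + 1)).
  by rewrite mulr_gt0// divr_gt0// powR_gt0.
pose c := k * (vol `^ (b + 1) / (b + 1)).
have na0 : 0 < a + n%:R by lra.
(* The integral over the ball of radius r is at most c r^(a + n), and [r0] makes this equal to
   [eta]. *)
pose r0 := (eta / c) `^ (a + n%:R)^-1.
exists r0 => [|r rp rr0]; first by rewrite powR_gt0// divr_gt0.
apply: (le_trans (bound r rp)); rewrite lee_fin.
rewrite powRM ?(ltW v0) ?exprn_ge0 ?(ltW rp)// -powR_mulrn ?(ltW rp)// -powRrM.
have -> : n%:R * (b + 1) = a + n%:R by rewrite /b mulrDr mulr1 mulrCA divff ?mulr1// gt_eqF.
have -> : k * (vol `^ (b + 1) * r `^ (a + n%:R) / (b + 1)) = r `^ (a + n%:R) * c by rewrite /c; ring.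
rewrite -ler_pdivlMr//.
have -> : eta / c = r0 `^ (a + n%:R).
  by rewrite /r0 -powRrM mulVf ?gt_eqF// powRr1// divr_ge0// ltW.
by rewrite ge0_ler_powR ?nnegrE ?(ltW na0) ?(ltW rp)// powR_ge0.
Qed.

End small_ball_rV.

(** * The region with its denominators cleared *)

Section region_inequalities.
Context (R : realType).

(** Each threshold is multiplied by its denominator, N - gamma or [D]. A negative denominator
    reverses the inequality, and the region reverses it in the same cases; where a denominator
    vanishes, the inequality reduces to the lower bound on alpha. *)
Lemma region_inequalities (N : nat) (p beta gamma alpha q : R) :
  1 < p < N%:R -> region N p beta gamma (alpha, q) ->
  [/\ 1 < q, p * beta < q, q * (N%:R - gamma) < p * (alpha - gamma * beta + N%:R) &
    q * (p * (N%:R - 1) - gamma * (p - 1)) <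
    p * (p * alpha + (1 - p * beta) * gamma + p * (N%:R - 1))].
Proof.
set n : R := N%:R => /andP[p1 pn]; rewrite /region /= -/n.
have p10 : 0 < p - 1 by lra.
have n10 : 0 < n - 1 by lra.
rewrite /q_star /q_sstar -/n.
set X := alpha - gamma * beta + n; set Y := p * alpha + _ + _.
set D := p * (n - 1) - gamma * (p - 1).
have gcE : (gamma < p / (p - 1) * (n - 1)) = (0 < D).
  by rewrite mulrAC ltr_pdivlMr// /D subr_gt0.
have gcE' : (gamma == p / (p - 1) * (n - 1)) = (D == 0).
  have p10' : p - 1 != 0 by rewrite gt_eqF.
  apply/eqP/eqP => [h|DE]; first by rewrite /D h; field.
  have -> : p / (p - 1) * (n - 1) = (D + gamma * (p - 1)) / (p - 1) by rewrite /D; field.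
  by rewrite DE add0r mulfK.
case: ifPn => [gn|gn].
  (* For gamma < N the denominator [D] exceeds N - p. *)
  have D0 : 0 < D by rewrite /D; nra.
  have ng : 0 < n - gamma by lra.
  rewrite gt_max lt_min => /andP[/andP[q1 pq] /andP[qs qss]]; split => //.
    by rewrite -ltr_pdivlMr// -mulrA.
  by rewrite -ltr_pdivlMr// -mulrA.
case: ifPn => [/eqP gE|gn'].
  have D0 : 0 < D by rewrite /D gE; nra.
  rewrite gt_max => /and3P[/andP[q1 pq] qss an]; split => //.
    by rewrite gE subrr mulr0 /X gE mulr_gt0//; nra.
  by rewrite -ltr_pdivlMr// -mulrA.
have ng : n - gamma < 0.
  by rewrite subr_lt0 lt_neqAle eq_sym gn' leNgt.
have star : p * (X / (n - gamma)) < q -> q * (n - gamma) < p * X.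
  by rewrite mulrA ltr_ndivrMr.
rewrite gcE gcE'; case: ifPn => [D0|D0].
  rewrite !gt_max => /andP[/andP[/andP[q1 pq] /star qs] qss]; split => //.
  by rewrite -ltr_pdivlMr// -mulrA.
case: ifPn => [/eqP DE|D0'].
  rewrite !gt_max => /andP[/andP[/andP[q1 pq] /star qs] an]; split => //.
  have -> : Y = p * (alpha + (1 - beta) * gamma) + D by rewrite /Y /D; ring.
  by rewrite DE mulr0 addr0 !mulr_gt0//; nra.
rewrite !gt_max => /andP[/andP[/andP[q1 pq] /star qs] qss]; split => //.
have Dn : D < 0 by rewrite lt_neqAle D0' leNgt.
by rewrite -ltr_ndivrMr// -mulrA.
Qed.

End region_inequalities.

(** * Pointwise bounds of the integrand *)

Section power_bounds.
Context (R : realType).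
Implicit Types r v U H : R.

(** The exponent beta - s is nonpositive, so a lower bound on [v] is an upper bound on v^(beta -
    s). *)
Lemma powR_weight_le (c gamma beta s r v : R) : 0 < c -> 0 < r -> beta <= s ->
  c * r `^ (- gamma) <= v -> v `^ beta <= c `^ (beta - s) * r `^ (gamma * (s - beta)) * v `^ s.
Proof.
move=> c0 r0 bs cv; have v0 : 0 < v by apply: lt_le_trans cv; rewrite mulr_gt0// powR_gt0.
have -> : v `^ beta = v `^ (beta - s) * v `^ s by rewrite -powRDp// subrK.
rewrite ler_wpM2r ?powR_ge0//.
have -> : c `^ (beta - s) * r `^ (gamma * (s - beta)) = (c * r `^ (- gamma)) `^ (beta - s).
  by rewrite powRM ?powR_ge0 ?(ltW c0)// -powRrM; congr (_ * _ `^ _); ring.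
have cr0 : 0 < c * r `^ (- gamma) by rewrite mulr_gt0// powR_gt0.
have -> : beta - s = - (s - beta) by ring.
rewrite (powRN v) (powRN (c * _)) lef_pV2 ?posrE ?powR_gt0//.
by rewrite ge0_ler_powR ?nnegrE ?subr_ge0 ?(ltW v0)// mulr_ge0 ?powR_ge0// ltW.
Qed.

Lemma powR_max_le (q U H : R) : 1 < q -> 0 <= U -> 0 <= H ->
  U `^ (q - 1) * H <= Num.max U H `^ q.
Proof.
move=> q1 U0 H0; set M := Num.max U H.
have UM : U <= M by rewrite le_max lexx.
have HM : H <= M by rewrite le_max lexx orbT.
have M0 : 0 <= M by exact: le_trans UM.
have [M00|M0'] := eqVneq M 0.
  have -> : H = 0 by apply/eqP; rewrite eq_le H0 andbT -M00.
  by rewrite mulr0 powR_ge0.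
have Mp : 0 < M by rewrite lt_neqAle eq_sym M0'.
have -> : M `^ q = M `^ (q - 1) * M by rewrite -{3}(powRr1 M0) -powRDp// subrK.
by rewrite ler_pM ?powR_ge0// ge0_ler_powR ?nnegrE// subr_ge0 ltW.
Qed.

(** V^beta is raised to V^(q/p), which p beta < q allows, so that V and the q-th power of the
    maximum combine into M^(q/p). *)
Lemma integrand_le_subcritical (K L c alpha beta gamma p q r v U H : R) :
  0 < L -> 0 < c -> 0 < r -> 1 < p -> 1 < q -> p * beta < q -> 0 <= U -> 0 <= H ->
  c * r `^ (- gamma) <= v -> K <= L * r `^ alpha * v `^ beta ->
  K * U `^ (q - 1) * H <=
  L * c `^ (beta - q / p) * r `^ (alpha + gamma * (q / p - beta)) *
  (v * Num.max U H `^ p) `^ (q / p).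
Proof.
move=> L0 c0 r0 p1 q1 pbq U0 H0 cv Kle.
have p0 : 0 < p by exact: lt_trans p1.
have v0 : 0 < v by apply: lt_le_trans cv; rewrite mulr_gt0// powR_gt0.
have bq : beta <= q / p by rewrite ler_pdivlMr// mulrC ltW.
have mp := powR_max_le q1 U0 H0.
have UH0 : 0 <= U `^ (q - 1) * H by rewrite mulr_ge0// powR_ge0.
rewrite -mulrA; apply: (@le_trans _ _ (L * r `^ alpha * v `^ beta * (U `^ (q - 1) * H))).
  by rewrite ler_wpM2r.
rewrite (powRM _ (ltW v0)) ?powR_ge0// -powRrM (mulrC p) divfK ?gt_eqF//.
apply: (@le_trans _ _ (L * r `^ alpha *
    (c `^ (beta - q / p) * r `^ (gamma * (q / p - beta)) * v `^ (q / p)) * Num.max U H `^ q)).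
  apply: ler_pM => //.
    by rewrite !mulr_ge0 ?powR_ge0// ltW.
  rewrite ler_wpM2l ?mulr_ge0 ?powR_ge0 ?(ltW L0)//; exact: powR_weight_le.
by rewrite (powRDp _ _ r0) le_eqVlt; apply/orP; left; apply/eqP; ring.
Qed.

(** Of the exponent q - 1 of [U], the part q - p is bounded by the decay of [u], and the remaining p
    - 1 goes with [H] into the maximum; V^beta is raised to V. *)
Lemma integrand_le_supercritical (K L c C nu alpha beta gamma p q r v U H : R) :
  0 < L -> 0 < c -> 0 < r -> 0 < C -> 1 < p -> p <= q -> beta <= 1 -> 0 <= U -> 0 <= H ->
  c * r `^ (- gamma) <= v -> K <= L * r `^ alpha * v `^ beta -> U <= C * r `^ (- nu) ->
  K * U `^ (q - 1) * H <=
  L * c `^ (beta - 1) * C `^ (q - p) * r `^ (alpha + gamma * (1 - beta) - nu * (q - p)) *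
  (v * Num.max U H `^ p).
Proof.
move=> L0 c0 r0 C0 p1 pq b1 U0 H0 cv Kle UC.
have v0 : 0 < v by apply: lt_le_trans cv; rewrite mulr_gt0// powR_gt0.
have q1 : 1 < q by exact: lt_le_trans pq.
have mx0 : 0 <= Num.max U H by rewrite le_max U0.
have UH0 : 0 <= U `^ (q - 1) * H by rewrite mulr_ge0// powR_ge0.
have UH : U `^ (q - 1) * H <= C `^ (q - p) * r `^ (- nu * (q - p)) * Num.max U H `^ p.
  have [U00|U0'] := eqVneq U 0.
    rewrite U00 powR0 ?mul0r ?mulr_ge0 ?powR_ge0// subr_eq0 gt_eqF//.
  have Up : 0 < U by rewrite lt_neqAle eq_sym U0'.
  have -> : q - 1 = (q - p) + (p - 1) by ring.
  rewrite powRDp// -mulrA; apply: ler_pM; rewrite ?mulr_ge0 ?powR_ge0//.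
    rewrite powRrM -powRM ?powR_ge0 ?(ltW C0)//.
    by rewrite ge0_ler_powR ?nnegrE ?subr_ge0// mulr_ge0 ?powR_ge0// ltW.
  exact: powR_max_le.
rewrite -mulrA; apply: (@le_trans _ _ (L * r `^ alpha * v `^ beta * (U `^ (q - 1) * H))).
  by rewrite ler_wpM2r.
apply: (@le_trans _ _ (L * r `^ alpha *
    (c `^ (beta - 1) * r `^ (gamma * (1 - beta)) * v `^ 1) *
    (C `^ (q - p) * r `^ (- nu * (q - p)) * Num.max U H `^ p))).
  apply: ler_pM => //.
    by rewrite !mulr_ge0 ?powR_ge0// ltW.
  rewrite ler_wpM2l ?mulr_ge0 ?powR_ge0 ?(ltW L0)//; exact: powR_weight_le.
rewrite powRr1 ?(ltW v0)// -[- (nu * _)]mulNr !(powRDp _ _ r0).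
by rewrite le_eqVlt; apply/orP; left; apply/eqP; ring.
Qed.

(** If the first term does not dominate, then M^(1 - s) is at most w/eps, which bounds M^s. The
    maximum is the form that [le_integral_max] takes apart. *)
Lemma powR_young_max (s w M eps : R) : 0 < s -> s < 1 -> 0 <= w -> 0 <= M -> 0 < eps ->
  w * M `^ s <= Num.max (eps * M) (eps `^ (- (s / (1 - s))) * w `^ (1 - s)^-1).
Proof.
move=> s0 s1 w0 M0 e0; rewrite le_max.
have [//|/= eM] := leP (w * M `^ s) (eps * M).
have s10 : 0 < 1 - s by lra.
have [M00|M0'] := eqVneq M 0.
  by move: eM; rewrite M00 powR0 ?gt_eqF// !mulr0 ltxx.
have Mp : 0 < M by rewrite lt_neqAle eq_sym M0'.
have wp : 0 < w.
  rewrite lt_neqAle w0 andbT eq_sym; apply/eqP => w00.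
  by move: eM; rewrite w00 mul0r ltNge mulr_ge0// ltW.
have ME : M = M `^ (1 - s) * M `^ s by rewrite -powRDp// subrK powRr1.
have h : M `^ (1 - s) <= w / eps.
  rewrite ler_pdivlMr// mulrC -(ler_pM2r (powR_gt0 s Mp)) -mulrA -ME.
  exact: ltW.
have h2 : M `^ s <= (w / eps) `^ (s / (1 - s)).
  have -> : M `^ s = (M `^ (1 - s)) `^ (s / (1 - s)).
    by rewrite -powRrM; congr (_ `^ _); field; rewrite gt_eqF.
  by apply: ge0_ler_powR => //; rewrite ?nnegrE ?powR_ge0// divr_ge0// ltW.
apply: (@le_trans _ _ (w * (w / eps) `^ (s / (1 - s)))); first by rewrite ler_wpM2l.
rewrite powRM ?invr_ge0 ?(ltW e0) ?(ltW wp)// -(powR_inv1 (ltW e0)) -powRrM mulN1r.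
rewrite mulrA -{1}(powRr1 (ltW wp)) -powRDp// mulrC.
have -> : 1 + s / (1 - s) = (1 - s)^-1 by field; rewrite gt_eqF.
by [].
Qed.

End power_bounds.

(** * Smallness of the supremum *)

Section sup_bound.
Context (R : realType) (m : nat).
Local Notation n := m.+2.
Local Notation RN := 'rV[R]_n.
Local Notation mu := (lebesgue_rV R n).
Local Notation leb := (@lebesgue_measure R).

Context (p : R) (V : R -> \bar R) (K : R -> R).
Hypothesis p1 : 1 < p.
Hypothesis V0 : forall r, 0 < r -> (0 <= V r)%E.

Let p0 : 0 < p. Proof. exact: lt_trans p1. Qed.

Lemma ae_weight_ge0 (u : RN -> R) :
  {ae mu, forall x, (0 <= V (enorm x) * (`|u x| `^ p)%:E)%E}.
Proof.
apply: filterS (@ae_enorm_gt0 R m.+1) => x x0.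
by rewrite mule_ge0 ?V0// lee_fin powR_ge0.
Qed.

(** The chosen representative is a weak gradient because one exists. Norm one bounds the integral of
    the sum by 1, and each summand is at most the sum almost everywhere. *)
Lemma W_unit (u : RN -> R) : W p V u -> Wnorm p V u = 1%E ->
  [/\ is_weak_gradient u (weak_gradient u),
      (\int[mu]_x (enorm (weak_gradient u x) `^ p)%:E <= 1)%E &
      (\int[mu]_x (V (enorm x) * (`|u x| `^ p)%:E) <= 1)%E].
Proof.
move=> [[_ ug _] _] un; have V0u := ae_weight_ge0 u.
have uw : is_weak_gradient u (weak_gradient u) by exact: (xgetPex _ ug).
have : (\int[mu]_x ((enorm (weak_gradient u x) `^ p)%:E + V (enorm x) * (`|u x| `^ p)%:E) <= 1)%E.
  move: un; rewrite /Wnorm; set I := (\int[mu]_x _)%E.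
  have I0 : (0 <= I)%E.
    apply: integral_ae_ge0; apply: filterS V0u => x x0.
    by rewrite adde_ge0// lee_fin powR_ge0.
  case: I I0 => [i||]//=.
    move=> i0 [/eqP]; rewrite powR_eq1 invr_eq0 (gt_eqF p0) orbF.
    by case/orP => [/eqP -> //|i0']; move: i0; rewrite lee_fin leNgt i0'.
  by rewrite invr_eq0 (gt_eqF p0).
move=> I1; split => //; apply: le_trans I1; apply: le_integral_ae.
  by apply: filterS V0u => x x0; rewrite leeDl.
by apply: nearW => x; rewrite leeDr// lee_fin powR_ge0.
Qed.

(** The set where |h| <= |u| is Borel. On it the maximum is |u|, off it |h|, and each of the two
    weighted integrals is at most 1, whence 2 eps. *)
Lemma integral_weighted_split (u h : RN -> R) (Z : RN -> \bar R) (q rho eps : R) :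
  0 < eps -> measurable_fun setT u -> measurable_fun setT h -> measurable_fun setT Z ->
  (forall x, (0 <= Z x)%E) ->
  (\int[mu]_x (V (enorm x) * (`|u x| `^ p)%:E) <= 1)%E ->
  (\int[mu]_x (V (enorm x) * (`|h x| `^ p)%:E) <= 1)%E ->
  {ae mu, forall x, enorm x < rho ->
    ((K (enorm x) * `|u x| `^ (q - 1) * `|h x|)%:E <=
     maxe (eps%:E * (V (enorm x) * (Num.max `|u x| `|h x| `^ p)%:E)) (Z x))%E} ->
  (\int[mu]_(x in eball rho) (K (enorm x) * `|u x| `^ (q - 1) * `|h x|)%:E <=
   (2 * eps)%:E + \int[mu]_x Z x)%E.
Proof.
move=> e0 mu_ mh mZ Z0 hu hh bound.
pose A : set RN := [set x | `|h x| <= `|u x|].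
have mA : measurable A.
  rewrite -[X in measurable X]setTI.
  by apply: measurable_fun_le => //; exact: measurableT_comp.
(* The sign of V is known at positive radii; the maximum with 0 settles the origin, a null set. *)
pose X (w : RN -> R) x := maxe (V (enorm x) * (`|w x| `^ p)%:E)%E 0%E.
have X0 w x : (0 <= X w x)%E by rewrite /X le_max lexx orbT.
have XE w : (\int[mu]_x X w x = \int[mu]_x (V (enorm x) * (`|w x| `^ p)%:E))%E.
  apply: eq_integral_ae; apply: filterS (ae_weight_ge0 w) => x x0.
  by rewrite /X max_l.
have restr (w : RN -> R) (x : RN) : (enorm x < rho -> Num.max `|u x| `|h x| = `|w x| ->
    ((K (enorm x) * `|u x| `^ (q - 1) * `|h x|)%:E <=
     maxe (eps%:E * (V (enorm x) * (Num.max `|u x| `|h x| `^ p)%:E)) (Z x))%E) ->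
    Num.max `|u x| `|h x| = `|w x| ->
    (((fun x => (K (enorm x) * `|u x| `^ (q - 1) * `|h x|)%:E) \_ (eball rho)) x <=
    maxe (eps%:E * X w x) (Z x))%E.
  move=> hx mxE; rewrite patchE; case: ifPn => [|_]; last by rewrite le_max Z0 orbT.
  rewrite inE => xr; apply: (le_trans (hx xr mxE)); rewrite mxE.
  rewrite ge_max !le_max lexx orbT andbT.
  by rewrite lee_wpmul2l ?lee_fin ?(ltW e0)// /X le_max lexx.
rewrite integral_mkcond; apply: (@le_trans _ _
    (eps%:E * ((\int[mu]_x X u x) + (\int[mu]_x X h x)) + \int[mu]_x Z x)%E).
  apply: (le_integral_split_max e0 mA) => //.
    apply: filterS bound => x hx Ax; apply: restr => [xr _|]; first exact: hx.
    by rewrite max_l.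
  apply: filterS bound => x hx nAx; apply: restr => [xr _|]; first exact: hx.
  by rewrite max_r// ltW// ltNge; apply/negP.
rewrite leeD2r// !XE mulrC EFinM; apply: lee_wpmul2l; first by rewrite lee_fin ltW.
by apply: (le_trans (leeD hu hh)); rewrite -EFinD.
Qed.

Context (R1 c L alpha beta gamma q : R).
Hypotheses (R10 : 0 < R1) (c0 : 0 < c) (L0 : 0 < L).
Hypothesis hfact : {ae leb, forall r, 0 < r < R1 -> exists v : R,
  [/\ V r = v%:E, c * r `^ (- gamma) <= v & K r <= L * r `^ alpha * v `^ beta]}.
Hypotheses (beta1 : beta <= 1) (pgamma : p <= gamma) (q1 : 1 < q) (pbq : p * beta < q).

Let R0_le rho eta : (forall u h : RN -> R, is_weak_gradient u (weak_gradient u) -> radial u ->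
   measurable_fun setT u -> measurable_fun setT h ->
  (\int[mu]_x (enorm (weak_gradient u x) `^ p)%:E <= 1)%E ->
  (\int[mu]_x (V (enorm x) * (`|u x| `^ p)%:E) <= 1)%E ->
  (\int[mu]_x (V (enorm x) * (`|h x| `^ p)%:E) <= 1)%E ->
  (\int[mu]_(x in eball rho) (K (enorm x) * `|u x| `^ (q - 1) * `|h x|)%:E <= eta)%E) ->
  (R0 n p V K q rho <= eta)%E.
Proof.
move=> H; apply: ge_ereal_sup => _ [u [h [[Wu ru] Wh un hn ->]]].
have [ug gu Vu] := W_unit Wu un; have [hg _ Vh] := W_unit Wh hn.
apply: (H u h) => //; apply: locally_L1_measurable; first by case: ug.
by case: hg.
Qed.

Lemma R0_small_subcritical : q < p ->
  q * (n%:R - gamma) < p * (alpha - gamma * beta + n%:R) ->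
  forall eta : R, 0 < eta -> exists2 rho0 : R, 0 < rho0 &
    forall rho, 0 < rho -> rho < rho0 -> (R0 n p V K q rho <= eta%:E)%E.
Proof.
move=> qp hq eta eta0.
pose s := q / p; have s0 : 0 < s by rewrite divr_gt0//; exact: lt_trans q1.
have s1 : s < 1 by rewrite ltr_pdivrMr// mul1r.
have s10 : 0 < 1 - s by lra.
pose L1 := L * c `^ (beta - q / p).
have L10 : 0 < L1 by rewrite mulr_gt0// powR_gt0.
pose e := alpha + gamma * (q / p - beta).
pose a := e / (1 - s).
(* Multiplied by p (1 - s), this is the inequality from [q_star]. *)
have na : - n%:R < a.
  have pE : p * q / p = q by rewrite mulrAC divff ?mul1r// gt_eqF.
  rewrite /a ltr_pdivlMr// -(ltr_pM2l p0) -subr_gt0 /e /s.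
  have -> : p * (alpha + gamma * (q / p - beta)) - p * (- n%:R * (1 - q / p)) =
     p * (alpha - gamma * beta + n%:R) - (p * q / p) * (n%:R - gamma) by ring.
  by rewrite pE subr_gt0.
(* Half of [eta] goes to the term with M, since 2 L1 eps = eta/2, and half to the power of the
   radius, through the bound eta/(2 k) on its integral. *)
pose eps := eta / (4 * L1).
have e0 : 0 < eps by rewrite divr_gt0// mulr_gt0.
pose k := L1 * eps `^ (- (s / (1 - s))).
have k0 : 0 < k by rewrite mulr_gt0// powR_gt0.
have ek0 : 0 < eta / (2 * k) by rewrite divr_gt0// mulr_gt0.
have [r0 r00 hr0] := integral_power_small_ball na ek0.
exists (Num.min r0 R1) => [|rho rp]; first by rewrite lt_min r00.
rewrite lt_min => /andP[rr0 rR1]; apply: R0_le => u h ug ru mu_ mh _ Vu Vh.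
pose Z := ((fun x : RN => (k * enorm x `^ a)%:E) \_ (eball rho)).
have mpow : measurable_fun setT (fun x : RN => (enorm x `^ a)%:E).
  apply/measurable_EFinP.
  by apply: (measurableT_comp (measurable_powR a)); exact: measurable_enorm.
have mZ : measurable_fun setT Z.
  apply/(measurable_restrictT _ (@measurable_eball R n rho)); apply: measurable_funTS.
  by apply: (measurable_funeM k%:E) mpow.
have Z0 x : (0 <= Z x)%E.
  by rewrite /Z patchE; case: ifPn => // _; rewrite lee_fin mulr_ge0 ?powR_ge0// ltW.
have Le0 : 0 < L1 * eps by rewrite mulr_gt0.
apply: (le_trans (@integral_weighted_split u h Z q rho (L1 * eps) Le0 mu_ mh mZ Z0 Vu Vh _)).
  have := @ae_enorm R m.+1 _ hfact; have := @ae_enorm_gt0 R m.+1.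
  apply: filterS2 => x x0 hx xrho.
  have [|v [Vv cv Kv]] := hx; first by rewrite x0 (lt_trans xrho).
  have hb := integrand_le_subcritical L0 c0 x0 p1 q1 pbq (normr_ge0 (u x)) (normr_ge0 (h x)) cv Kv.
  have v0 : 0 <= v by apply: le_trans cv; rewrite mulr_ge0 ?powR_ge0// ltW.
  set M := Num.max `|u x| `|h x| in hb *.
  have M0 : 0 <= v * M `^ p by rewrite mulr_ge0 ?powR_ge0.
  have hy := powR_young_max s0 s1 (powR_ge0 (enorm x) e) M0 e0.
  rewrite Vv /Z patchE mem_set// -!EFinM -EFin_max lee_fin (le_trans hb)//.
  rewrite -/L1 -/e -/s -mulrA (le_trans (ler_wpM2l (ltW L10) hy))//.
  by rewrite maxr_pMr ?(ltW L10)// !mulrA -powRrM.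
rewrite -integral_mkcond.
have -> : (\int[mu]_(x in eball rho) (k * enorm x `^ a)%:E =
   k%:E * \int[mu]_(x in eball rho) (enorm x `^ a)%:E)%E.
  under eq_integral do rewrite EFinM.
  have mB := @measurable_eball R n rho.
  have mpB : measurable_fun (@eball R n rho) (fun x : RN => (enorm x `^ a)%:E).
    exact: measurable_funTS.
  have pB0 (x : RN) : eball rho x -> (0 <= (enorm x `^ a)%:E)%E by rewrite lee_fin powR_ge0.
  have kE0 : (0 <= k%:E)%E by rewrite lee_fin ltW.
  by rewrite ge0_integralZl.
apply: (@le_trans _ _ ((2 * (L1 * eps))%:E + k%:E * (eta / (2 * k))%:E)%E).
  by rewrite leeD2l// lee_wpmul2l ?lee_fin ?(ltW k0)//; apply: hr0 => //; exact: ltW.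
rewrite -EFinM -EFinD lee_fin le_eqVlt; apply/orP; left; apply/eqP.
by rewrite /eps; field; rewrite !gt_eqF.
Qed.

Lemma R0_small_supercritical : p <= q ->
  q * (p * (n%:R - 1) - gamma * (p - 1)) <
    p * (p * alpha + (1 - p * beta) * gamma + p * (n%:R - 1)) ->
  forall eta : R, 0 < eta -> exists2 rho0 : R, 0 < rho0 &
    forall rho, 0 < rho -> rho < rho0 -> (R0 n p V K q rho <= eta%:E)%E.
Proof.
move=> pq hq eta eta0.
have hV : {ae leb, forall r, 0 < r < R1 -> ((c * r `^ (- gamma))%:E <= V r)%E}.
  by apply: (@filterS _ _ (ae_filter_ringOfSetsType leb) _ _ _ hfact) => r hr /hr[v [-> cv _]]; rewrite lee_fin.
have [C C0 hC] := @radial_decay R m p gamma c R1 V p1 pgamma c0 V0 hV.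
pose nu := decay_exponent m p gamma.
pose delta := alpha + gamma * (1 - beta) - nu * (q - p).
(* p^2 delta is the difference of the two sides of the inequality from [q_sstar]. *)
have d0 : 0 < delta.
  rewrite -(ltr_pM2l p0) mulr0 -(ltr_pM2l p0) mulr0.
  have -> : p * (p * delta) = p * (p * alpha + (1 - p * beta) * gamma + p * (n%:R - 1)) -
      q * (p * (n%:R - 1) - gamma * (p - 1)).
    by rewrite /delta /nu /decay_exponent; field; rewrite gt_eqF.
  by rewrite subr_gt0.
pose L2 := L * c `^ (beta - 1) * C `^ (q - p).
have L20 : 0 < L2 by rewrite /L2 mulr_gt0// ?mulr_gt0// powR_gt0.
(* The radius r at which 2 L2 r^delta equals [eta]. *)
pose r1 := (eta / (2 * L2)) `^ delta^-1.
have eL0 : 0 < eta / (2 * L2) by rewrite divr_gt0// mulr_gt0.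
exists (Num.min r1 (Num.min R1 (Num.min 1 (R1 / 2)))).
  by rewrite !lt_min R10 ltr01 powR_gt0//= divr_gt0.
move=> rho rp; rewrite 2!lt_min => /and3P[rr1 rR1 rR2].
apply: R0_le => u h ug ru mu_ mh gu Vu Vh.
have e0 : 0 < L2 * rho `^ delta by rewrite mulr_gt0// powR_gt0.
apply: (le_trans (@integral_weighted_split u h (cst 0%E) q rho _ e0 mu_ mh _ _ Vu Vh _)) => //.
  have hx := @ae_enorm R m.+1 _ hfact.
  have hx' := hC u _ ug ru gu Vu.
  have h0 := @ae_enorm_gt0 R m.+1.
  move: h0 hx hx'; apply: filterS3 => x x0 hx hdec xrho.
  have [|v [Vv cv Kv]] := hx; first by rewrite x0 (lt_trans xrho).
  have ux : `|u x| <= C * enorm x `^ (- nu) by apply: hdec; rewrite x0 (lt_trans xrho).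
  have hb := integrand_le_supercritical L0 c0 x0 C0 p1 pq beta1 (normr_ge0 (u x))
    (normr_ge0 (h x)) cv Kv ux.
  have v0 : 0 <= v by apply: le_trans cv; rewrite mulr_ge0 ?powR_ge0// ltW.
  rewrite Vv le_max; apply/orP; left; rewrite -!EFinM lee_fin (le_trans hb)//.
  rewrite -/L2 -/delta ler_wpM2r ?mulr_ge0 ?powR_ge0// ler_pM2l//.
  by rewrite ge0_ler_powR ?nnegrE ?(ltW d0) ?enorm_ge0 ?(ltW rp)// ltW.
rewrite integral0 adde0 lee_fin mulrA mulrC -ler_pdivlMr; last by rewrite mulr_gt0.
have -> : eta / (2 * L2) = r1 `^ delta.
  by rewrite /r1 -powRrM mulVf ?gt_eqF// powRr1// ltW.
by rewrite ge0_ler_powR ?nnegrE ?(ltW d0) ?(ltW rp) ?powR_ge0// ltW.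
Qed.

End sup_bound.

Lemma ae_mrestr d (T : measurableType d) (R : realType)
    (nu : {measure set T -> \bar R}) (D : set T) (mD : measurable D) (P : T -> Prop) :
  {ae mrestr nu mD, forall x, P x} -> {ae nu, forall x, D x -> P x}.
Proof.
move=> [M [mM M0 sM]]; exists (M `&` D); split => //; first exact: measurableI.
by move=> x /= /not_implyP[Dx Px]; split => //; exact: sM.
Qed.

(** * Constants from the essential bounds *)

Section weight_bounds.
Context (R : realType) (V : R -> \bar R) (K : R -> R) (R1 alpha beta gamma : R).
Local Notation leb := (@lebesgue_measure R).
Local Notation leb1 := (mrestr leb (measurable_itv `]0%R, R1[)).

Lemma ae_weight_bounds : (forall r, 0 < r -> (0 <= V r)%E) ->
  {ae leb, forall r, r \in `]0, R1[ -> (V r < +oo)%E} ->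
  (ess_sup leb1 (fun r => (K r)%:E / ((r `^ alpha)%:E * V r `^ beta)) < +oo)%E ->
  (0 < ess_inf leb1 (fun r => (r `^ gamma)%:E * V r))%E ->
  exists c L : R, [/\ 0 < c, 0 < L & {ae leb, forall r, 0 < r < R1 -> exists v : R,
    [/\ V r = v%:E, c * r `^ (- gamma) <= v & K r <= L * r `^ alpha * v `^ beta]}].
Proof.
move=> V0 Vfin; set S := ess_sup _ _ => Soo; set I := ess_inf _ _ => I0.
have [c c0 cI] : exists2 c : R, 0 < c & (c%:E <= I)%E.
  by case: I I0 => [i i0||//]; [exists i|exists 1; rewrite ?leey].
have [L L0 SL] : exists2 L : R, 0 < L & (S <= L%:E)%E.
  case: S Soo => [s _|//|_]; last by exists 1; rewrite ?leNye.
  by exists (Num.max s 1); rewrite ?lt_max ?ltr01 ?orbT// lee_fin le_max lexx.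
exists c, L; split => //.
have hS := ae_mrestr (elimT ess_supP SL).
have hI := ae_mrestr (elimT ess_infP cI).
move: Vfin hS hI; apply: (@filterS3 _ _ (ae_filter_ringOfSetsType leb)) => r.
rewrite /= !in_itv/= => hV hS hI /andP[r0 rR1].
have := V0 _ r0; have := hV; have := hI; have := hS; rewrite r0 rR1.
move=> /(_ isT) + /(_ isT) + /(_ isT); case: (V r) => [v||]// Sv Iv _ v0.
have rg : 0 < r `^ gamma by exact: powR_gt0.
have cv : c * r `^ (- gamma) <= v.
  by move: Iv; rewrite -EFinM lee_fin powRN ler_pdivrMr// mulrC.
exists v; split => //.
have v1 : 0 < v by apply: lt_le_trans cv; rewrite mulr_gt0// powR_gt0.
have rv : 0 < r `^ alpha * v `^ beta by rewrite mulr_gt0// powR_gt0.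
move: Sv; rewrite poweR_EFin -EFinM inver (gt_eqF rv) -EFinM lee_fin.
by rewrite ler_pdivrMr// mulrA.
Qed.

End weight_bounds.

(** * Integration by parts *)

Lemma integrable_bounded_support d (T : measurableType d) (R : realType)
    (nu : {measure set T -> \bar R}) (S : set T) (f : T -> R) (M : R) :
  measurable S -> (nu S < +oo)%E -> measurable_fun setT f ->
  (forall x, `|f x| <= M) -> (forall x, ~ S x -> f x = 0) ->
  nu.-integrable setT (EFin \o f).
Proof.
move=> mS Soo mf fM f0.
have -> : EFin \o f = (EFin \o f) \_ S.
  by apply/funext => x; rewrite patchE; case: ifPn => //; rewrite notin_setE => /f0 /= ->.
rewrite -integrable_mkcond//; apply: measurable_bounded_integrable => //.
  exact: measurable_funTS.
exists M; split; first exact: num_real.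
by move=> x xM y _; exact: le_trans (fM y) (ltW xM).
Qed.

Section integral_of_derivative.
Context (R : realType).
Local Notation leb := (@lebesgue_measure R).

Lemma integral_derive_eq0 (F f : R -> R) (b : R) : 0 < b ->
  (forall t : R, is_derive t (1 : R) F (f t)) -> continuous f ->
  (forall t, b < `|t| -> F t = 0) -> (forall t, b < `|t| -> f t = 0) ->
  (\int[leb]_t (f t)%:E = 0)%E.
Proof.
move=> b0 dF cf F0 f0; pose c := b + 1.
have bc : b < `|c| by rewrite gtr0_norm /c; lra.
have bNc : b < `|- c| by rewrite normrN.
have cF : continuous F by exact: is_derive_continuous dF.
have -> : (\int[leb]_t (f t)%:E = \int[leb]_(t in `[(- c)%R, c]) (f t)%:E)%E.
  rewrite [RHS]integral_mkcond; apply: eq_integral => t _; rewrite patchE.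
  case: ifPn => //; rewrite notin_setE /= in_itv/= => /negP tc; rewrite f0//.
  by move: tc; rewrite -ler_norml -ltNge /c; lra.
rewrite (@continuous_FTC2 R f F).
- by rewrite (F0 _ bc) (F0 _ bNc) subee.
- by rewrite /c; lra.
- exact: continuous_subspaceT.
- split; first by move=> t _; have [] := dF t.
  + by apply: cvg_at_right_filter; exact: cF.
  + by apply: cvg_at_left_filter; exact: cF.
- by move=> t _; rewrite derive1E; have [_ ->] := dF t.
Qed.

Lemma rV_cons_addl n (h s : R) (v : 'rV[R]_n) :
  rV_cons (h + s, v) = h *: delta_mx ord0 ord0 + rV_cons (s, v).
Proof.
apply/rowP => k; rewrite !mxE/=; case: unliftP => [j ->|->]/=.
  by rewrite ?andbF mulr0 add0r.
by rewrite ?eqxx mulr1.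
Qed.

Lemma rV_cons_addr n (h s : R) (j : 'I_n) (v : 'rV[R]_n) :
  rV_cons (s, h *: delta_mx ord0 j + v) =
  h *: delta_mx ord0 (lift ord0 j) + rV_cons (s, v).
Proof.
apply/rowP => k; rewrite !mxE/=; case: unliftP => [l ->|->]/=.
  by rewrite !mxE (inj_eq lift_inj).
by rewrite mulr0 add0r.
Qed.

(* [dpsi] is assumed continuous along the lines of direction e_i only, so that the
   hypotheses pass to the slices in the induction on the dimension. *)
Lemma integral_partial_eq0 n (i : 'I_n) (psi dpsi : 'rV[R]_n -> R) (b M : R) :
  0 < b -> measurable_fun setT dpsi -> (forall x, `|dpsi x| <= M) ->
  (forall x, ~ box b x -> psi x = 0) -> (forall x, ~ box b x -> dpsi x = 0) ->
  (forall x, is_derive x (delta_mx ord0 i : 'rV[R]_n) psi (dpsi x)) ->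
  (forall x, continuous (fun t : R => dpsi (t *: delta_mx ord0 i + x))) ->
  (\int[lebesgue_rV R n]_x (dpsi x)%:E = 0)%E.
Proof.
move=> b0; elim: n => [|n IH] in i psi dpsi *; first by case: i.
move=> md dM psi0 dpsi0 dpsiE cd.
pose m := (leb \x lebesgue_rV R n)%E.
have mc : measurable_fun setT (dpsi \o @rV_cons R n).
  by apply: measurableT_comp => //; exact: measurable_rV_cons.
have ic : m.-integrable setT (EFin \o (dpsi \o @rV_cons R n)).
  apply: (@integrable_bounded_support _ _ _ m (@rV_cons R n @^-1` @box R n.+1 b) _ M) => //.
  - by apply: measurable_rV_cons_preimage; exact: measurable_box.
  - have boo : (lebesgue_rV R n.+1 (@box R n.+1 b) < +oo)%E.
      by rewrite lebesgue_rV_box ?(ltW b0)// ltry.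
    exact: boo.
  - by move=> x; exact: dM.
  - by move=> x; exact: dpsi0.
transitivity (\int[pushforward m (@rV_cons R n)]_x (EFin \o dpsi) x)%E.
  by apply: eq_measure_integral => //; exact: measurable_rV_cons.
rewrite integral_pushforward//; last first.
- exact/measurable_EFinP.
- exact: measurable_rV_cons.
rewrite preimage_setT.
have nbox s v : b < `|s| -> ~ @box R n.+1 b (rV_cons (s, v)).
  by move=> bs /(_ ord0); rewrite mxE unlift_none /= leNgt bs.
have nboxr s v : ~ @box R n b v -> ~ @box R n.+1 b (rV_cons (s, v)).
  by move=> bv bx; apply: bv => j; have := bx (lift ord0 j); rewrite mxE liftK.
(* For a direction other than the first, the inner integral is over the remaining coordinates and
   vanishes by induction. For the first direction the order of integration is exchanged and the
   inner integral is that of a derivative on the line. *)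
have [j ij|i0] := unliftP ord0 i.
  rewrite -(integral12_prod_meas1 ic); apply: integral0_eq => s _.
  rewrite /fubini_F/=; apply: (IH j (fun v => psi (rV_cons (s, v)))) => //.
  - by apply: measurableT_comp md _; apply: measurableT_comp; [exact: measurable_rV_cons|].
  - by move=> v bv; apply: psi0; exact: nboxr.
  - by move=> v bv; apply: dpsi0; exact: nboxr.
  - move=> v; apply/is_derive_line; under eq_fun do rewrite rV_cons_addr -ij.
    exact/is_derive_line.
  - by move=> v; under eq_fun do rewrite rV_cons_addr -ij; exact: cd.
rewrite -(integral21_prod_meas1 ic); apply: integral0_eq => v _.
rewrite /fubini_G/=; apply: (@integral_derive_eq0 (fun s => psi (rV_cons (s, v))) _ b) => //.
- move=> s; apply/is_derive_line.
  under eq_fun do rewrite [_ *: 1]mulr1 rV_cons_addl -i0.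
  exact/is_derive_line.
- suff -> : (fun s => dpsi (rV_cons (s, v))) =
     (fun s => dpsi (s *: delta_mx ord0 i + rV_cons (0, v))) by exact: cd.
  by apply/funext => s; rewrite i0 -rV_cons_addl addr0.
- by move=> s bs; apply: psi0; exact: nbox.
- by move=> s bs; apply: dpsi0; exact: nbox.
Qed.

End integral_of_derivative.

Section classical_gradient.
Context (R : realType) (N : nat).
Local Notation RN := 'rV[R]_N.
Local Notation mu := (lebesgue_rV R N).
Local Notation e_ i := (delta_mx ord0 i : RN).

Lemma continuous_bounded_on_compact (f : RN -> R) (A : set RN) : continuous f ->
  compact A -> exists2 B : R, 0 <= B & forall x, A x -> `|f x| <= B.
Proof.
move=> cf cA; have /compact_bounded[M [Mr hM]] : compact (f @` A).
  by apply: continuous_compact => //; exact: continuous_subspaceT.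
exists (`|M| + 1) => [|x Ax]; first by rewrite addr_ge0.
apply: (hM (`|M| + 1)); last by exists x.
by rewrite (le_lt_trans (ler_norm _))// ltrDl.
Qed.

Lemma lebesgue_rV_box_lty M : (mu (@box R N M) < +oo)%E.
Proof.
apply: (@le_lt_trans _ _ (mu (@box R N `|M|))); last first.
  by rewrite lebesgue_rV_box// ltry.
apply: le_measure; rewrite ?inE; try exact: measurable_box.
by move=> x xM i; exact: le_trans (xM i) (ler_norm _).
Qed.

Lemma continuous_locally_L1 (f : RN -> R) : continuous f -> locally_L1 f.
Proof.
move=> cf A cA; have [B B0 fB] := continuous_bounded_on_compact cf cA.
have mA : measurable A.
  by apply: closed_measurable_rV; apply: compact_closed => //; exact: norm_hausdorff.
have [M _ AM] := compact_sub_box cA.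
have mf := continuous_measurable_rV cf.
apply: measurable_bounded_integrable => //.
- apply: le_lt_trans (lebesgue_rV_box_lty M).
  by apply: le_measure; rewrite ?inE//; exact: measurable_box.
- exact: measurable_funTS.
exists B; split; first exact: num_real.
by move=> x Bx y Ay; exact: le_trans (fB y Ay) (ltW Bx).
Qed.

Lemma continuous_box_integrable (f : RN -> R) M : continuous f ->
  (forall x, ~ box M x -> f x = 0) ->
  (exists B, forall x, `|f x| <= B) /\ mu.-integrable setT (EFin \o f).
Proof.
move=> cf f0; have [B B0 fB] := continuous_bounded_on_compact cf (@compact_box R N M).
have bf x : `|f x| <= B.
  by have [/fB//|/f0 ->] := pselect (box M x); rewrite normr0.
split; first by exists B.
apply: (integrable_bounded_support (@measurable_box R N M) (lebesgue_rV_box_lty M)) => //.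
exact: continuous_measurable_rV.
Qed.

Lemma continuous_shift_line (i : 'I_N) (f : RN -> R) (x : RN) : continuous f ->
  continuous (fun t : R => f (t *: e_ i + x)).
Proof.
move=> cf t; apply: (@continuous_comp _ _ _ (fun t : R => t *: e_ i + x) f); last exact: cf.
by apply: cvgD; [exact: scalel_continuous|exact: cvg_cst].
Qed.

(** The product of [u] and a test function has compact support, so its partial derivatives integrate
    to 0. *)
Lemma Ck_weak_gradient (u : RN -> R) : Ck 1 u ->
  is_weak_gradient u (fun x => \row_i partial i u x).
Proof.
move=> cu; have cu0 := Ck_continuous cu; split; first exact: continuous_locally_L1.
move=> i; have cdu : continuous (partial i u) by exact: Ck_continuous (Ck_partial i cu).
have -> : (fun x => (\row_i0 partial i0 u x) ord0 i) = partial i u.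
  by apply/funext => x; rewrite mxE.
split; first exact: continuous_locally_L1.
move=> phi [sphi cphi]; have cphi1 := sphi 1%N.
have cphi0 := Ck_continuous cphi1.
have cdphi : continuous (partial i phi) by exact: Ck_continuous (Ck_partial i cphi1).
have [M M0 suppM] := compact_sub_box cphi.
(* Off the box [phi] vanishes on a neighbourhood, not only at the point, so its partial derivatives
   vanish there too. *)
have zphi x : ~ box M x -> \forall y \near x, phi y = 0.
  move=> xM; pose S := closure [set x | phi x != 0].
  have : nbhs x (~` S).
    apply: open_nbhs_nbhs; split; last by move=> s; exact: xM (suppM _ s).
    by apply: closed_openC; exact: closed_closure.
  apply: filterS => y py; apply: contrapT => /eqP py0.
  by apply: py; exact: subset_closure.
have phi0 x : ~ box M x -> phi x = 0 by move=> /zphi /nbhs_singleton.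
have dphi0 x : ~ box M x -> partial i phi x = 0.
  move=> /zphi xM; rewrite /partial.
  by rewrite (@near_eq_derive _ _ _ phi (cst 0) x (e_ i) xM) derive_cst.
have cud : continuous (fun x => u x * partial i phi x).
  by move=> x; apply: (@continuousM _ _ u (partial i phi)); [exact: cu0|exact: cdphi].
have cdu' : continuous (fun x => partial i u x * phi x).
  by move=> x; apply: (@continuousM _ _ (partial i u) phi); [exact: cdu|exact: cphi0].
have ud0 x : ~ box M x -> u x * partial i phi x = 0 by move=> /dphi0 ->; rewrite mulr0.
have du0 x : ~ box M x -> partial i u x * phi x = 0 by move=> /phi0 ->; rewrite mulr0.
have [_ iud] := continuous_box_integrable cud ud0.
have [_ idu] := continuous_box_integrable cdu' du0.
pose dpsi x := u x * partial i phi x + partial i u x * phi x.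
have cdpsi : continuous dpsi by move=> x; apply: (continuousD (cud x) (cdu' x)).
have dpsi0 x : ~ box M x -> dpsi x = 0.
  by move=> xM; rewrite /dpsi phi0// dphi0// !mulr0 addr0.
have [[B dB] _] := continuous_box_integrable cdpsi dpsi0.
have dpsiE x : is_derive x (e_ i) (fun x => u x * phi x) (dpsi x).
  have du := Ck_is_derive i x cu; have dphi := Ck_is_derive i x cphi1.
  by apply: is_derive_eq; rewrite /dpsi; congr (_ + _); rewrite mulrC.
under [X in _ = - X]eq_Rintegral do rewrite mxE.
apply/eqP; rewrite -addr_eq0 -RintegralD//; apply/eqP.
transitivity (fine (\int[mu]_x (dpsi x)%:E)%E) => //.
have psi0 x : ~ box M x -> u x * phi x = 0 by move=> /phi0 ->; rewrite mulr0.
have cl x : continuous (fun t : R => dpsi (t *: e_ i + x)) by exact: continuous_shift_line.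
have mdpsi := continuous_measurable_rV cdpsi.
by rewrite (integral_partial_eq0 M0 mdpsi dB psi0 dpsi0 dpsiE cl).
Qed.

End classical_gradient.

(** * Uniqueness of the weak gradient *)

Section cube_indicator.
Context (R : realType) (N : nat).
Local Notation RN := 'rV[R]_N.
Local Notation mu := (lebesgue_rV R N).
Local Notation step := (@smooth_step R).

Lemma test_function_box (phi : RN -> R) M : (forall k, Ck k phi) ->
  (forall x, ~ box M x -> phi x = 0) -> test_function phi.
Proof.
move=> cphi sphi; split => //.
apply: (@compact_sub_closed_box _ _ _ M); first exact: closed_closure.
rewrite closureE; apply: smallest_sub.
  by apply: compact_closed; [exact: norm_hausdorff|exact: compact_box].
by move=> x /= px; apply: contrapT => /sphi px0; rewrite px0 eqxx in px.
Qed.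

(** All coordinates share the upper end [b] while the lower ends vary: an orthant met with a cube
    has this form. *)
Definition open_box (a : 'I_N -> R) (b : R) : set RN :=
  [set x | forall j, a j < x ord0 j < b].

Lemma measurable_open_box a b : measurable (open_box a b).
Proof.
have := @measurable_forall_coord R N (fun j => `]a j, b[%classic) (fun=> measurable_itv _).
by congr measurable; apply/seteqP; split => x /= h j; have := h j; rewrite in_itv.
Qed.

(** Smooth approximations of the indicator of the open box from inside: each factor rises from 0 to
    1 within distance 1/(l + 1) of a face. *)
Definition open_box_bump (a : 'I_N -> R) (b : R) (l : nat) (x : RN) : R :=
  \prod_j (step (l.+1%:R * x ord0 j - l.+1%:R * a j) *
           step (- l.+1%:R * x ord0 j + l.+1%:R * b)).

Lemma open_box_bump_out a b l x : ~ open_box a b x -> open_box_bump a b l x = 0.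
Proof.
move=> /existsNP[j /negP]; rewrite negb_and -!leNgt => xj.
rewrite /open_box_bump (bigD1 j)//=; apply/eqP; rewrite mulf_eq0; apply/orP; left.
rewrite mulf_eq0; apply/orP; case/orP: xj => xj; [left|right]; apply/eqP.
  by rewrite smooth_step_le0// -mulrBr mulr_ge0_le0// subr_le0.
by rewrite smooth_step_le0// mulNr addrC -mulrBr mulr_ge0_le0// subr_le0.
Qed.

Lemma open_box_bump_bound a b l x : `|open_box_bump a b l x| <= 1.
Proof.
rewrite ger0_norm; last first.
  by apply: prodr_ge0 => j _; rewrite mulr_ge0// smooth_step_ge0.
apply: (@le_trans _ _ (\prod_(j < N) (1 : R))); last by rewrite big1.
apply: ler_prod => j _; rewrite mulr_ge0 ?smooth_step_ge0//=.
by rewrite mulr_ile1 ?smooth_step_ge0 ?smooth_step_le1.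
Qed.

Lemma test_open_box_bump a b l : (forall j, - b <= a j) ->
  test_function (open_box_bump a b l).
Proof.
move=> ab; apply: (@test_function_box _ b) => [k|x xb].
  apply: Ck_prod => j; apply: CkM.
    apply: (@Ck_comp _ _ _ (fun t => step (l.+1%:R * t - l.+1%:R * a j))); last exact: Ck_coord.
    by apply: smooth_upto_affine; exact: smooth_smooth_step.
  apply: (@Ck_comp _ _ _ (fun t => step (- l.+1%:R * t + l.+1%:R * b))); last exact: Ck_coord.
  by apply: smooth_upto_affine; exact: smooth_smooth_step.
apply: open_box_bump_out => xo; apply: xb => j; have /andP[axj xjb] := xo j.
by rewrite ler_norml (ltW xjb) (ltW (le_lt_trans (ab j) axj)).
Qed.

Lemma open_box_bump_cvg a b x :
  open_box_bump a b l x @[l --> \oo] --> (\1_(open_box a b) x : R).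
Proof.
have [xo|xo] := pselect (open_box a b x); last first.
  rewrite indicE memNset//=; under eq_fun do rewrite open_box_bump_out//.
  exact: cvg_cst.
rewrite indicE mem_set//=; apply: cvg_near_cst.
have big d : 0 < d -> \forall l \near \oo, 1 <= l.+1%:R * d :> R.
  move=> d0; near=> l; rewrite -ler_pdivrMl// mulr1 ltW//.
  by near: l; exact: near_infty_natSinv_lt (PosNum d0).
have : \forall l \near \oo, forall j, (1 <= l.+1%:R * (x ord0 j - a j)) &&
    (1 <= l.+1%:R * (b - x ord0 j)).
  apply: filter_forall => j; have /andP[axj xjb] := xo j.
  by near=> l; apply/andP; split; near: l; apply: big; rewrite subr_gt0.
apply: filterS => l hl; rewrite /open_box_bump big1// => j _.
have /andP[h1 h2] := hl j.
by rewrite !smooth_step_ge1 ?mulr1// ?mulNr 1?[- _ + _]addrC -mulrBr.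
Unshelve. all: by end_near. Qed.

(** Dominated convergence along the bumps, with |f| on the closed box as dominating function; the
    condition on [a] keeps the supports in that box. *)
Lemma integral_open_box_eq0 (f : RN -> R) a b : locally_L1 f ->
  (forall phi, test_function phi -> (\int[mu]_x (f x * phi x) = 0)%R) ->
  (forall j, - b <= a j) ->
  (\int[mu]_(x in open_box a b) (f x)%:E = 0)%E.
Proof.
move=> lf f0 ab; have mf := locally_L1_measurable lf.
pose B := @box R N b.
have iB : mu.-integrable B (EFin \o f) by apply: lf; exact: compact_box.
have mB : measurable B by exact: measurable_box.
have oB : open_box a b `<=` B.
  move=> x xo j; have /andP[axj xjb] := xo j.
  by rewrite ler_norml (ltW xjb) (ltW (le_lt_trans (ab j) axj)).
have mbump l : measurable_fun setT (open_box_bump a b l).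
  by apply: continuous_measurable_rV; have [/(_ 0%N)] := test_open_box_bump l ab.
pose f_ l x := (f x * open_box_bump a b l x)%:E.
have f_int l : (\int[mu]_(x in B) f_ l x = 0)%E.
  have [if_ _] := @integrable_mul_bounded _ _ _ mu B f (open_box_bump a b l) 1 mB iB mf
     (mbump l) (@open_box_bump_bound a b l)
     (fun x xB => @open_box_bump_out a b l x (fun xo => xB (oB _ xo))).
  rewrite integral_mkcond; transitivity (\int[mu]_x f_ l x)%E.
    apply: eq_integral => x _; rewrite patchE; case: ifPn => //.
    rewrite notin_setE => xB; rewrite /f_ open_box_bump_out ?mulr0// => xo.
    exact/xB/oB.
  have := f0 _ (test_open_box_bump l ab); rewrite /Rintegral => /eqP.
  rewrite fine_eq0; first by move/eqP.
  exact: integrable_fin_num if_.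
have dom : (\int[mu]_(x in B) f_ l x @[l --> \oo] -->
    \int[mu]_(x in B) (f x * \1_(open_box a b) x)%:E)%E.
  apply: (@dominated_cvg _ _ _ mu B mB f_ _ (fun x => `|f x|%:E)) => //.
  - move=> l; apply: measurable_funTS; apply/measurable_EFinP; exact: measurable_funM.
  - move=> x _; rewrite /f_; apply: cvg_EFin; first exact: nearW.
    by apply: cvgM; [exact: cvg_cst|exact: open_box_bump_cvg].
  - exact: integrable_norm.
  - move=> l x _; rewrite /f_ lee_fin normrM.
    by rewrite ler_piMr// open_box_bump_bound.
have : (\int[mu]_(x in B) (f x * \1_(open_box a b) x)%:E = 0)%E.
  apply: (cvg_unique _ dom) => //.
  by apply: cvg_near_cst; apply: nearW => l; exact: f_int.
move=> <-; rewrite integral_mkcond [RHS]integral_mkcond; apply: eq_integral => x _.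
rewrite !patchE indicE; case: ifPn => [|xo].
  by rewrite inE => xo; rewrite mem_set ?mulr1//; exact: oB.
by case: ifPn => // _; rewrite mulr0.
Qed.

End cube_indicator.

Section fundamental_lemma.
Context (R : realType) (N : nat).
Local Notation RN := 'rV[R]_N.
Local Notation mu := (lebesgue_rV R N).

(** A pi-system that generates the Borel sets and whose traces on a cube are open boxes. *)
Let orthants : set (set RN) :=
  [set A | exists a : 'I_N -> R, A = [set x : RN | forall j, a j < x ord0 j]].

Let measurable_orthants : @measurable _ RN = <<s orthants >>.
Proof.
apply/seteqP; split => A mA; last first.
  suff sG : <<s orthants >> `<=` @measurable _ RN by exact: sG.
  apply: smallest_sub; first exact: sigma_algebra_measurable.
  move=> _ [a ->].
  have := @measurable_forall_coord R N (fun j => `]a j, +oo[%classic) (fun=> measurable_itv _).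
  by congr measurable; apply/seteqP; split => x /= h j; have := h j; rewrite in_itv/= andbT.
pose T := g_sigma_algebraType orthants.
have mid : measurable_fun [set: T] (fun x : T => x : RN).
  apply: measurable_fun_rV => i.
  apply: (measurability _ (RGenOInfty.measurableE R)) => _ [_ [a ->] <-].
  (* A half-space bounds one coordinate only: it is the union over [k] of the orthants whose other
     coordinates exceed -k. *)
  rewrite setTI (_ : _ @^-1` _ =
      \bigcup_k [set x : RN | forall j, (if j == i then a else - k%:R) < x ord0 j]).
    by apply: bigcupT_measurable => k; apply: sub_sigma_algebra; eexists.
  apply/seteqP; split => [x|x [k _ /(_ i)]]; rewrite /= in_itv/= andbT ?eqxx// => ax.
  exists (Num.truncn (\sum_j `|x ord0 j|)).+1 => // j; case: eqP => [->//|_].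
  rewrite ltrNl; apply: le_lt_trans (truncnS_gt _).
  rewrite (le_trans (ler_norm _))// normrN (bigD1 j)//= lerDl.
  by apply: sumr_ge0.
by have := mid measurableT A mA; rewrite setTI.
Qed.

Let orthants_setI : setI_closed orthants.
Proof.
move=> _ _ [a ->] [b ->]; exists (fun j => Num.max (a j) (b j)).
apply/seteqP; split => [x [ha hb] j|x h].
  by rewrite gt_max ha hb.
by split => j; have := h j; rewrite gt_max => /andP[].
Qed.

(** The sets [A] such that [f] integrates to 0 over the part of [A] in the cube [Q] form a Dynkin
    system that contains the orthants, hence all Borel sets. Restricting to a cube makes the locally
    integrable [f] integrable. *)
Lemma ae_eq0_of_test (f : RN -> R) : locally_L1 f ->
  (forall phi, test_function phi -> (\int[mu]_x (f x * phi x) = 0)%R) ->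
  {ae mu, forall x, f x = 0}.
Proof.
move=> lf f0; have mf := locally_L1_measurable lf.
suff H (k : nat) : {ae mu, forall x, open_box (fun=> - k%:R) k%:R x -> f x = 0}.
  have := ae_foralln H; apply: filterS => x hx.
  apply: (hx (Num.truncn (\sum_j `|x ord0 j|)).+1) => j.
  rewrite -ltr_norml; apply: le_lt_trans (truncnS_gt _).
  by rewrite (bigD1 j)//= lerDl; apply: sumr_ge0.
pose Q : set RN := open_box (fun=> - k%:R) k%:R.
have mQ : measurable Q by exact: measurable_open_box.
have iQ : mu.-integrable Q (EFin \o f).
  apply: (integrableS (@measurable_box R N k%:R) mQ); last exact: lf (@compact_box _ _ _).
  by move=> x xQ j; rewrite ler_norml; have /andP[h1 h2] := xQ j; rewrite !ltW.
pose P (A : set RN) := (\int[mu]_(x in A `&` Q) (f x)%:E = 0)%E.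
have PQ : P setT by rewrite /P setTI; exact: integral_open_box_eq0.
have PA : forall A, <<s orthants >> A -> P A.
  apply: dynkin_induction => //.
  - move=> _ [a ->]; rewrite /P.
    rewrite (_ : _ `&` _ = open_box (fun j => Num.max (a j) (- k%:R)) k%:R).
      by apply: integral_open_box_eq0 => // j; rewrite le_max lexx orbT.
    apply/seteqP; split => [x [ha hb] j|x h].
      by have /andP[h1 h2] := hb j; rewrite gt_max ha h1 h2.
    by split => j; have /andP[] := h j; rewrite gt_max => /andP[h1 h2] h3 //; rewrite h2 h3.
  - move=> S mS PS; rewrite /P.
    have : (\int[mu]_(x in (S `&` Q) `|` (~` S `&` Q)) (f x)%:E = 0)%E.
      by rewrite -setIUl setUv setTI; exact: integral_open_box_eq0.
    rewrite integral_setU.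
    + by rewrite PS add0e.
    + exact: measurableI.
    + by apply: measurableI => //; exact: measurableC.
    + by apply: measurable_funTS; exact/measurable_EFinP.
    + by apply/disj_setPS => x [[Sx _] [nSx _]].
  - move=> F mF tF PF; rewrite /P setI_bigcupl integral_bigcup.
    + by rewrite eseries0// => i _ _; exact: PF.
    + exact: trivIset_setIr.
    + by move=> j; exact: measurableI.
    + apply: integrableS iQ => //; first by apply: bigcupT_measurable => j; exact: measurableI.
      by move=> x [j _ []].
have : ae_eq mu Q (EFin \o f) (cst 0%E).
  apply: integral_ae_eq => // E EQ mE; rewrite integral0.
  have := PA E; rewrite -measurable_orthants /P => /(_ mE).
  by rewrite setIidl.
by apply: filterS => x /= h /h [].
Qed.

Lemma weak_gradient_unique (u : RN -> R) (g h : RN -> RN) :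
  is_weak_gradient u g -> is_weak_gradient u h -> {ae mu, forall x, g x = h x}.
Proof.
move=> [lu hg] [_ hh].
suff H i : {ae mu, forall x, g x ord0 i - h x ord0 i = 0}.
  have : {ae mu, forall x, forall i, g x ord0 i - h x ord0 i = 0} by exact: filter_forall.
  by apply: filterS => x gh; apply/rowP => i; apply/eqP; rewrite -subr_eq0 gh.
have [lg ig] := hg i; have [lh ih] := hh i.
apply: ae_eq0_of_test => [A cA|phi tphi].
  have mA : measurable A.
    by apply: closed_measurable_rV; apply: compact_closed => //; exact: norm_hausdorff.
  by have := integrableB mA (lg A cA) (lh A cA).
have [sphi cphi] := tphi; have [M M0 suppM] := compact_sub_box cphi.
have mB := @measurable_box R N M.
have phi0 x : ~ box M x -> phi x = 0.
  move=> xM; apply: contrapT => /eqP px; apply: xM; apply: suppM.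
  exact: subset_closure.
have cphi0 : continuous phi by exact: (sphi 0%N).
have [B B0 phiB] := continuous_bounded_on_compact cphi0 (@compact_box R N M).
have bphi x : `|phi x| <= B.
  by have [/phiB//|/phi0 ->] := pselect (box M x); rewrite normr0.
have int (w : RN -> R) : locally_L1 w -> mu.-integrable setT (EFin \o (fun x => w x * phi x)).
  move=> lw; have [] // := @integrable_mul_bounded _ _ _ mu _ w phi B mB _ _ _ bphi phi0.
  - by apply: lw; exact: compact_box.
  - exact: locally_L1_measurable.
  - exact: continuous_measurable_rV.
under eq_Rintegral do rewrite mulrBl.
rewrite RintegralB//; [|exact: int lg|exact: int lh].
by apply/eqP; rewrite subr_eq0 -(inj_eq oppr_inj) -ig// -ih.
Qed.

End fundamental_lemma.

(** * A radial function of norm one *)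

Section Borel_version.
Context (R : realType).
Local Notation leb := (@lebesgue_measure R).

Lemma lebesgue_measurable_Borel (A : set R) :
  measurable (A : set (g_sigma_algebraType (completed_algebra_gen leb))) ->
  exists2 B : set R, measurable B & {ae leb, forall r, A r <-> B r}.
Proof.
move=> mA; have : completed_algebra_gen leb A by rewrite -g_sigma_completed_algebra_genE.
move=> [B mB [M [Z [mZ Z0 MZ]]] BMA]; exists B => //.
exists Z; split => // r /= nAB; apply: MZ; apply: contrapT => Mr; apply: nAB.
by rewrite -BMA; split => [[]//|Br]; left.
Qed.

(** The sublevel sets at rational levels are replaced by Borel sets; the infimum of the levels whose
    set contains [r] recovers [f r] off a countable union of null sets. The Borel version restores
    additivity of the integral in bounds that involve V. *)
Lemma lebesgue_measurable_fun_Borel (D : set R) (f : R -> \bar R) :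
  measurable D -> lebesgue_measurable_fun D f -> (forall r, D r -> (0 <= f r)%E) ->
  exists g : R -> \bar R, [/\ measurable_fun setT g, forall r, (0 <= g r)%E &
    {ae leb, forall r, D r -> f r = g r}].
Proof.
(* Natural numbers that code no rational stand for 0, a level that merely occurs again. *)
move=> mD mf f0; pose q (k : nat) : R := ratr (odflt 0 (unpickle k : option rat)).
have mDc : measurable (D : set (g_sigma_algebraType (completed_algebra_gen leb))).
  apply: sub_sigma_algebra; exists D => //; exists set0; last by rewrite setU0.
  exact: negligible_set0.
have /choice[B hB] k : exists B : set R, measurable B /\
    {ae leb, forall r, (D r /\ (f r < (q k)%:E)%E) <-> B r}.
  have mk := mf mDc _ (emeasurable_itv `]-oo, (q k)%:E[).
  have [B mB aeB] := lebesgue_measurable_Borel mk.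
  by exists B.
pose h k (r : R) : \bar R := if r \in B k then (q k)%:E else +oo%E.
have mh k : measurable_fun setT (h k).
  apply: measurable_fun_ifT => //; apply: (measurable_fun_bool true).
  by rewrite setTI preimage_mem_true; have [] := hB k.
exists (fun r => maxe (einfs (h^~ r) 0%N) 0%E); split.
- by apply: measurable_maxe => //; exact: measurable_fun_einfs.
- by move=> r; rewrite le_max lexx orbT.
have := ae_foralln (fun k => (hB k).2).
apply: (@filterS _ _ (ae_filter_ringOfSetsType leb)) => r hr Dr.
suff -> : einfs (h^~ r) 0%N = f r by rewrite max_l// f0.
apply/eqP; rewrite eq_le; apply/andP; split; last first.
  apply: le_ereal_inf_tmp => _ [k _ <-]; rewrite /h; case: ifPn => [|_]; last exact: leey.
  by rewrite inE => /hr[_ /ltW].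
rewrite leNgt; apply/negP => fr.
have fq k : (f r < (q k)%:E)%E -> (einfs (h^~ r) 0%N <= (q k)%:E)%E.
  move=> frq; apply: ereal_inf_lbound; exists k => //.
  by rewrite /h mem_set//; apply/hr.
case fE : (f r) fr fq (f0 r Dr) => [s||]// fr fq s0; last by rewrite ltNge leey in fr.
have [t st tE] : exists2 t : R, s < t & (t%:E < einfs (h^~ r) 0%N)%E.
  case E : (einfs (h^~ r) 0%N) fr => [e||]//; last by exists (s + 1); rewrite ?ltrDl ?ltry.
  rewrite lte_fin => se; exists ((s + e) / 2); rewrite ?lte_fin; lra.
have [x] := rat_in_itvoo st; rewrite in_itv/= => /andP[sx xt].
have := fq (pickle x); rewrite /q pickleK/= lte_fin => /(_ sx).
by rewrite leNgt (lt_trans _ tE)// lte_fin.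
Qed.

End Borel_version.

Section shell_bump.
Context (R : realType).
Local Notation P := (@smooth_step R).
Local Notation P' := (@smooth_step' R).

(** A step up over the first quarter of [[a, b]] and a step down over the third. The subinterval
    where chi' >= k is the middle third of the first quarter; it will make the gradient energy
    positive. *)
Lemma exists_smooth_bump (a b : R) : a < b -> exists chi chi' : R -> R,
  [/\ smooth chi, (forall t : R, is_derive t (1 : R) chi (chi' t)), continuous chi',
      forall t, ~ (a < t < b) -> chi t = 0 /\ chi' t = 0 &
      (exists M, forall t, `|chi t| <= M /\ `|chi' t| <= M) /\
      exists c d k, [/\ a < c, c < d, d < b, 0 < k & forall t, c <= t <= d -> k <= chi' t]].
Proof.
move=> ab; pose w := (b - a) / 4; have w0 : 0 < w by rewrite divr_gt0// subr_gt0.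
have bE : b = a + 4 * w by rewrite /w; lra.
pose arg (s t : R) := w^-1 * t + (- (s / w)).
have argE (s t : R) : arg s t = (t - s) / w by rewrite /arg; ring.
pose chi (t : R) := P (arg a t) + (-1) * P (arg (a + 2 * w) t).
pose chi' (t : R) := P' (arg a t) / w + (-1) * (P' (arg (a + 2 * w) t) / w).
have darg (s : R) t : is_derive t (1 : R) (fun t => P (arg s t)) (P' (arg s t) / w).
  apply: (@is_derive1_comp R P (arg s)); first exact: is_derive_smooth_step.
  have := is_deriveD (is_deriveZ (w^-1 : R) (is_derive_id t (1 : R))) (is_derive_cst (- (s / w)) t (1 : R)).
  by rewrite addr0 /GRing.scale/= mulr1.
have arg0 (s t : R) : t <= s -> arg s t <= 0.
  by move=> ts; rewrite argE pmulr_lle0 ?invr_gt0// subr_le0.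
have arg1 (s t : R) : s + w <= t -> 1 <= arg s t.
  by move=> ts; rewrite argE ler_pdivlMr// mul1r; lra.
have [B B0 PB] := @smooth_step'_bound R.
have [k k0 Pk] := @smooth_step'_lower_bound R.
exists chi, chi'; split.
- move=> j; apply: smooth_uptoD; first by apply: smooth_upto_affine; exact: smooth_smooth_step.
  apply: smooth_uptoM; first exact: smooth_cst.
  by apply: smooth_upto_affine; exact: smooth_smooth_step.
- by move=> t; exact: (is_deriveD (darg a t) (is_deriveZ (-1 : R) (darg (a + 2 * w) t))).
- have carg s : continuous (fun t => P' (arg s t) / w).
    move=> t; apply: (@continuousM _ _ (fun t => P' (arg s t)) (cst w^-1)); last exact: cvg_cst.
    apply: (@continuous_comp _ _ _ (arg s) P'); last exact: continuous_smooth_step'.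
    apply: (@continuousD _ _ _ (fun t => w^-1 * t)); last exact: cvg_cst.
    by apply: (@continuousM _ _ (cst w^-1) id); [exact: cvg_cst|exact: cvg_id].
  move=> t; apply: (@continuousD _ _ _ (fun t => P' (arg a t) / w)); first exact: carg.
  by apply: (@continuousM _ _ (cst (-1))); [exact: cvg_cst|exact: carg].
- move=> t /negP; rewrite negb_and -!leNgt /chi /chi' => /orP[ta|bt].
    have h1 := arg0 _ _ ta; have h2 : arg (a + 2 * w) t <= 0 by apply: arg0; lra.
    rewrite !smooth_step_le0// !smooth_step'_out; [|by left|by left].
    by rewrite mul0r !mulr0 addr0.
  have h1 : 1 <= arg a t by apply: arg1; lra.
  have h2 : 1 <= arg (a + 2 * w) t by apply: arg1; lra.
  rewrite !smooth_step_ge1// !smooth_step'_out; [|by right|by right].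
  by rewrite mul0r mulr1 mulr0 addr0 subrr.
split.
  exists (1 + B / w + B / w) => t.
  have Bw : 0 < B / w by rewrite divr_gt0.
  have q s : 0 <= P' (arg s t) / w <= B / w.
    by rewrite divr_ge0 ?smooth_step'_ge0 ?(ltW w0)//= ler_wpM2r// invr_ge0 ltW.
  have /andP[q1 q2] := q a; have /andP[q3 q4] := q (a + 2 * w).
  have := @smooth_step_ge0 R (arg a t); have := @smooth_step_ge0 R (arg (a + 2 * w) t).
  have := @smooth_step_le1 R (arg a t); have := @smooth_step_le1 R (arg (a + 2 * w) t).
  by rewrite /chi /chi' !mulN1r !ler_norml => *; split; apply/andP; split; lra.
exists (a + w / 3), (a + 2 * w / 3), (k / w); split; try lra.
  by rewrite divr_gt0.
move=> t /andP[h1 h2]; rewrite /chi' (smooth_step'_out (t := arg (a + 2 * w) t)).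
  rewrite mul0r mulr0 addr0 ler_wpM2r ?invr_ge0 ?(ltW w0)// Pk// argE.
  by rewrite ler_pdivlMr// ler_pdivrMr//; apply/andP; split; lra.
by left; apply: arg0; lra.
Qed.

End shell_bump.

(** * A radial bump and its energy *)

Section radial_bump.
Context (R : realType) (m : nat).
Local Notation n := m.+1.
Local Notation RN := 'rV[R]_n.
Local Notation mu := (lebesgue_rV R n).
Local Notation leb := (@lebesgue_measure R).
Context (p : R) (V : R -> \bar R) (r1 r2 : R).
Hypotheses (p0 : 0 < p) (pn : p < n%:R) (r10 : 0 < r1) (r12 : r1 < r2).
Hypothesis V0 : forall r, 0 < r -> (0 <= V r)%E.
Hypothesis mV : lebesgue_measurable_fun `]0, +oo[ V.
Hypothesis iV : (\int[leb]_(r in `]r1, r2[) V r < +oo)%E.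

Local Notation S := (@enorm R n @^-1` `]r1, r2[%classic).

Let r20 : 0 < r2. Proof. exact: lt_trans r12. Qed.
Let mS : measurable S. Proof. exact: measurable_enorm_preimage. Qed.
Let sub0r2 : `]r1, r2[%classic `<=` `]0, r2[%classic.
Proof. by move=> r; rewrite /= !in_itv/= => /andP[h1 ->]; rewrite (lt_trans r10). Qed.

(** V is replaced by a Borel version, for which the integral is additive, and the bound on the
    radial density reduces finiteness to that of the integral of V over []r1, r2[]. *)
Lemma integral_shell_lty (f : RN -> \bar R) (k c : R) : 0 <= k -> 0 <= c ->
  {ae mu, forall x, (f x <= ((fun x => (k%:E + V (enorm x) * c%:E)) \_ S) x)%E} ->
  (\int[mu]_x f x < +oo)%E.
Proof.
move=> k0 c0 fle.
have mD : measurable (`]0%R, +oo[%classic : set R) by exact: measurable_itv.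
have V0' r : `]0%R, +oo[%classic r -> (0 <= V r)%E.
  by rewrite /= in_itv/= andbT; exact: V0.
have [V1 [mV1 V10 VV1]] := lebesgue_measurable_fun_Borel mD mV V0'.
have ccE : (0 <= c%:E)%E by rewrite lee_fin.
have kkE : (0 <= k%:E)%E by rewrite lee_fin.
pose F r := (k%:E + V1 r * c%:E)%E.
have mVc : measurable_fun setT (fun r => V1 r * c%:E)%E.
  by under eq_fun do rewrite muleC; apply: (measurable_funeM c%:E) mV1.
have mF : measurable_fun setT F by apply: emeasurable_funD.
have Vc0 r : (0 <= V1 r * c%:E)%E by rewrite mule_ge0.
have F0 r : (0 <= F r)%E by rewrite adde_ge0.
apply: (@le_lt_trans _ _ (\int[mu]_(x in S) F (enorm x))%E).
  rewrite [leRHS]integral_mkcond; apply: le_integral_ae.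
  have := @ae_enorm R m _ VV1; have := @ae_enorm_gt0 R m.
  move: fle; apply: filterS3 => x fx x0 VE; apply: (le_trans fx).
  rewrite !patchE; case: ifPn => // _.
  by rewrite VE//= in_itv/= x0.
have := @ge0_integral_radial_le R m r2 _ F r20 (measurable_itv `]r1, r2[) sub0r2 mF F0.
move/le_lt_trans; apply.
apply: lte_mul_pinfty; rewrite ?lee_fin ?(ltW (radial_density_bound_gt0 _ _))//.
have mD' := @measurable_itv R `]r1, r2[.
have mVcD : measurable_fun `]r1, r2[ (fun r => V1 r * c%:E)%E by exact: measurable_funTS.
have mV1D : measurable_fun `]r1, r2[ V1 by exact: measurable_funTS.
rewrite /F ge0_integralD//.
apply: lte_add_pinfty.
  rewrite integral_cst//= lebesgue_measure_itv/= lte_fin r12 -EFinD -EFinM.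
  exact: ltry.
under eq_integral do rewrite muleC.
rewrite ge0_integralZl//.
apply: lte_mul_pinfty => //.
apply: le_lt_trans iV; rewrite integral_mkcond [leRHS]integral_mkcond.
apply: le_integral_ae; move: VV1.
apply: (@filterS _ _ (ae_filter_ringOfSetsType leb)) => r VE; rewrite !patchE; case: ifPn => //.
rewrite inE /= in_itv/= => /andP[h1 _]; rewrite VE//= in_itv/= andbT.
exact: lt_trans h1.
Qed.

Lemma bounded_shell_Lfun (f : RN -> R) (B q : R) : 0 < q -> measurable_fun setT f ->
  {ae mu, forall x, `|f x| <= B /\ (~ S x -> f x = 0)} -> f \in Lfun mu q%:E.
Proof.
move=> q0 mf fB; rewrite inE; apply/andP; split; first by rewrite inE.
rewrite inE /= /finite_norm unlock; apply: poweR_lty.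
apply: (@integral_shell_lty _ (`|B| `^ q) 0); rewrite ?powR_ge0//.
apply: filterS fB => x [xB x0]; rewrite patchE mule0 adde0 poweR_EFin.
case: ifPn => [_|]; last by rewrite notin_setE => /x0 ->; rewrite normr0 powR0 ?gt_eqF.
by rewrite lee_fin ge0_ler_powR ?nnegrE ?(ltW q0)// (le_trans xB)// ler_norm.
Qed.

Context (chi chi' : R -> R) (M : R).
Hypothesis schi : smooth chi.
Hypothesis dchi : forall t : R, is_derive t (1 : R) chi (chi' t).
Hypothesis chi0 : forall t, ~ (r1 ^+ 2 < t < r2 ^+ 2) -> chi t = 0 /\ chi' t = 0.
Hypothesis chiM : forall t, `|chi t| <= M /\ `|chi' t| <= M.

Local Notation u := (@radial_smooth R n chi).

(** By the chain rule, the length at radius [r] of the gradient of chi(|x|^2). *)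
Definition radial_slope (r : R) : R := 2 * `|chi' (r ^+ 2)| * r.
Local Notation slope := radial_slope.

Let out (x : RN) : ~ S x -> ~ (r1 ^+ 2 < enorm x ^+ 2 < r2 ^+ 2).
Proof.
move=> nS /andP[h1 h2]; apply: nS; rewrite /= in_itv/=; apply/andP; split.
  by move: h1; rewrite ltr_pXn2r ?nnegrE ?enorm_ge0// ltW.
by move: h2; rewrite ltr_pXn2r ?nnegrE ?enorm_ge0// ltW.
Qed.

Let Ck_u : Ck 1 u. Proof. exact: Ck_radial_smooth. Qed.

Let weak_u : is_weak_gradient u (weak_gradient u).
Proof. exact: (xgetPex _ (ex_intro _ _ (Ck_weak_gradient Ck_u))). Qed.

Lemma ae_enorm_weak_gradient :
  {ae mu, forall x, enorm (weak_gradient u x) = slope (enorm x)}.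
Proof.
have := weak_gradient_unique weak_u (Ck_weak_gradient Ck_u).
apply: filterS => x ->; rewrite /radial_slope.
have -> : \row_i partial i u x = (2 * chi' (enorm x ^+ 2)) *: x.
  apply/rowP => i; rewrite !mxE.
  rewrite /partial; have [_ ->] := is_derive_radial_smooth i x dchi.
  by rewrite -!mulrA; congr (2 * _); rewrite mulrC.
by rewrite enormZ normrM ger0_norm.
Qed.

Let M0 : 0 <= M. Proof. by have [h _] := chiM 0; exact: le_trans h. Qed.

Let slope0 x : ~ S x -> slope (enorm x) = 0.
Proof. by move=> /out /chi0[_ h]; rewrite /radial_slope h normr0 mulr0 mul0r. Qed.

Let u0 x : ~ S x -> u x = 0. Proof. by move=> /out /chi0[]. Qed.

Let slope_ge0 (x : RN) : 0 <= slope (enorm x).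
Proof. by rewrite /radial_slope !mulr_ge0// enorm_ge0. Qed.

Let slopeM (x : RN) : slope (enorm x) <= 2 * M * r2.
Proof.
have [xS|/slope0 ->] := pselect (S x); last by rewrite !mulr_ge0// ltW.
rewrite /radial_slope ler_pM ?mulr_ge0 ?enorm_ge0//; last first.
  by move: xS; rewrite /= in_itv/= => /andP[_ /ltW].
by rewrite ler_wpM2l//; have [] := chiM (enorm x ^+ 2).
Qed.

Lemma radial_bump_Wr : Wr p V u.
Proof.
split; last by exists (fun r => chi (r ^+ 2)); exact: nearW.
split; last first.
  apply: (@integral_shell_lty _ 0 (M `^ p)); rewrite ?powR_ge0//.
  apply: filterS (@ae_enorm_gt0 R m) => x x0; rewrite patchE add0e.
  case: ifPn => [_|]; last first.
    by rewrite notin_setE => /u0 ->; rewrite normr0 powR0 ?gt_eqF// mule0.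
  apply: lee_wpmul2l; first exact: V0.
  rewrite lee_fin ge0_ler_powR ?nnegrE ?(ltW p0)//.
  by have [] := chiM (enorm x ^+ 2).
split.
- apply: (@bounded_shell_Lfun _ M).
  + by rewrite /sobolev_exponent divr_gt0 ?mulr_gt0 ?subr_gt0.
  + by apply: continuous_measurable_rV; exact: Ck_continuous Ck_u.
  + apply: nearW => x; split; last exact: u0.
    by have [] := chiM (enorm x ^+ 2).
- by exists (weak_gradient u).
apply: (@bounded_shell_Lfun _ (2 * M * r2)) => //.
  apply: measurable_enorm_comp => i; apply: locally_L1_measurable.
  by have [_ /(_ i)[]] := weak_u.
apply: filterS ae_enorm_weak_gradient => x ->; split; last exact: slope0.
by rewrite ger0_norm.
Qed.

(** The integrand of the norm with the classical gradient in place of the representative that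
    [weak_gradient] selects, so that it can be estimated at every point. *)
Definition radial_energy (x : RN) : \bar R :=
  ((slope (enorm x) `^ p)%:E + V (enorm x) * (`|u x| `^ p)%:E)%E.
Local Notation energy := radial_energy.

Lemma Wnorm_radial_bump : Wnorm p V u = ((\int[mu]_x energy x) `^ p^-1)%E.
Proof.
have E : (\int[mu]_x ((enorm (weak_gradient u x) `^ p)%:E + V (enorm x) * (`|u x| `^ p)%:E)
    = \int[mu]_x energy x)%E.
  apply: eq_integral_ae.
  by apply: filterS ae_enorm_weak_gradient => x; rewrite /radial_energy => ->.
by rewrite /Wnorm E.
Qed.

Lemma radial_bump_energy_ge0 x : (0 <= energy x)%E.
Proof.
rewrite adde_ge0 ?lee_fin ?powR_ge0//.
have [xS|/u0 ->] := pselect (S x); last by rewrite normr0 powR0 ?gt_eqF// mule0.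
rewrite mule_ge0 ?lee_fin ?powR_ge0// V0//.
by move: xS; rewrite /= in_itv/= => /andP[h _]; exact: lt_trans h.
Qed.

Lemma radial_bump_energy_lty : (\int[mu]_x energy x < +oo)%E.
Proof.
apply: (@integral_shell_lty _ ((2 * M * r2) `^ p) (M `^ p)); rewrite ?powR_ge0//.
apply: filterS (@ae_enorm_gt0 R m) => x x0; rewrite patchE /radial_energy; case: ifPn => [_|].
  apply: leeD; first by rewrite lee_fin ge0_ler_powR ?nnegrE ?(ltW p0)// (le_trans _ (slopeM x)).
  apply: lee_wpmul2l; first exact: V0.
  rewrite lee_fin ge0_ler_powR ?nnegrE ?(ltW p0)//.
  by have [] := chiM (enorm x ^+ 2).
rewrite notin_setE => xS; rewrite slope0// u0// normr0 powR0 ?gt_eqF// mule0 adde0.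
by [].
Qed.

(** The weight may vanish, so positivity comes from the gradient, whose length is at least 2 k
    sqrt(c) on the shell c <= |x|^2 < d. *)
Lemma radial_bump_energy_gt0 (c d k : R) :
  r1 ^+ 2 < c -> c < d -> d < r2 ^+ 2 -> 0 < k -> (forall t, c <= t <= d -> k <= chi' t) ->
  (0 < \int[mu]_x energy x)%E.
Proof.
move=> ac cd db k0 hk; pose s := Num.sqrt c; pose t := Num.sqrt d.
have c0 : 0 < c by apply: lt_trans ac; rewrite exprn_gt0.
have d0 : 0 < d by exact: lt_trans cd.
have s0 : 0 < s by rewrite sqrtr_gt0.
have st : s < t by rewrite ltr_sqrt.
pose T : set RN := @enorm R n @^-1` `[s, t[%classic.
have mT : measurable T by exact: measurable_enorm_preimage.
pose kappa := (2 * k * s) `^ p.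
have ka0 : 0 < kappa by rewrite powR_gt0// !mulr_gt0.
have muT : mu T = (unit_ball_volume R n * (t ^+ n - s ^+ n))%:E.
  exact: (@lebesgue_rV_shell R m s t s0 (ltW st)).
have : (0 < \int[mu]_x ((cst kappa%:E) \_ T) x)%E.
  have -> : (\int[mu]_x ((cst kappa%:E) \_ T) x = kappa%:E * mu T)%E.
    by rewrite -integral_mkcond integral_cst.
  rewrite muT -EFinM lte_fin.
  rewrite mulr_gt0// mulr_gt0 ?unit_ball_volume_gt0// subr_gt0.
  by rewrite ltrXn2r// ltW.
move/lt_le_trans; apply; apply: le_integral_ae; apply: nearW => x; rewrite patchE.
case: ifPn => [|_]; last exact: radial_bump_energy_ge0.
rewrite inE /T/= in_itv/= => /andP[sx xt].
have x0 : 0 < enorm x by exact: lt_le_trans sx.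
apply: (@le_trans _ _ (slope (enorm x) `^ p)%:E); last first.
  by rewrite leeDl// mule_ge0 ?V0// lee_fin powR_ge0.
rewrite lee_fin ge0_ler_powR ?nnegrE ?(ltW p0) ?slope_ge0//.
  by rewrite !mulr_ge0// ltW.
rewrite /radial_slope -!mulrA ler_wpM2l// ler_pM ?(ltW k0) ?(ltW s0)//.
rewrite (le_trans _ (ler_norm _))// hk//; apply/andP; split.
  by rewrite -(sqr_sqrtr (ltW c0)) lerXn2r ?nnegrE ?enorm_ge0 ?sqrtr_ge0.
by rewrite -(sqr_sqrtr (ltW d0)) lerXn2r ?nnegrE ?enorm_ge0 ?sqrtr_ge0// ltW.
Qed.

End radial_bump.

(** * Normalisation and nonemptiness of the supremum *)

Section nonempty.
Context (R : realType) (m : nat).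
Local Notation n := m.+1.
Local Notation RN := 'rV[R]_n.
Local Notation mu := (lebesgue_rV R n).
Local Notation leb := (@lebesgue_measure R).
Context (p : R) (V : R -> \bar R) (K : R -> R).
Hypotheses (p0 : 0 < p) (pn : p < n%:R).
Hypothesis V0 : forall r, 0 < r -> (0 <= V r)%E.
Hypothesis mV : lebesgue_measurable_fun `]0, +oo[ V.
Hypothesis iV : exists r1 r2 : R, [/\ 0 < r1, r1 < r2 &
  (\int[leb]_(r in `]r1, r2[) V r < +oo)%E].

Lemma exists_Wr_unit : exists2 u : RN -> R, Wr p V u & Wnorm p V u = 1%E.
Proof.
have [r1 [r2 [r10 r12 iV12]]] := iV.
have r20 : 0 < r2 by exact: lt_trans r12.
have [|chi [chi' [schi dchi _ chi0 [[M chiM] [c [d [k [ac cd db k0 hk]]]]]]]] :=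
    @exists_smooth_bump R (r1 ^+ 2) (r2 ^+ 2).
  by rewrite ltrXn2r// ltW.
have I0 := @radial_bump_energy_gt0 R m p V r1 r2 p0 r10 r12 V0 chi chi' chi0 c d k ac cd db k0 hk.
have Ioo := @radial_bump_energy_lty R m p V r1 r2 p0 r10 r12 V0 mV iV12 chi chi' M chi0 chiM.
case IE : (\int[mu]_x radial_energy p V chi chi' x)%E I0 Ioo => [i||]//; rewrite lte_fin => i0 _.
(* The energy is homogeneous of degree p, so this factor brings its integral from [i] to 1. *)
pose l := i `^ (- p^-1); have l0 : 0 < l by rewrite powR_gt0.
pose lchi t := l * chi t; pose lchi' t := l * chi' t.
have slchi : smooth lchi by move=> j; apply: smooth_uptoM; [exact: smooth_cst|exact: schi].
have dlchi t : is_derive t (1 : R) lchi (lchi' t) by exact: (is_deriveZ (l : R) (dchi t)).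
have lchi0 t : ~ (r1 ^+ 2 < t < r2 ^+ 2) -> lchi t = 0 /\ lchi' t = 0.
  by move=> /chi0[h h']; rewrite /lchi /lchi' h h' mulr0.
have lchiM t : `|lchi t| <= l * M /\ `|lchi' t| <= l * M.
  by have [h h'] := chiM t; rewrite !normrM (gtr0_norm l0) !ler_pM2l.
exists (radial_smooth lchi).
  exact: (@radial_bump_Wr R m p V r1 r2 p0 pn r10 r12 V0 mV iV12 lchi lchi' (l * M)).
rewrite (@Wnorm_radial_bump R m p V _ _ slchi dlchi).
have e0 (x : RN) : (0 <= radial_energy p V chi chi' x)%E.
  exact: (@radial_bump_energy_ge0 R m p V r1 r2 p0 r10 r12 V0 chi chi').
have lp0 : 0 < l `^ p by exact: powR_gt0.
have lpV : (l `^ p)^-1 = i by rewrite /l -powRrM mulNr mulVf ?gt_eqF// powR_inv1 ?invrK// ltW.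
have eE (x : RN) : radial_energy p V lchi lchi' x = ((l `^ p)%:E * radial_energy p V chi chi' x)%E.
  rewrite /radial_energy muleDr ?fin_num_adde_defr//.
  congr (_ + _)%E.
    rewrite -EFinM -powRM ?(ltW l0)//; last by rewrite /radial_slope !mulr_ge0// enorm_ge0.
    by rewrite /radial_slope /lchi' normrM (gtr0_norm l0); congr ((_ `^ _)%:E); ring.
  rewrite muleCA -EFinM -powRM ?(ltW l0)//.
  by rewrite /radial_smooth /lchi normrM (gtr0_norm l0).
have -> : (\int[mu]_x radial_energy p V lchi lchi' x = 1)%E.
  under eq_integral do rewrite eE.
  (* Equality comes from the one-sided scaling, used with the factor l^p and with its inverse. *)
  apply/eqP; rewrite eq_le; apply/andP; split.
    apply: (le_trans (le_integralZ mu lp0 e0)).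
    by rewrite IE -EFinM -lpV divff ?gt_eqF.
  have le0 (x : RN) : (0 <= (l `^ p)%:E * radial_energy p V chi chi' x)%E.
    by rewrite mule_ge0// lee_fin ltW.
  have lpV0 : 0 < (l `^ p)^-1 by rewrite invr_gt0.
  have := le_integralZ mu lpV0 le0.
  under eq_integral do rewrite muleA -EFinM mulVf ?gt_eqF// mul1e.
  rewrite IE lpV; set J := (\int[mu]_x _)%E; rewrite -lee_pdivrMl// -EFinM mulVf ?gt_eqF//.
by rewrite poweR1r.
Qed.

Hypothesis K0 : forall r, 0 < r -> 0 < K r.

(* Not automatic: the supremum of the empty set is -oo. *)
Lemma R0_ge0 (q r : R) : (0 <= R0 n p V K q r)%E.
Proof.
have [u Wu u1] := exists_Wr_unit.
apply: (@le_trans _ _ (\int[mu]_(x in eball r)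
    (K (enorm x) * `|u x| `^ (q - 1) * `|u x|)%:E)%E).
  rewrite integral_mkcond; apply: integral_ae_ge0.
  apply: filterS (@ae_enorm_gt0 R m) => x x0; rewrite patchE; case: ifPn => // _.
  by rewrite lee_fin !mulr_ge0 ?powR_ge0// ltW// K0.
apply: ereal_sup_ubound; exists u, u; split => //.
by case: Wu.
Qed.

End nonempty.

Theorem theorem2p7 (R : realType) (N : nat) (p : R) (V : R -> \bar R) (K : R -> R)
    (hN : (3 <= N)%N) (hp : 1 < p < N%:R)
    (hV0 : forall r, 0 < r -> (0 <= V r)%E)
    (hVm : lebesgue_measurable_fun `]0, +oo[ V)
    (hV1 : exists r1 r2 : R, [/\ 0 < r1, r1 < r2 &
       (\int[lebesgue_measure]_(r in `]r1, r2[) V r < +oo)%E])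
    (hK0 : forall r, 0 < r -> 0 < K r)
    (hKm : lebesgue_measurable_fun `]0, +oo[ K)
    (hKs : exists s : R, 1 < s /\ forall a b : R, 0 < a -> a < b ->
       (\int[lebesgue_measure]_(r in `[a, b]) (K r `^ s)%:E < +oo)%E)
    (R1 : R) (hR1 : 0 < R1)
    (hVfin : {ae lebesgue_measure, forall r, r \in `]0, R1[ -> (V r < +oo)%E})
    (alpha0 beta0 gamma0 : R) (hbeta0 : 0 <= beta0 <= 1)
    (hess_sup :
       (ess_sup (mrestr lebesgue_measure (measurable_itv `]0%R, R1[))
          (fun r => (K r)%:E / ((r `^ alpha0)%:E * V r `^ beta0)) < +oo)%E)
    (hgamma0 : p <= gamma0)
    (hess_inf :
       (0 < ess_inf (mrestr lebesgue_measure (measurable_itv `]0%R, R1[))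
          (fun r => (r `^ gamma0)%:E * V r))%E) :
  forall q1 : R, region N p beta0 gamma0 (alpha0, q1) ->
    R0 N p V K q1 r @[r --> 0^'+] --> 0%E.
Proof.
move=> q1 hq; have /andP[p1 pN] := hp; have p0 : 0 < p by exact: lt_trans p1.
case: N hN hp pN hq => [|[|m]]// _ pN' pN hq.
have [q11 pbq hq1 hq2] := region_inequalities pN' hq.
have /andP[_ b1] := hbeta0.
have [c [L [c0 L0 hfact]]] := ae_weight_bounds hV0 hVfin hess_sup hess_inf.
have small : forall eta : R, 0 < eta -> exists2 rho0 : R, 0 < rho0 &
    forall rho, 0 < rho -> rho < rho0 -> (R0 m.+2 p V K q1 rho <= eta%:E)%E.
  have [qp|pq] := ltP q1 p.
    exact: (R0_small_subcritical p1 hV0 hR1 c0 L0 hfact q11 pbq qp hq1).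
  exact: (R0_small_supercritical p1 hV0 hR1 c0 L0 hfact b1 hgamma0 pq hq2).
have ge0 r : (0 <= R0 m.+2 p V K q1 r)%E by exact: R0_ge0.
have near_le eta : 0 < eta -> \forall r \near 0^'+, (R0 m.+2 p V K q1 r <= eta%:E)%E.
  move=> /small[rho0 rho00 h]; near=> r; apply: h; first by [].
  by near: r; exact: nbhs_right_lt.
(* Near 0 the supremum lies between 0 and 1, hence is finite, and its real value is eventually at
   most any given [eta]. *)
apply/fine_cvgP; split.
  apply: filterS (near_le 1 ltr01) => r hr.
  by rewrite ge0_fin_numE//; apply: le_lt_trans hr _; exact: ltry.
apply/cvgrPdist_le => eta eta0; apply: filterS (near_le eta eta0) => r hr.
rewrite /= sub0r normrN ger0_norm; last exact: fine_ge0.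
by rewrite -lee_fin fineK// ge0_fin_numE//; apply: le_lt_trans hr _; exact: ltry.
Unshelve. all: by end_near. Qed.
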